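(* Let $f\in\mathcal F(\mathbb R^n)$ and let $E,H$ be linear subspaces of $\mathbb R^n$ with $\dim E=i$, $\dim H=j$, where $i,j\in\{2,\dots,n-1\}$, $i+j\ge n+1$, and $E^\perp\subset H$. Put $k=i+j-n$, so that $1\le k\le n-2$. Then $$\int_{E\cap H}P_{E\cap H}f(w)\,dw\,\int_{\mathbb R^n}f(z)\,dz\le\binom{n-k}{n-i}\int_EP_Ef(x)\,dx\,\int_HP_Hf(y)\,dy .$$
   Context: $\mathcal F(\mathbb R^n)$ is the set of integrable log-concave functions $f:\mathbb R^n\to[0,\infty)$, i.e. $f((1-\lambda)x+\lambda y)\ge f(x)^{1-\lambda}f(y)^\lambda$ for all $x,y\in\mathbb R^n$, $\lambda\in[0,1]$. For a linear subspace $F$, $P_Ff(x)=\sup\{f(y):y\in x+F^\perp\}$ for $x\in F$. Integrals over subspaces are with respect to Lebesgue measure of the corresponding dimension. *)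

(* Defs.v *)
From HB Require Import structures.
From mathcomp Require Import all_boot all_order all_algebra.
From mathcomp Require Import all_classical all_reals all_analysis.

Set Implicit Arguments.
Unset Strict Implicit.
Unset Printing Implicit Defensive.

Import Order.TTheory GRing.Theory Num.Theory.
Import numFieldNormedType.Exports.

Local Open Scope classical_set_scope.
Local Open Scope ring_scope.

(* R^n is 'rV[R]_n with the sigma-algebra generated by the coordinates, as the
   library does for n.-tuple; it is the Borel sigma-algebra. *)
Section borel_rV.
Context (R : realType) (n : nat).

Definition coord_rV (i : 'I_n) (v : 'rV[R]_n) : measurableTypeR R := v ord0 i.

Let rV_set0 : g_sigma_preimage coord_rV set0.
Proof. exact: sigma_algebra0. Qed.

Let rV_setC A : g_sigma_preimage coord_rV A -> g_sigma_preimage coord_rV (~` A).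
Proof. exact: sigma_algebraC. Qed.

Let rV_bigcup (F : _^nat) : (forall i, g_sigma_preimage coord_rV (F i)) ->
  g_sigma_preimage coord_rV (\bigcup_i (F i)).
Proof. exact: sigma_algebra_bigcup. Qed.

HB.instance Definition _ :=
  @isMeasurable.Build default_measure_display 'rV[R]_n
    (g_sigma_preimage coord_rV) rV_set0 rV_setC rV_bigcup.

Lemma measurable_coord_rV (i : 'I_n) : measurable_fun setT (coord_rV i).
Proof.
move=> _ Y mY; rewrite setTI; apply: sub_sigma_algebra => /=.
rewrite -bigcup_seq/=; exists i => /=; first by rewrite mem_index_enum.
by exists Y => //; rewrite setTI.
Qed.

Lemma measurable_fun_rV d (T : measurableType d) (f : T -> 'rV[R]_n) :
  (forall i, measurable_fun setT (fun x => coord_rV i (f x))) ->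
  measurable_fun setT f.
Proof.
move=> mf _ A; rewrite setTI => mA.
suff: g_sigma_preimage (fun i x => coord_rV i (f x)) `<=` measurable.
  by apply; rewrite (g_sigma_preimage_comp coord_rV f); exists A; rewrite ?setTI.
apply: smallest_sub; first exact: sigma_algebra_measurable.
rewrite -bigcup_seq; apply: bigcup_sub => i _ B [C mC <-].
exact: mf.
Qed.

End borel_rV.

Definition cons_rV (R : realType) (n : nat)
  (p : measurableTypeR R * 'rV[R]_n) : 'rV[R]_n.+1 :=
  row_mx (p.1%:M : 'rV[R]_1) p.2.

Definition behead_rV (R : realType) (n : nat)
  (v : 'rV[R]_n.+1) : measurableTypeR R * 'rV[R]_n :=
  (v ord0 ord0, rsubmx (v : 'rV[R]_(1 + n))).

Section cons_rV.
Context (R : realType) (n : nat).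

Lemma cons_rV0 (p : measurableTypeR R * 'rV[R]_n) : cons_rV p ord0 ord0 = p.1.
Proof.
rewrite /cons_rV mxE; case: splitP => [j _|//].
by rewrite !ord1 mxE.
Qed.

Lemma cons_rVS (p : measurableTypeR R * 'rV[R]_n) (i : 'I_n) :
  cons_rV p ord0 (lift ord0 i) = p.2 ord0 i.
Proof.
rewrite /cons_rV mxE; case: splitP => [j|j [ij]]; first by rewrite ord1.
by congr (_ _ _); apply: val_inj.
Qed.

Lemma measurable_cons_rV :
  measurable_fun [set: measurableTypeR R * 'rV[R]_n] (@cons_rV R n).
Proof.
apply: measurable_fun_rV => i; rewrite /coord_rV.
case: (unliftP ord0 i) => [j|] ->.
  under eq_fun do rewrite cons_rVS.
  exact: (measurableT_comp (measurable_coord_rV j)).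
under eq_fun do rewrite cons_rV0.
exact: measurable_fst.
Qed.

Lemma measurable_behead_rV : measurable_fun setT (@behead_rV R n).
Proof.
apply/measurable_fun_pairP; split; first exact: measurable_coord_rV.
apply: measurable_fun_rV => i /=.
rewrite (_ : (fun _ => _) = coord_rV (lift ord0 i)).
  exact: measurable_coord_rV.
apply/funext => v; rewrite /coord_rV /= mxE.
by congr (_ _ _); apply: val_inj.
Qed.

Lemma cons_rVK : cancel (@cons_rV R n) (@behead_rV R n).
Proof.
move=> [a v]; rewrite /behead_rV cons_rV0; congr pair.
by apply/rowP => i; rewrite mxE -[RHS](cons_rVS (a, v)); congr (_ _ _); apply: val_inj.
Qed.

Lemma behead_rVK : cancel (@behead_rV R n) (@cons_rV R n).
Proof.
move=> v; apply/rowP => i; case: (unliftP ord0 i) => [j|] ->.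
  by rewrite cons_rVS mxE; congr (_ _ _); apply: val_inj.
by rewrite cons_rV0.
Qed.

Variable m : {sigma_finite_measure set 'rV[R]_n -> \bar R}.

Definition pcons_rV : set 'rV[R]_n.+1 -> \bar R :=
  pushforward (@lebesgue_measure R \x m)%E (@cons_rV R n).

HB.instance Definition _ := Measure.copy pcons_rV
  (measure_function_pushforward__canonical__measure_function_Measure
     (@lebesgue_measure R \x m)%E measurable_cons_rV).

Let pcons_rV_sigma_finite : sigma_finite setT pcons_rV.
Proof.
have /sigma_finiteP[F [TF ndF Foo]] := sigma_finiteT (@lebesgue_measure R).
have /sigma_finiteP[G [TG ndG Goo]] := sigma_finiteT m.
have cons_behead A : @cons_rV R n @^-1` (@behead_rV R n @^-1` A) = A.
  by apply/seteqP; split=> p; rewrite /preimage /= cons_rVK.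
exists (fun k => @behead_rV R n @^-1` (F k `*` G k)).
  rewrite -preimage_bigcup [X in _ @^-1` X](_ : _ = setT) ?preimage_setT//.
  rewrite -setXTT TF TG predeqE => -[x y]; split.
    by move=> [k _ []/= ? ?]; split; exists k.
  move=> [/= [k _ Fkx] [l _ Gly]]; exists (maxn k l) => //; split.
    by move: x Fkx; exact/subsetPset/ndF/leq_maxl.
  by move: y Gly; exact/subsetPset/ndG/leq_maxr.
move=> k; have [mF muF] := Foo k; have [mG mG_oo] := Goo k; split.
  by rewrite -[X in measurable X]setTI; apply: measurable_behead_rV => //;
    exact: measurableX.
rewrite /pcons_rV /pushforward cons_behead product_measure1E//.
by rewrite lte_mul_pinfty// ge0_fin_numE.
Qed.

HB.instance Definition _ :=
  Measure_isSigmaFinite.Build _ _ _ pcons_rV pcons_rV_sigma_finite.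

End cons_rV.

(* lambda_0 is the point mass and lambda_(n+1) = lambda_1 x lambda_n. *)
Fixpoint borel_lebesgue_rV (R : realType) (n : nat) :
    {sigma_finite_measure set 'rV[R]_n -> \bar R} :=
  if n is m.+1 then pcons_rV (borel_lebesgue_rV R m) else \d_(0 : 'rV[R]_0).

Lemma borel_lebesgue_rV_box (R : realType) (n : nat)
    (A : 'I_n -> set (measurableTypeR R)) : (forall i, measurable (A i)) ->
  borel_lebesgue_rV R n [set v | forall i, A i (v ord0 i)] =
  (\prod_(i < n) lebesgue_measure (A i))%E.
Proof.
elim: n A => [|n IHn] A mA /=.
  rewrite big_ord0 diracE mem_set//.
  by case.
rewrite big_ord_recl /pcons_rV /pushforward.
transitivity ((@lebesgue_measure R \x borel_lebesgue_rV R n)%E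
    (A ord0 `*` [set v : 'rV[R]_n | forall i, A (lift ord0 i) (v ord0 i)])); last first.
  rewrite product_measure1E//.
    by congr (_ * _)%E; exact: (IHn (fun i => A (lift ord0 i))).
  rewrite (_ : [set _ | _] = \bigcap_(i in [set: 'I_n])
    (coord_rV i @^-1` A (lift ord0 i))); last first.
    by apply/seteqP; split=> v vA i; [move=> _; exact: vA|exact: (vA i I)].
  apply: fin_bigcap_measurable; first exact: finite_finset.
  move=> i _.
  by rewrite -[X in measurable X]setTI; exact: measurable_coord_rV.
congr (_ _); apply/seteqP; split=> -[a v] /= vA.
  split=> [|i]; first by have := vA ord0; rewrite cons_rV0.
  by have := vA (lift ord0 i); rewrite cons_rVS.
move=> i; case: (unliftP ord0 i) => [j|] ->.
  by rewrite cons_rVS; exact: vA.2.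
by rewrite cons_rV0; exact: vA.1.
Qed.

(* Lebesgue measure proper, on the Lebesgue (completed) sigma-algebra: a
   log-concave function need not be Borel measurable. *)
Definition lebesgue_rV (R : realType) (n : nat) :=
  @completed_measure_extension _ _ _ (borel_lebesgue_rV R n).
Arguments lebesgue_rV : clear implicits.

HB.instance Definition _ (R : realType) (n : nat) :=
  Measure.on (lebesgue_rV R n).

Definition dotv (R : realType) (n : nat) (u v : 'rV[R]_n) : R :=
  (u *m v^T) ord0 ord0.

Definition orthogonal_compl (R : realType) (n : nat) (F : {vspace 'rV[R]_n}) :
    set 'rV[R]_n :=
  [set v | forall u, u \in F -> dotv u v = 0].

Definition orthonormal_basis (R : realType) (n : nat) (F : {vspace 'rV[R]_n})
    (B : 'M[R]_(\dim F, n)) : Prop :=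
  basis_of F [tuple row i B | i < \dim F] /\ B *m B^T = 1%:M.
Arguments orthonormal_basis {R n} F B.

Lemma exists_orthonormal_rows (R : realType) (m n : nat) (A : 'M[R]_(m, n)) :
  row_free A -> exists2 B : 'M[R]_(m, n), B *m B^T = 1%:M & (A == B)%MS.
Proof.
elim: m A => [|m IHm] A fA.
  by exists A; [apply/matrixP => -[]|rewrite submx_refl].
move: A fA; rewrite -[m.+1]/(1 + m)%N => A fA.
pose a : 'rV[R]_n := usubmx A.
pose A' : 'M[R]_(m, n) := dsubmx A.
have AE : A = col_mx a A' by rewrite vsubmxK.
have rA : \rank A = m.+1 by apply/eqP.
have rA' : (\rank A' <= m)%N by exact: rank_leq_row.
have aNA' : ~~ (a <= A')%MS.
  apply/negP => aA'; have : (A <= A')%MS by rewrite AE col_mx_sub aA' submx_refl.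
  by move=> /mxrankS; rewrite rA => h; have := leq_trans h rA'; rewrite ltnn.
have fA' : row_free A'.
  rewrite -row_leq_rank -ltnS -rA AE -addsmxE.
  apply: leq_trans (mxrank_adds_leqif _ _).1 _.
  exact: (leq_add (rank_leq_row a) (leqnn _)).
have [B' B'1 /eqmxP A'B'] := IHm A' fA'.
pose w := a - a *m B'^T *m B'.
have wB' : w *m B'^T = 0.
  by rewrite mulmxBl -(mulmxA (a *m B'^T)) B'1 mulmx1 subrr.
have w0 : w != 0.
  apply: contra aNA'; rewrite subr_eq0 => /eqP ->.
  by rewrite A'B' submxMl.
pose s := (w *m w^T) ord0 ord0.
have s0 : 0 < s.
  have sE : s = \sum_j w ord0 j ^+ 2.
    by rewrite /s mxE; apply: eq_bigr => j _; rewrite [w^T _ _]mxE expr2.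
  rewrite lt_def sE sumr_ge0 ?andbT; last by move=> j _; exact: sqr_ge0.
  apply: contra w0; rewrite psumr_eq0; last by move=> j _; exact: sqr_ge0.
  move=> /allP w0; apply/eqP/rowP => j; rewrite [RHS]mxE; apply/eqP.
  by rewrite -sqrf_eq0; apply: w0; rewrite mem_index_enum.
pose b := (Num.sqrt s)^-1 *: w.
have s'0 : Num.sqrt s != 0 by rewrite gt_eqF// sqrtr_gt0.
have bB' : b *m B'^T = 0 by rewrite -scalemxAl wB' scaler0.
have wE : w = Num.sqrt s *: b by rewrite scalerA divff// scale1r.
have b1 : b *m b^T = 1%:M.
  rewrite linearZ/= -scalemxAl -scalemxAr scalerA.
  rewrite [w *m _]mx11_scalar -/s -invfM -expr2 sqr_sqrtr ?ltW//.
  by rewrite scale_scalar_mx mulVf// gt_eqF.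
exists (col_mx b B').
  rewrite tr_col_mx mul_col_row b1 bB' B'1.
  have -> : B' *m b^T = 0 by apply: trmx_inj; rewrite trmx_mul trmxK bB' trmx0.
  by rewrite -scalar_mx_block.
have aE : a = Num.sqrt s *: b + a *m B'^T *m B' by rewrite -wE subrK.
rewrite AE; apply/andP; split; rewrite col_mx_sub -!addsmxE.
  rewrite {1}aE addmx_sub ?A'B' ?addsmxSr//.
    by rewrite scalemx_sub// addsmxSl.
  by rewrite (submx_trans (submxMl _ _))// addsmxSr.
apply/andP; split; last by rewrite -A'B' addsmxSr.
rewrite scalemx_sub// addmx_sub ?addsmxSl// eqmx_opp.
by rewrite (submx_trans (submxMl _ _))// -A'B' addsmxSr.
Qed.

Lemma exists_orthonormal_basis (R : realType) (n : nat)
    (F : {vspace 'rV[R]_n}) : exists B, orthonormal_basis F B.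
Proof.
pose A : 'M[R]_(\dim F, n) := \matrix_i (vbasis F)`_i.
have rowP' (B : 'M[R]_(\dim F, n)) (v : 'rV[R]_n) :
  (v \in <<[tuple row i B | i < \dim F]>>%VS) = (v <= B)%MS.
  apply/idP/idP => [/coord_span ->|/submxP[c ->]].
    apply: summx_sub => i _; rewrite -tnth_nth tnth_mktuple.
    by rewrite scalemx_sub// row_sub.
  rewrite mulmx_sum_row; apply: memv_suml => i _; apply/memvZ/memv_span.
  by apply/tnthP; exists i; rewrite tnth_mktuple.
have rowA i : row i A = (vbasis F)`_i by rewrite rowK.
have fA : row_free A.
  rewrite -kermx_eq0; apply/rowV0P => v /sub_kermxP; rewrite mulmx_sum_row.
  under eq_bigr do rewrite rowA.
  have /freeP vF := basis_free (vbasisP F).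
  by move=> /vF v0; apply/rowP => i; rewrite v0 mxE.
have [B B1 /eqmxP AB] := exists_orthonormal_rows fA.
exists B; split=> //; rewrite basisEdim size_tuple leqnn andbT.
apply/subvP => v; rewrite rowP' -AB -rowP'.
rewrite (_ : [tuple row i A | i < \dim F] = vbasis F).
  by rewrite (span_basis (vbasisP F)).
by apply: eq_from_tnth => i; rewrite tnth_mktuple rowA -tnth_nth.
Qed.

Definition onb (R : realType) (n : nat) (F : {vspace 'rV[R]_n}) :
    'M[R]_(\dim F, n) :=
  projT1 (cid (exists_orthonormal_basis F)).

(* Lebesgue measure on F is the image of that on R^(dim F) under the isometry
   u |-> u *m onb F; it does not depend on the orthonormal basis chosen. *)
Definition integral_on (R : realType) (n : nat) (F : {vspace 'rV[R]_n})
    (g : 'rV[R]_n -> \bar R) : \bar R :=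
  (\int[lebesgue_rV R (\dim F)]_u g (u *m onb F))%E.

Definition log_concave (R : realType) (n : nat) (f : 'rV[R]_n -> R) : Prop :=
  forall (x y : 'rV[R]_n) (l : R), 0 <= l <= 1 ->
    f x `^ (1 - l) * f y `^ l <= f ((1 - l) *: x + l *: y).

Definition integrable_log_concave (R : realType) (n : nat)
    (f : 'rV[R]_n -> R) : Prop :=
  [/\ forall x, 0 <= f x,
      log_concave f &
      (lebesgue_rV R n).-integrable setT (fun x => (f x)%:E)].

(* Extended-real valued: the supremum may be infinite when f is carried by a
   proper affine subspace. *)
Definition proj_fun (R : realType) (n : nat) (F : {vspace 'rV[R]_n})
    (f : 'rV[R]_n -> R) (x : 'rV[R]_n) : \bar R :=
  ereal_sup [set (f (x + v))%:E | v in orthogonal_compl F].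

(* Main.v *)
Require Import Defs.
From HB Require Import structures.
From mathcomp Require Import all_boot all_order all_algebra.
From mathcomp Require Import all_classical all_reals all_analysis.
From mathcomp Require Import measurable_realfun.
From mathcomp Require Import ring lra zify.

Set Implicit Arguments.
Unset Strict Implicit.
Unset Printing Implicit Defensive.

Import Order.TTheory GRing.Theory Num.Theory.
Import numFieldNormedType.Exports.

Local Open Scope classical_set_scope.
Local Open Scope ring_scope.

(* Write x = w + a + b along the orthogonal decomposition of R^n into E `&` H,
   H^perp and E^perp, of dimensions k, p = n - j and q = n - i, and put
   F(w, a) = sup_b f, G(w, b) = sup_a f and M(w) = sup_(a, b) f.  By Prekopa-Leindler
   one may replace f by a lower semicontinuous log-concave minorant and then, by
   monotone convergence, truncate it to a bounded function of bounded support.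
   Since f <= min(F, G), the integral of f is at most that of |A_z| |B_z| over
   z = (w, s) with 0 < s < M(w), where A_z and B_z are the superlevel sets at height
   s of F(w, .) and G(w, .).  By Brunn-Minkowski and Prekopa-Leindler the measure of
   the set where |A_z|^(1/p) > t is log-concave in t, and likewise for B, so
   Berwald's inequality compares their moments of orders p, resp. q, with those of
   order p + q, the extremal case being an exponential tail; Young's inequality with
   exponents (p + q)/p and (p + q)/q then bounds the product, and the gamma
   integrals m! combine into the binomial coefficient. *)

(** * The layer cake formula *)

(** The sets where [|A_z|] and [|B_z|] are positive have to coincide. Berwald's inequality measures
    moments against the mass [V] of that set; with a common [V], equal to the integral of [M], the
    moments of orders [p] and [q] are [V c^p p!] and [V d^q q!], and those of order [n = p + q] are
    at most [V c^n n!] and [V d^n n!]. Young's inequality bounds the integral of [f] by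
    [V c^p d^q n!], and multiplying by [V] gives the product of the two moments times [n!/(p! q!)].
    This is why the integral over the intersection of [E] and [H] stands on the left. The sets
    coincide because a lower semicontinuous function has open superlevel sets, so that a nonempty
    fiber has positive volume. Lower semicontinuity also survives suprema over subspaces, whereas
    [f] and its projections need not be Borel measurable. Their integrals, over the completed
    measure, are reached through Borel minorants and through the mixing property of the
    regularization, which projections inherit. *)

Lemma measurable_superlevel d (T : measurableType d) (R : realType)
    (f : T -> \bar R) (s : \bar R) :
  measurable_fun setT f -> measurable [set x | (s < f x)%E].
Proof.
move=> mf; rewrite -[X in measurable X]setTI.
exact: emeasurable_fun_o_infty.
Qed.

Section layer_cake.
Context d (T : measurableType d) (R : realType).
Context (mu : {sigma_finite_measure set T -> \bar R}).
Local Open Scope ereal_scope.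

Lemma measurable_subgraph (f : T -> \bar R) : measurable_fun setT f ->
  measurable [set z : T * measurableTypeR R | (z.2 : R)%:E < f z.1].
Proof.
move=> mf; rewrite -[X in measurable X]setTI; apply: measurable_lte => //.
  by apply/measurable_EFinP; exact: measurable_snd.
exact: (measurableT_comp mf).
Qed.

Lemma measurable_distribution_tail (f : T -> \bar R) : measurable_fun setT f ->
  measurable_fun setT (fun s : measurableTypeR R => mu [set x | (s : R)%:E < f x]).
Proof.
move=> /measurable_subgraph/(measurable_fun_ysection mu); congr measurable_fun.
apply/funext => s; rewrite /=; congr (mu _).
by apply/seteqP; split => x; rewrite /ysection /= inE.
Qed.

(** Tonelli for [w s] on the region [0 < s < f x]. The weight serves for moments: [w s = m s^(m-1)]
    produces the integral of [f^m]. *)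
Lemma layer_cake_weight (f : T -> \bar R) (w : R -> R) :
  measurable_fun setT f -> measurable_fun setT w -> (forall s, 0 <= w s)%R ->
  \int[mu]_x \int[lebesgue_measure]_(s in [set s : R | (0 < s)%R /\ s%:E < f x])
     (w s)%:E =
  \int[lebesgue_measure]_(s in `]0%R, +oo[) ((w s)%:E * mu [set x | s%:E < f x]).
Proof.
move=> mf mw w0.
pose S : set (T * measurableTypeR R) :=
  fun z => (0%R < (z.2 : R))%R /\ (z.2 : R)%:E < f z.1.
pose g (z : T * measurableTypeR R) : \bar R := ((w z.2) * \1_S z)%:E.
have m2 : measurable_fun setT (fun z : T * measurableTypeR R => (z.2 : R)%:E).
  apply/measurable_EFinP; exact: measurable_snd.
have mS : measurable S.
  rewrite (_ : S = [set z : T * measurableTypeR R | 0%:E < (z.2 : R)%:E] `&`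
       [set z : T * measurableTypeR R | (z.2 : R)%:E < f z.1]); last first.
    by apply/seteqP; split=> z /=; rewrite lte_fin.
  apply: measurableI; first exact: (measurable_superlevel 0%:E m2).
  exact: measurable_subgraph.
have mg : measurable_fun setT g.
  apply/measurable_EFinP; apply: measurable_funM.
    exact: (measurableT_comp mw).
  exact: measurable_indic.
have g0 z : 0 <= g z by rewrite /g lee_fin mulr_ge0.
transitivity (\int[mu]_x \int[lebesgue_measure]_s g (x, s)).
  apply: eq_integral => x _; rewrite integral_mkcond.
  apply: eq_integral => s _; rewrite patchE /g /=.
  rewrite indicE; case: ifPn; rewrite !(inE, notin_setE) /= => h.
    by rewrite mem_set// mulr1.
  by rewrite memNset// mulr0.
rewrite (fubini_tonelli g)//.
rewrite [RHS]integral_mkcond; apply: eq_integral => s _.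
rewrite patchE; case: ifPn; rewrite !(inE, notin_setE) /= in_itv/= andbT => s0.
  rewrite /g /=; under eq_integral do rewrite EFinM.
  rewrite ge0_integralZl_EFin//; last first.
    apply/measurable_EFinP.
    by apply: (measurableT_comp (measurable_indic mS)) => //; exact: measurable_pair2.
  congr (_ * _).
  rewrite (_ : (fun x => _) = (fun x => (\1_[set x | (s%:E < f x)%E] x)%:E)); last first.
    by apply/funext => x; rewrite !indicE; congr (_%:R%:E); congr (nat_of_bool _);
       apply/idP/idP; rewrite !inE /S /=; tauto.
  by rewrite integral_indic ?setIT//; exact: measurable_superlevel.
by apply: integral0_eq => x _; rewrite /g indicE memNset ?mulr0// => -[].
Qed.

Lemma layer_cake (f : T -> \bar R) :
  measurable_fun setT f -> (forall x, 0 <= f x) ->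
  \int[mu]_x f x =
  \int[lebesgue_measure]_(s in `]0%R, +oo[) mu [set x | s%:E < f x].
Proof.
move=> mf f0.
transitivity (\int[lebesgue_measure]_(s in `]0%R, +oo[) (1%:E * mu [set x | s%:E < f x])).
  rewrite -(@layer_cake_weight f (cst 1%R)) //.
  apply: eq_integral => x _; under eq_integral do rewrite /cst.
  have := f0 x; case: (f x) => [r r0|_|//].
    rewrite (_ : [set s | _] = `]0%R, r[%classic); last first.
      apply/seteqP; split=> s /=; rewrite in_itv /= lte_fin.
        by move=> [-> ->].
      by move=> /andP[].
    rewrite integral_cst// mul1e /= lebesgue_measure_itv/=; case: ifPn => //=.
      by rewrite sube0.
    rewrite lte_fin -leNgt => ?; congr EFin; apply/eqP.
    by rewrite eq_le; apply/andP; split => //; rewrite -lee_fin.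
  rewrite (_ : [set s | _] = `]0%R, +oo[%classic); last first.
    apply/seteqP; split=> s /=; rewrite in_itv /= andbT ?ltry.
      by move=> [].
    by [].
  by rewrite integral_cst// mul1e /= lebesgue_measure_itv/= ltry.
by apply: eq_integral => s _; rewrite mul1e.
Qed.

End layer_cake.

(** * The Prékopa-Leindler inequality *)

Section prekopa_leindler_1d.
Context (R : realType).
Local Notation mu := (@lebesgue_measure R).

Lemma lebesgue_measure_affine (c d : R) (A : set R) : 0 < c -> measurable A ->
  mu ((fun x => c * x + d) @^-1` A) = ((c^-1)%:E * mu A)%E.
Proof.
move=> c0 mA.
have mg : measurable_fun setT (fun x : measurableTypeR R => c * x + d : measurableTypeR R).
  by apply: measurable_funD => //; exact: measurable_funM.
pose nu : {measure set (measurableTypeR R) -> \bar R} :=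
  mscale (NngNum (ltW c0)) (measure_function_pushforward__canonical__measure_function_Measure mu mg).
have nuE : forall X, measurable X -> mu X = nu X.
  apply: lebesgue_measure_unique => _ [[a b] _ <-].
  transitivity (c%:E * mu ((fun x => c * x + d)%R @^-1` `]a, b]%classic))%E; last by [].
  rewrite (_ : _ @^-1` _ = `](a - d) / c, (b - d) / c]%classic); last first.
    apply/seteqP; split => x /=; rewrite !in_itv /= ltr_pdivrMr// ler_pdivlMr// (mulrC x) ltrBlDr lerBrDr//.
  rewrite !lebesgue_measure_itv /= !lte_fin ltr_pM2r ?invr_gt0// ltrD2r.
  case: ifPn => _; last by rewrite mule0.
  by rewrite -!EFinD -EFinM; congr EFin; field; rewrite gt_eqF.
rewrite (nuE _ mA); transitivity ((c^-1)%:E * (c%:E * mu ((fun x => (c * x + d)%R) @^-1` A)))%E; last by [].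
by rewrite muleA -EFinM mulVf ?mul1e// gt_eqF.
Qed.

(** With [a = max A] and [b = min B], the sets [A' = (1 - l) A + l b] and [B' = (1 - l) a + l B] lie
    in [C] on opposite sides of [c = (1 - l) a + l b]. They overlap at most in [c], so their
    measures add up. *)
Lemma brunn_minkowski_compact (l : R) (A B C : set R) : 0 < l < 1 ->
  compact A -> A !=set0 -> compact B -> B !=set0 -> measurable C ->
  (forall x y, A x -> B y -> C ((1 - l) * x + l * y)) ->
  ((1 - l)%:E * mu A + l%:E * mu B <= mu C)%E.
Proof.
move=> /andP[l0 l1] cA A0 cB B0 mC ABC.
have [mA mB] : measurable A /\ measurable B.
  by split; apply: closed_measurable; apply: compact_closed => //; exact: Rhausdorff.
have l1' : 0 < 1 - l by rewrite subr_gt0.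
have [a Aa maxa] : exists2 a, A a & forall x, A x -> x <= a.
  have [|a Aa maxa] := compact_EVT_max (f := id) A0 cA.
    by apply: continuous_subspaceT => x; exact: cvg_id.
  by exists a => [|x Ax]; [exact: set_mem|apply: maxa; exact: mem_set].
have [b Bb minb] : exists2 b, B b & forall x, B x -> b <= x.
  have [|b Bb minb] := compact_EVT_min (f := id) B0 cB.
    by apply: continuous_subspaceT => x; exact: cvg_id.
  by exists b => [|x Bx]; [exact: set_mem|apply: minb; exact: mem_set].
pose A' := (fun x => (1 - l)^-1 * x + - ((1 - l)^-1 * (l * b))) @^-1` A.
pose B' := (fun x => l^-1 * x + - (l^-1 * ((1 - l) * a))) @^-1` B.
have A'E : mu A' = ((1 - l)%:E * mu A)%E.
  by rewrite lebesgue_measure_affine ?invr_gt0// invrK.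
have B'E : mu B' = (l%:E * mu B)%E.
  by rewrite lebesgue_measure_affine ?invr_gt0// invrK.
have mg (u v : R) (X : set R) : measurable X -> measurable ((fun x => u * x + v) @^-1` X).
  move=> mX; rewrite -[X in measurable X]setTI.
  apply: (_ : measurable_fun setT (fun x : measurableTypeR R => u * x + v : measurableTypeR R)) => //.
  by apply: measurable_funD => //; exact: measurable_funM.
pose c := (1 - l) * a + l * b.
have mA' : measurable A' by exact: mg.
have mB' : measurable B' by exact: mg.
have A'C x : A' x -> C x /\ x <= c.
  move=> A'x; have xE : x = (1 - l) * ((1 - l)^-1 * x + - ((1 - l)^-1 * (l * b))) + l * b.
    by field; rewrite gt_eqF.
  split; first by rewrite xE; exact: ABC.
  by rewrite xE lerD2r ler_pM2l//; exact: maxa.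
have B'C x : B' x -> C x /\ c <= x.
  move=> B'x; have xE : x = (1 - l) * a + l * (l^-1 * x + - (l^-1 * ((1 - l) * a))).
    by field; rewrite gt_eqF.
  split; first by rewrite xE; exact: ABC.
  by rewrite xE lerD2l ler_pM2l//; exact: minb.
rewrite -A'E -B'E.
have mc : measurable [set c] by exact: measurable_set1.
have -> : mu B' = mu (B' `\` [set c]).
  apply/eqP; rewrite eq_le; apply/andP; split; last first.
    by apply: le_measure; rewrite ?inE//; exact: measurableD.
  rewrite -[leLHS](_ : mu ((B' `\` [set c]) `|` (B' `&` [set c])) = _); last by rewrite setUC setUIDK.
  rewrite (le_trans (outer_measureU2 _ _ _))//.
  rewrite [X in (_ + X)%E](_ : _ = 0%E) ?adde0//.
  apply/eqP; rewrite eq_le outer_measure_ge0 andbT -(lebesgue_measure_set1 c).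
  by apply: le_outer_measure; exact: subIsetr.
rewrite -measureU//=; last 2 first.
- exact: measurableD.
- apply/seteqP; split => x //= -[/A'C[_ xc] [/B'C[_ cx] xNc]].
  by apply: xNc; apply/eqP; rewrite eq_le xc.
apply: le_measure; rewrite ?inE//; first by apply: measurableU => //; exact: measurableD.
by move=> x [/A'C[]//|[/B'C[]//]].
Qed.

Lemma brunn_minkowski_1d (l : R) (A B C : set R) : 0 < l < 1 ->
  measurable A -> A !=set0 -> measurable B -> B !=set0 -> measurable C ->
  (forall x y, A x -> B y -> C ((1 - l) * x + l * y)) ->
  ((1 - l)%:E * mu A + l%:E * mu B <= mu C)%E.
Proof.
move=> l01 mA [a Aa] mB [b Bb] mC ABC.
have /andP[l0 l1] := l01.
have l1' : 0 < 1 - l by rewrite subr_gt0.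
(* The compact case asks for nonempty sets. The compact set found by inner regularity can be empty
   only if [s < 0], and then a point of [X] replaces it. *)
have inner (X : set R) (x : R) (s : R) : measurable X -> X x -> (s%:E < mu X)%E ->
    exists K, [/\ compact K, K !=set0, K `<=` X & (s%:E < mu K)%E \/ s < 0].
  move=> mX Xx; rewrite lebesgue_regularity_inner_sup// => /ereal_sup_gt[_ [K [cK KX] <-] sK].
  have [K0|/set0P K0] := eqVneq K set0.
    exists [set x]; split; [exact: compact_set1|by exists x|by move=> _ ->|right].
    by move: sK; rewrite K0 measure0 lte_fin.
  by exists K; split => //; left.
have key (s t : R) : (s%:E < mu A)%E -> (t%:E < mu B)%E ->
    (((1 - l) * s + l * t)%:E <= mu C)%E.
  move=> sA tB.
  have [K [cK K0 KA sK]] := inner _ _ _ mA Aa sA.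
  have [L [cL L0 LB tL]] := inner _ _ _ mB Bb tB.
  apply: le_trans (brunn_minkowski_compact l01 cK K0 cL L0 mC _); last first.
    by move=> x y /KA Ax /LB By; exact: ABC.
  rewrite EFinD !EFinM; apply: leeD; apply: lee_wpmul2l; rewrite ?lee_fin ?(ltW l1') ?(ltW l0)//.
    by case: sK => [/ltW//|s0]; rewrite (@le_trans _ _ 0%E)// lee_fin ltW.
  by case: tL => [/ltW//|s0]; rewrite (@le_trans _ _ 0%E)// lee_fin ltW.
have [->|Cfin] := eqVneq (mu C) +oo%E; first by rewrite leey.
have {}Cfin : mu C \is a fin_num by rewrite ge0_fin_numE// ltey.
move: key; rewrite -(fineK Cfin); set c := fine _ => key.
(* With [t = -1], which is below [mu B], the chosen [s] turns [key] into [c + 1 <= c]. *)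
have finA : mu A \is a fin_num.
  rewrite ge0_fin_numE//; apply: contraT; rewrite -leNgt leye_eq => /eqP Aoo.
  have := key ((c + l + 1) / (1 - l)) (-1).
  rewrite Aoo ltry (lt_le_trans _ (measure_ge0 _ _)) ?lte_fin ?ltrN10// => /(_ isT isT).
  by rewrite lee_fin mulrC divfK ?gt_eqF//; lra.
have finB : mu B \is a fin_num.
  rewrite ge0_fin_numE//; apply: contraT; rewrite -leNgt leye_eq => /eqP Boo.
  have := key (-1) ((c + (1 - l) + 1) / l).
  rewrite Boo ltry (lt_le_trans _ (measure_ge0 _ _)) ?lte_fin ?ltrN10// => /(_ isT isT).
  by rewrite lee_fin [X in _ + X]mulrC divfK ?gt_eqF//; lra.
move: key; rewrite -(fineK finA) -(fineK finB) => key.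
rewrite -!EFinM -EFinD; apply/lee_addgt0Pr => e e0.
have := key (fine (mu A) - e) (fine (mu B) - e).
rewrite !lte_fin !ltrBlDr !ltrDl e0 => /(_ isT isT).
by rewrite -EFinD !lee_fin; lra.
Qed.

End prekopa_leindler_1d.

(** Statements such as [pl] see an integral only through the numbers strictly below it; this passes
    such a number on to one term of a monotone approximation. *)
Lemma lt_integral_monotone d (T : measurableType d) (R : realType)
    (mu : {measure set T -> \bar R}) (g : nat -> T -> \bar R) (f : T -> \bar R)
    (s : \bar R) :
  (forall n, measurable_fun setT (g n)) -> (forall n x, (0 <= g n x)%E) ->
  (forall x, nondecreasing_seq (g ^~ x)) ->
  (forall x, g ^~ x @ \oo --> f x) ->
  (s < \int[mu]_x f x)%E -> exists n, (s < \int[mu]_x g n x)%E.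
Proof.
move=> mg g0 ndg gf sf; apply: contrapT => /forallNP h.
move: sf; apply/negP; rewrite -leNgt.
rewrite (_ : (\int[mu]_x f x = limn (fun n => \int[mu]_x g n x))%E); last first.
  rewrite -monotone_convergence//.
  by apply: eq_integral => x _; apply/esym/cvg_lim => //; exact: gf.
apply: lime_le.
  apply: ereal_nondecreasing_is_cvgn => a b ab; apply: ge0_le_integral => //.
  by move=> x _; exact: ndg.
by apply: nearW => n; rewrite leNgt; apply/negP/h.
Qed.

Lemma amgm (R : realType) (l a b : R) : 0 < l < 1 -> 0 < a -> 0 < b ->
  a `^ (1 - l) * b `^ l <= (1 - l) * a + l * b.
Proof.
move=> /andP[l0 l1] a0 b0; have l1' : 0 < 1 - l by rewrite subr_gt0.
have := @conjugate_powR R (a `^ (1 - l)) (b `^ l) (1 - l)^-1 l^-1.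
rewrite !invr_gt0 !invrK -!powRrM !mulfV ?gt_eqF// (powRr1 (ltW a0)) (powRr1 (ltW b0)) => h.
by rewrite (mulrC (1 - l)) (mulrC l b) h ?powR_ge0// subrK.
Qed.

Lemma lt_powR2 (R : realType) (l a b c d : R) : 0 < l < 1 ->
  0 < a -> 0 < b -> a < c -> b < d ->
  a `^ (1 - l) * b `^ l < c `^ (1 - l) * d `^ l.
Proof.
move=> /andP[l0 l1] a0 b0 ac bd; apply: ltr_pM; rewrite ?powR_ge0//.
  by apply: gt0_ltr_powR; rewrite ?subr_gt0 ?nnegrE ?ltW// (lt_trans a0).
by apply: gt0_ltr_powR; rewrite ?nnegrE ?ltW// (lt_trans b0).
Qed.

(* [pl l a b c] says [a^(1-l) b^l <= c] for extended reals, with [0 * oo = 0];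
   unlike the inequality itself, it composes under iterated integration. *)
Definition pl (R : realType) (l : R) (a b c : \bar R) : Prop :=
  forall s t : R, 0 < s -> 0 < t -> (s%:E < a)%E -> (t%:E < b)%E ->
    ((s `^ (1 - l) * t `^ l)%:E <= c)%E.

Lemma lte_gap (R : realType) (s : R) (a : \bar R) : (s%:E < a)%E ->
  exists2 s', s < s' & (s'%:E < a)%E.
Proof.
case: a => [r|_|//]; last by exists (s + 1); rewrite ?ltrDl ?ltry.
by rewrite lte_fin => /midf_lt[h1 h2]; exists ((s + r) / 2).
Qed.

Lemma pl_lt (R : realType) (l : R) (a b c : \bar R) (s t : R) : 0 < l < 1 ->
  pl l a b c -> 0 < s -> 0 < t -> (s%:E < a)%E -> (t%:E < b)%E ->
  ((s `^ (1 - l) * t `^ l)%:E < c)%E.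
Proof.
move=> l01 h s0 t0 /lte_gap[s' ss' s'a] /lte_gap[t' tt' t'b].
apply: lt_le_trans (h s' t' (lt_trans s0 ss') (lt_trans t0 tt') s'a t'b).
by rewrite lte_fin; exact: lt_powR2.
Qed.

(** The product is homogeneous of degree 1. Shrinking [a] and [b] by a factor [r < 1] brings them
    strictly below the bounds; if [c] were less than the product [X], any [r] between [c / X] and 1
    would contradict [pl]. *)
Lemma pl_EFin (R : realType) (l a b c : R) : 0 < l < 1 -> 0 <= a -> 0 <= b -> 0 <= c ->
  pl l a%:E b%:E c%:E -> a `^ (1 - l) * b `^ l <= c.
Proof.
move=> /andP[l0 l1]; have l1' : 0 < 1 - l by rewrite subr_gt0.
rewrite le_eqVlt => /predU1P[<- _ c0 _|a0]; first by rewrite powR0 ?mul0r// gt_eqF.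
rewrite le_eqVlt => /predU1P[<- c0 _|b0 c0 h]; first by rewrite powR0 ?mulr0// gt_eqF.
rewrite leNgt; apply/negP => cX; set X := a `^ _ * _ in cX.
have X0 : 0 < X by exact: le_lt_trans cX.
have [r cr r1] : exists2 r, c / X < r & r < 1.
  have : c / X < 1 by rewrite ltr_pdivrMr// mul1r.
  by move=> /midf_lt[? ?]; exists ((c / X + 1) / 2).
have r0 : 0 < r by rewrite (le_lt_trans _ cr)// divr_ge0// ltW.
have := h (r * a) (r * b) (mulr_gt0 r0 a0) (mulr_gt0 r0 b0).
rewrite !lte_fin !gtr_pMl// r1 => /(_ isT isT); rewrite lee_fin !powRM ?(ltW r0, ltW a0, ltW b0)//.
rewrite mulrACA -powRD; last by rewrite subrK oner_eq0.
by rewrite subrK powRr1 ?(ltW r0)// -/X -ler_pdivlMr// leNgt cr.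
Qed.

Section prekopa_leindler.
Context (R : realType).
Local Notation mu := (@lebesgue_measure R).
Local Open Scope ereal_scope.

(** Since both suprema equal 1, the superlevel sets of [h0] and [h1] at a height [u < 1] are
    nonempty together, so that the one-dimensional Brunn-Minkowski inequality applies height by
    height. Heights [u >= 1] contribute nothing on the left. *)
Lemma prekopa_leindler_normalized (l : R) (h0 h1 h : R -> \bar R) :
  (0 < l < 1)%R ->
  measurable_fun setT h0 -> measurable_fun setT h1 -> measurable_fun setT h ->
  (forall x, 0 <= h0 x <= 1) -> (forall x, 0 <= h1 x <= 1) ->
  (forall x, 0 <= h x) ->
  (forall u : R, (u < 1)%R -> exists x, u%:E < h0 x) ->
  (forall u : R, (u < 1)%R -> exists x, u%:E < h1 x) ->
  (forall x y, pl l (h0 x) (h1 y) (h ((1 - l) * x + l * y)%R)) ->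
  (1 - l)%:E * \int[mu]_x h0 x + l%:E * \int[mu]_x h1 x <= \int[mu]_x h x.
Proof.
move=> l01 mh0 mh1 mh h0_01 h1_01 h_0 s0 s1 hpl.
have /andP[l0 l1] := l01.
have l1' : (0 < 1 - l)%R by rewrite subr_gt0.
have mN := fun f (mf : measurable_fun setT f) => measurable_distribution_tail mu mf.
rewrite !layer_cake//; [|by move=> x; case/andP: (h1_01 x)|by move=> x; case/andP: (h0_01 x)].
rewrite -!ge0_integralZl//=; [| | by rewrite lee_fin ltW | | by rewrite lee_fin ltW]; last 2 first.
- by apply: measurable_funTS; exact: mN.
- by apply: measurable_funTS; exact: mN.
rewrite -ge0_integralD//=; last 4 first.
- by move=> u _; rewrite mule_ge0// lee_fin ltW.
- by apply: measurable_funeM; apply: measurable_funTS; exact: mN.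
- by move=> u _; rewrite mule_ge0// lee_fin ltW.
- by apply: measurable_funeM; apply: measurable_funTS; exact: mN.
apply: ge0_le_integral => //.
- by move=> u _; rewrite adde_ge0// mule_ge0// lee_fin ltW.
- by apply: emeasurable_funD;apply: measurable_funeM; apply: measurable_funTS; exact: mN.
- by apply: measurable_funTS; exact: mN.
move=> u; rewrite /= in_itv /= andbT => u0.
have [u1|u1] := ltP u 1%R.
  apply: brunn_minkowski_1d => //; try exact: measurable_superlevel.
    exact: s0.
    exact: s1.
  move=> x y /= ux uy.
  have := pl_lt l01 (hpl x y) u0 u0 ux uy.
  by rewrite -powRD ?subrK ?powRr1 ?ltW// gt_eqF.
have e0 (f : R -> \bar R) : (forall x, 0 <= f x <= 1) -> [set x | u%:E < f x] = set0.
  move=> f01; rewrite -subset0 => x /= ufx.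
  have /andP[_] := f01 x; apply/negP; rewrite -ltNge (le_lt_trans _ ufx)//.
by rewrite (e0 _ h0_01) (e0 _ h1_01) measure0 !mule0 adde0.
Qed.

(** Truncation makes the suprema finite and positive, and division turns them into 1. The arithmetic
    mean of the normalized inequality is then lowered to a geometric one by [amgm], and the factor
    [m = m0^(1-l) m1^l] undoes the normalization. *)
Lemma prekopa_leindler_1d (l : R) (h0 h1 h : R -> \bar R) :
  (0 < l < 1)%R ->
  measurable_fun setT h0 -> measurable_fun setT h1 -> measurable_fun setT h ->
  (forall x, 0 <= h0 x) -> (forall x, 0 <= h1 x) -> (forall x, 0 <= h x) ->
  (forall x y, pl l (h0 x) (h1 y) (h ((1 - l) * x + l * y)%R)) ->
  pl l (\int[mu]_x h0 x) (\int[mu]_x h1 x) (\int[mu]_x h x).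
Proof.
move=> l01 mh0 mh1 mh h0_ge0 h1_ge0 h_ge0 hpl s t s_gt0 t_gt0 sh0 th1.
have trunc (g : R -> \bar R) (r : R) : measurable_fun setT g -> (forall x, 0 <= g x) ->
    (0 < r)%R -> r%:E < \int[mu]_x g x ->
    exists m : R, [/\ (0 < m)%R, r%:E < \int[mu]_x mine (g x) m%:E &
      forall v : R, (v < m)%R -> exists x, v%:E < g x].
  move=> mg g0 r0 rg.
  have mt (c : \bar R) : measurable_fun setT (fun x => mine (g x) c).
    by apply: measurable_mine.
  have [n rn] : exists n, r%:E < \int[mu]_x mine (g x) (n%:R)%:E.
    apply: (@lt_integral_monotone _ _ _ mu (fun n x => mine (g x) (n%:R)%:E) g) => //.
    - by move=> n; exact: mt.
    - by move=> n x /=; rewrite le_min g0 lee_fin ler0n.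
    - move=> x a b ab /=; rewrite le_min ge_min lexx/= ge_min.
      by rewrite lee_fin ler_nat ab orbT.
    - move=> x; have := g0 x; case: (g x) => [y y0|_|//].
        apply: cvg_near_cst; exists (Num.trunc y).+1 => // n /= yn.
        apply/min_idPl; rewrite lee_fin.
        rewrite (le_trans (ltW (truncnS_gt y)))// ler_nat//.
      rewrite (_ : (fun _ => _) = (fun n => (n%:R)%:E)); last first.
        by apply/funext => n; apply/min_idPr; rewrite leey.
      by apply/cvgeryP; exact: cvgr_idn.
  (* Cutting at [min(M, n)] instead of [n] gives the same truncated function, but makes the cut [m]
     exactly its supremum. *)
  pose M := ereal_sup (range g).
  have M0 : 0 <= M by apply: ereal_sup_ge; exists (g 0%R) => //; exists 0%R.
  have gM x : g x <= M by apply: ereal_sup_ubound; exists x.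
  pose m := fine (mine M (n%:R)%:E).
  have mE : m%:E = mine M (n%:R)%:E.
    rewrite /m fineK// ge0_fin_numE ?le_min ?M0 ?lee_fin ?ler0n//.
    by rewrite gt_min ltry orbT.
  have gm x : mine (g x) m%:E = mine (g x) (n%:R)%:E.
    rewrite mE minA; congr mine; exact/min_idPl.
  have m_ge0 : (0 <= m)%R by rewrite -lee_fin mE le_min M0 lee_fin ler0n.
  exists m; split.
  - rewrite lt_neqAle m_ge0 andbT; apply/eqP => m0; move: rn.
    under eq_integral do rewrite -gm -m0.
    rewrite integral0_eq ?lte_fin ?ltNge ?(ltW r0)// => x _.
    by apply/min_idPr.
  - by under eq_integral do rewrite gm.
  - move=> v vm; have : v%:E < M by rewrite (@lt_le_trans _ _ m%:E)// ?lte_fin// mE ge_min lexx.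
    by move=> /ereal_sup_gt[_ [x _ <-] vx]; exists x.
have [m0 [m0_gt0 sm0 sup0]] := trunc _ _ mh0 h0_ge0 s_gt0 sh0.
have [m1 [m1_gt0 tm1 sup1]] := trunc _ _ mh1 h1_ge0 t_gt0 th1.
pose m := (m0 `^ (1 - l) * m1 `^ l)%R.
have m_gt0 : (0 < m)%R by rewrite mulr_gt0// powR_gt0.
pose k0 x := (m0^-1)%:E * mine (h0 x) m0%:E.
pose k1 x := (m1^-1)%:E * mine (h1 x) m1%:E.
pose k x := (m^-1)%:E * h x.
have V (r : R) : (0 < r)%R -> 0 <= (r^-1)%:E :> \bar R by rewrite lee_fin invr_ge0 => /ltW.
have ltV (r v : R) (z : \bar R) : (0 < r)%R -> (v%:E < (r^-1)%:E * z) = ((v * r)%R%:E < z).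
  by move=> r0; rewrite muleC lte_pdivlMr.
have k_01 (g : R -> \bar R) (r : R) x : (0 < r)%R -> (forall x, 0 <= g x) ->
    0 <= (r^-1)%:E * mine (g x) r%:E <= 1.
  move=> r0 g0; rewrite mule_ge0 ?V ?le_min ?g0 ?lee_fin ?(ltW r0)//=.
  rewrite muleC lee_pdivrMr// mul1e ge_min lexx orbT//.
have mk (g : R -> \bar R) (r : R) : measurable_fun setT g ->
    measurable_fun setT (fun x => (r^-1)%:E * mine (g x) r%:E).
  by move=> mg; apply: measurable_funeM; exact: measurable_mine.
have sk (g : R -> \bar R) (r : R) : (0 < r)%R ->
    (forall v, (v < r)%R -> exists x, v%:E < g x) ->
    forall u : R, (u < 1)%R -> exists x, u%:E < (r^-1)%:E * mine (g x) r%:E.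
  move=> r0 sup u u1; have [|x ux] := sup (u * r)%R; first by rewrite gtr_pMl.
  by exists x; rewrite ltV// lt_min ux lte_fin gtr_pMl.
have := @prekopa_leindler_normalized l k0 k1 k l01 (mk _ _ mh0) (mk _ _ mh1).
move=> /(_ (measurable_funeM _ mh) (fun x => k_01 h0 m0 x m0_gt0 h0_ge0)).
move=> /(_ (fun x => k_01 h1 m1 x m1_gt0 h1_ge0)).
move=> /(_ (fun x => mule_ge0 (V _ m_gt0) (h_ge0 x)) (sk _ _ m0_gt0 sup0) (sk _ _ m1_gt0 sup1)).
have kpl x y : pl l (k0 x) (k1 y) (k ((1 - l) * x + l * y)%R).
  move=> a b a0 b0; rewrite /k0 /k1 /k !ltV// !lt_min => /andP[ax _] /andP[b_y _].
  rewrite muleC lee_pdivlMr// -EFinM.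
  have -> : (a `^ (1 - l) * b `^ l * m = (a * m0) `^ (1 - l) * (b * m1) `^ l)%R.
    by rewrite /m !powRM ?ltW//; ring.
  by apply: hpl => //; exact: mulr_gt0.
move=> /(_ kpl).
rewrite /k0 /k1 /k !ge0_integralZl//; try exact: V; try exact: measurable_mine;
  try by (move=> x _; rewrite le_min ?h0_ge0 ?h1_ge0 lee_fin ltW).
rewrite [leRHS]muleC lee_pdivlMr// => H; apply: le_trans H.
have /andP[l0 l1] := l01.
have l1' : (0 < 1 - l)%R by rewrite subr_gt0.
apply: (@le_trans _ _ (((1 - l) * (s / m0) + l * (t / m1)) * m)%:E).
  rewrite lee_fin.
  have -> : (s `^ (1 - l) * t `^ l = (s / m0) `^ (1 - l) * (t / m1) `^ l * m)%R.
    have {1}-> : s = (s / m0 * m0)%R by rewrite divfK ?gt_eqF.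
    have {1}-> : t = (t / m1 * m1)%R by rewrite divfK ?gt_eqF.
    rewrite (powRM _ (ltW (divr_gt0 s_gt0 m0_gt0)) (ltW m0_gt0)).
    rewrite (powRM _ (ltW (divr_gt0 t_gt0 m1_gt0)) (ltW m1_gt0)).
    by rewrite /m; ring.
  by apply: ler_wpM2r; [exact: ltW|apply: amgm; rewrite ?divr_gt0].
rewrite EFinM; apply: lee_wpmul2r; first by rewrite lee_fin ltW.
rewrite EFinD !EFinM; apply: leeD; apply: lee_wpmul2l; rewrite ?lee_fin ?(ltW l1') ?(ltW l0)//.
  by rewrite muleC; apply: lee_wpmul2l; [exact: V|exact: ltW].
by rewrite muleC; apply: lee_wpmul2l; [exact: V|exact: ltW].
Qed.

End prekopa_leindler.

Section iterated_integral.
Context (R : realType) (n : nat).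
Local Notation lebn := (borel_lebesgue_rV R).
Local Open Scope ereal_scope.

Lemma measurable_fun_section_cons_rV (f : 'rV[R]_n.+1 -> \bar R) (x : R) :
  measurable_fun setT f ->
  measurable_fun setT (fun v => f (cons_rV (x : measurableTypeR R, v))).
Proof.
move=> mf.
have mc := measurableT_comp mf (@measurable_cons_rV R n).
exact: (measurableT_comp mc (pair1_measurable (x : measurableTypeR R))).
Qed.

Lemma measurable_fun_integral_cons_rV (f : 'rV[R]_n.+1 -> \bar R) :
  measurable_fun setT f -> (forall x, 0 <= f x) ->
  measurable_fun setT (fun x : measurableTypeR R => \int[lebn n]_v f (cons_rV (x, v))).
Proof.
move=> mf f0.
exact: (measurable_fun_fubini_tonelli_F (m2 := lebn n) (f \o @cons_rV R n)
  (measurableT_comp mf (@measurable_cons_rV R n)) (fun=> f0 _)).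
Qed.

Lemma integral_cons_rV (f : 'rV[R]_n.+1 -> \bar R) :
  measurable_fun setT f -> (forall x, 0 <= f x) ->
  \int[lebn n.+1]_z f z =
  \int[lebesgue_measure]_x \int[lebn n]_v f (cons_rV (x, v)).
Proof.
move=> mf f0.
have mf' := measurableT_comp mf (@measurable_cons_rV R n).
transitivity (\int[lebesgue_measure \x lebn n]_p f (cons_rV p)).
  rewrite -(ge0_integral_pushforward (@measurable_cons_rV R n)
    (lebesgue_measure \x lebn n)%E measurableT mf (fun x _ => f0 x)).
  by [].
exact: (fubini_tonelli1 (f \o @cons_rV R n) mf' (fun=> f0 _)).
Qed.

Lemma convex_cons_rV (l x y : R) (u v : 'rV[R]_n) :
  ((1 - l) *: cons_rV (x : measurableTypeR R, u) + l *: cons_rV (y : measurableTypeR R, v) =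
  cons_rV (((1 - l) * x + l * y)%R : measurableTypeR R, (1 - l) *: u + l *: v))%R.
Proof.
apply/rowP => i; rewrite mxE [X in (X + _)%R]mxE [X in (_ + X)%R]mxE.
case: (unliftP ord0 i) => [j|] ->.
  by rewrite !cons_rVS !mxE.
by rewrite !cons_rV0.
Qed.

End iterated_integral.

(** Induction on the dimension: for fixed first coordinates the induction hypothesis gives [pl] for
    the integrals of the sections, possibly infinite, and this is the hypothesis of the
    one-dimensional inequality. *)
Lemma prekopa_leindler (R : realType) (n : nat) (l : R)
    (h0 h1 h : 'rV[R]_n -> \bar R) : 0 < l < 1 ->
  measurable_fun setT h0 -> measurable_fun setT h1 -> measurable_fun setT h ->
  (forall x, 0 <= h0 x)%E -> (forall x, 0 <= h1 x)%E -> (forall x, 0 <= h x)%E ->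
  (forall x y, pl l (h0 x) (h1 y) (h ((1 - l) *: x + l *: y))) ->
  pl l (\int[borel_lebesgue_rV R n]_x h0 x) (\int[borel_lebesgue_rV R n]_x h1 x)
    (\int[borel_lebesgue_rV R n]_x h x).
Proof.
move=> l01; elim: n h0 h1 h => [|n IH] h0 h1 h mh0 mh1 mh h0_ge0 h1_ge0 h_ge0 hpl.
  rewrite /= !integral_dirac// !diracT !mul1e.
  by have := hpl 0 0; rewrite !scaler0 addr0.
rewrite !integral_cons_rV//.
apply: prekopa_leindler_1d => //; try exact: measurable_fun_integral_cons_rV;
  try by (move=> x; exact: integral_ge0).
move=> x y; apply: IH => //; try exact: measurable_fun_section_cons_rV.
by move=> u v; rewrite -convex_cons_rV.
Qed.

(** * Invariance of Lebesgue measure *)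

Lemma measurable_rV_add (R : realType) (n : nat) :
  measurable_fun setT (fun p : 'rV[R]_n * 'rV[R]_n => p.1 + p.2).
Proof.
apply: measurable_fun_rV => i.
rewrite (_ : (fun _ => _) = (coord_rV i \o fst) \+ (coord_rV i \o snd)); last first.
  by apply/funext => p; rewrite /coord_rV /= mxE.
by apply: measurable_funD; apply: measurableT_comp => //; exact: measurable_coord_rV.
Qed.

Lemma measurable_mulmx_rV (R : realType) (m n : nat) (Q : 'M[R]_(m, n)) :
  measurable_fun setT (fun v : 'rV[R]_m => v *m Q).
Proof.
apply: measurable_fun_rV => i.
rewrite (_ : (fun _ => _) = (fun v => \sum_(j < m) coord_rV j v * Q j i)); last first.
  by apply/funext => v; rewrite /coord_rV /= mxE.
apply: measurable_sum => j; apply: measurable_funM => //; exact: measurable_coord_rV.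
Qed.

Lemma measurable_rV_addr (R : realType) (n : nat) (w : 'rV[R]_n) :
  measurable_fun setT (fun v : 'rV[R]_n => v + w).
Proof.
exact: (measurableT_comp (@measurable_rV_add R n) (pair2_measurable w)).
Qed.

Lemma measurable_rV_opp (R : realType) (n : nat) :
  measurable_fun setT (fun v : 'rV[R]_n => - v).
Proof.
rewrite (_ : (fun _ => _) = fun v => v *m (- 1%:M)); first exact: measurable_mulmx_rV.
by apply/funext => v; rewrite mulmxN mulmx1.
Qed.

Lemma measurable_preimageT d1 d2 (T1 : measurableType d1) (T2 : measurableType d2)
    (f : T1 -> T2) (A : set T2) :
  measurable_fun setT f -> measurable A -> measurable (f @^-1` A).
Proof. by move=> mf mA; rewrite -[X in measurable X]setTI; exact: mf. Qed.

Definition translation_invariant (R : realType) (n : nat)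
    (nu : set 'rV[R]_n -> \bar R) :=
  forall (w : 'rV[R]_n) (A : set 'rV[R]_n), measurable A ->
    nu ((fun v => v + w) @^-1` A) = nu A.

Section with_sigma_finite.
Context d (T : measurableType d) (R : realType) (nu : {measure set T -> \bar R}).
Context (snu : sigma_finite setT nu).

(* The proof argument lets the structure below depend on [snu]. *)
Definition with_sigma_finite & sigma_finite setT nu : set T -> \bar R := nu.

Let sf := with_sigma_finite snu.

HB.instance Definition _ := Measure.copy sf nu.

HB.instance Definition _ := @Measure_isSigmaFinite.Build _ _ _ sf snu.

Lemma sigma_finite_measure_of :
  {m : {sigma_finite_measure set T -> \bar R} | m = nu :> (set T -> \bar R)}.
Proof. by exists sf. Qed.

End with_sigma_finite.

Section uniqueness.
Context (R : realType) (n : nat).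
Local Open Scope ereal_scope.

(* Both sides equal the measure of [{(x, y) | x \in S, x + y \in B}]. *)
Lemma translation_invariant_swap
    (mu nu : {sigma_finite_measure set 'rV[R]_n -> \bar R}) (S B : set 'rV[R]_n) :
  translation_invariant mu -> translation_invariant nu ->
  measurable S -> measurable B -> (forall x, S x -> S (- x)%R) ->
  mu S * nu B = mu B * nu S.
Proof.
move=> tmu tnu mS mB symS.
have SN x : S (- x)%R -> S x by move=> /symS; rewrite opprK.
pose f (p : 'rV[R]_n * 'rV[R]_n) : \bar R := (\1_S p.1 * \1_B (p.1 + p.2)%R)%:E.
pose g (p : 'rV[R]_n * 'rV[R]_n) : \bar R := (\1_B p.1 * \1_S (p.1 - p.2)%R)%:E.
have mdiff : measurable_fun setT (fun p : 'rV[R]_n * 'rV[R]_n => (p.1 - p.2)%R).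
  have mp : measurable_fun setT (fun p : 'rV[R]_n * 'rV[R]_n => (p.1, - p.2)%R).
    apply/measurable_fun_pairP; split; first exact: measurable_fst.
    exact: (measurableT_comp (@measurable_rV_opp R n) measurable_snd).
  exact: (measurableT_comp (@measurable_rV_add R n) mp).
have mf : measurable_fun setT f.
  apply/measurable_EFinP; apply: measurable_funM.
    exact: (measurableT_comp (measurable_indic mS) measurable_fst).
  exact: (measurableT_comp (measurable_indic mB) (@measurable_rV_add R n)).
have mg : measurable_fun setT g.
  apply/measurable_EFinP; apply: measurable_funM.
    exact: (measurableT_comp (measurable_indic mB) measurable_fst).
  exact: (measurableT_comp (measurable_indic mS) mdiff).
have f0 p : 0 <= f p by rewrite lee_fin mulr_ge0.
have g0 p : 0 <= g p by rewrite lee_fin mulr_ge0.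
have indM (la : {measure set 'rV[R]_n -> \bar R}) (r : R) (A : set 'rV[R]_n) : (0 <= r)%R ->
    measurable A -> \int[la]_x (r * \1_A x)%:E = r%:E * la A.
  move=> r0 mA; under eq_integral do rewrite EFinM.
  rewrite ge0_integralZl_EFin//; last exact/measurable_EFinP.
  by rewrite integral_indic// setIT.
have indMr (la : {measure set 'rV[R]_n -> \bar R}) (r : \bar R) (A : set 'rV[R]_n) : 0 <= r ->
    measurable A -> \int[la]_x ((\1_A x)%:E * r) = la A * r.
  move=> r0 mA; rewrite ge0_integralZr//; last exact/measurable_EFinP.
  by rewrite integral_indic// setIT.
transitivity (\int[mu]_x \int[nu]_y f (x, y)).
  rewrite -indMr//; apply: eq_integral => x _.
  rewrite /f /= (indM _ _ ((fun y => (x + y)%R) @^-1` B))//.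
    congr (_ * _); rewrite -(tnu x B mB); congr (nu _).
    by apply/funext => y; rewrite /preimage/= addrC.
  rewrite (_ : (fun y => _) = (fun y => y + x)%R); last by apply/funext => y; rewrite addrC.
  by apply: measurable_preimageT => //; exact: measurable_rV_addr.
transitivity (\int[mu]_x \int[nu]_y g (x, y)); last first.
  rewrite -indMr//; apply: eq_integral => x _.
  rewrite /g /= (indM _ _ ((fun y => (x - y)%R) @^-1` S))//.
    congr (_ * _); rewrite -(tnu (- x)%R S mS); congr (nu _).
    apply/seteqP; split => y; rewrite /preimage/= => h.
      by apply: SN; rewrite opprB.
    by rewrite -opprB; exact: symS.
  rewrite (_ : (fun y => _) = (fun y => - y + x)%R); last by apply/funext => y; rewrite addrC.
  apply: measurable_preimageT => //.
  by apply: (measurableT_comp (measurable_rV_addr x)); exact: measurable_rV_opp.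
rewrite (fubini_tonelli f mf f0) (fubini_tonelli g mg g0); apply: eq_integral => y _.
pose A := S `&` (fun x => (x + y)%R) @^-1` B.
have mA : measurable A.
  by apply: measurableI => //; apply: measurable_preimageT => //; exact: measurable_rV_addr.
pose A' := B `&` (fun x => (x - y)%R) @^-1` S.
have mA' : measurable A'.
  by apply: measurableI => //; apply: measurable_preimageT => //; exact: measurable_rV_addr.
transitivity (mu A).
  rewrite -[A]setIT -integral_indic//; apply: eq_integral => x _.
  by rewrite /f /= /A indicI.
transitivity (mu A').
  rewrite -(tmu (- y)%R A mA); congr (mu _); apply/seteqP.
  split => x; rewrite /A /A' /preimage/= subrK; tauto.
rewrite -[A']setIT -integral_indic//; apply: eq_integral => x _.
by rewrite /g /= /A' indicI.
Qed.

(** Dividing the swap identity by the common value at [S] shows that one symmetric set of positive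
    finite measure fixes the measure. The set is adapted to each use: the Euclidean ball for
    orthogonal maps, the cube for scalings and products. *)
Lemma translation_invariant_unique
    (mu : {sigma_finite_measure set 'rV[R]_n -> \bar R})
    (nu : {measure set 'rV[R]_n -> \bar R}) (S : set 'rV[R]_n) :
  sigma_finite setT nu ->
  translation_invariant mu -> translation_invariant nu ->
  measurable S -> (forall x, S x -> S (- x)%R) ->
  0 < mu S -> mu S < +oo -> nu S = mu S ->
  forall B, measurable B -> nu B = mu B.
Proof.
move=> snu tmu tnu mS symS mu0 muoo numu B mB.
have [nu' nu'E] := sigma_finite_measure_of snu.
have := @translation_invariant_swap mu nu' S B tmu.
rewrite nu'E numu (muleC (mu B)) => /(_ tnu mS mB symS).
have : mu S \is a fin_num by rewrite ge0_fin_numE.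
move: mu0; case: (mu S) => [r||//]// r0 _ /(congr1 (fun z => (r^-1)%:E * z)).
by rewrite !muleA -!EFinM mulVf ?mul1e ?gt_eqF.
Qed.

End uniqueness.

Section borel_lebesgue_invariance.
Context (R : realType).
Local Notation lebn := (borel_lebesgue_rV R).
Local Open Scope ereal_scope.

Lemma measure_cons_rV (n : nat) (A : set 'rV[R]_n.+1) : measurable A ->
  lebn n.+1 A =
  \int[lebesgue_measure]_x lebn n [set v | A (cons_rV (x : measurableTypeR R, v))].
Proof.
move=> mA; rewrite -[in LHS](setIT A) -integral_indic//.
rewrite integral_cons_rV//; last exact/measurable_EFinP.
apply: eq_integral => x _.
rewrite -[in RHS](setIT [set v | _]) -integral_indic//.
exact: (measurable_preimageT (measurableT_comp (@measurable_cons_rV R n)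
  (pair1_measurable (x : measurableTypeR R))) mA).
Qed.

Lemma measurable_fun_measure_cons_rV (n : nat) (A : set 'rV[R]_n.+1) : measurable A ->
  measurable_fun setT
   (fun x : measurableTypeR R => lebn n [set v | A (cons_rV (x, v))]).
Proof.
move=> mA; have := measurable_preimageT (@measurable_cons_rV R n) mA.
move=> /(measurable_fun_xsection (lebn n)); congr measurable_fun.
apply/funext => x /=; congr (lebn n _).
by apply/seteqP; split => v; rewrite /xsection /= inE.
Qed.

Lemma lebesgue_integral_shift (d : R) (f : R -> \bar R) :
  measurable_fun setT f -> (forall x, 0 <= f x) ->
  \int[lebesgue_measure]_x f (x + d)%R = \int[lebesgue_measure]_x f x.
Proof.
move=> mf f0.
have mg : measurable_fun setT (fun x : measurableTypeR R => x + d : measurableTypeR R)%R.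
  exact: measurable_funD.
transitivity (\int[measure_function_pushforward__canonical__measure_function_Measure
    lebesgue_measure mg]_x f x).
  by rewrite (ge0_integral_pushforward mg _ measurableT mf)//.
apply: eq_measure_integral => A mA _.
rewrite -[RHS]mul1e -(invr1 R) -(lebesgue_measure_affine d ltr01 mA).
congr (lebesgue_measure _).
by apply/seteqP; split => x; rewrite /preimage/= mul1r.
Qed.

Lemma lebesgue_rV_translation (n : nat) : translation_invariant (lebn n).
Proof.
elim: n => [|n IH] w A mA.
  rewrite (_ : (fun v => _) = id) ?preimage_id//.
  by apply/funext => v; apply/rowP => -[].
have mAw := measurable_preimageT (measurable_rV_addr w) mA.
rewrite !measure_cons_rV//.
pose phi (x : R) := lebn n [set v | A (cons_rV (x : measurableTypeR R, v))].
rewrite -[RHS](@lebesgue_integral_shift (w ord0 ord0) phi)//; last first.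
  exact: measurable_fun_measure_cons_rV.
apply: eq_integral => x _; rewrite /phi.
have shift v : (cons_rV (x : measurableTypeR R, v) + w = cons_rV
    ((x + w ord0 ord0)%R : measurableTypeR R, v + rsubmx (w : 'rV_(1 + n))))%R.
  apply/rowP => i; rewrite mxE; case: (unliftP ord0 i) => [j|] ->.
    rewrite !cons_rVS /= mxE; congr (_ + _)%R; rewrite mxE.
    by congr (w _ _); apply: val_inj.
  by rewrite !cons_rV0.
rewrite -(IH (rsubmx (w : 'rV[R]_(1 + n)))
    [set v | A (cons_rV ((x + w ord0 ord0)%R : measurableTypeR R, v))]).
  by congr (lebn n _); apply/seteqP; split => v; rewrite /preimage /= shift.
exact: (measurable_preimageT (measurableT_comp (@measurable_cons_rV R n)
  (pair1_measurable ((x + w ord0 ord0)%R : measurableTypeR R))) mA).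
Qed.

End borel_lebesgue_invariance.

Lemma sigma_finite_pushforward d1 d2 (T1 : measurableType d1) (T2 : measurableType d2)
    (R : realType) (m : {measure set T1 -> \bar R}) (f : T1 -> T2) (g : T2 -> T1) :
  sigma_finite setT m -> measurable_fun setT g -> cancel f g ->
  sigma_finite setT (pushforward m f).
Proof.
move=> [F TF Foo] mg fgK.
exists (fun k => g @^-1` F k).
  by rewrite -preimage_bigcup -TF preimage_setT.
move=> k; have [mF Fk] := Foo k; split; first exact: measurable_preimageT.
rewrite /pushforward (_ : f @^-1` _ = F k)//.
by apply/seteqP; split => x; rewrite /preimage/= fgK.
Qed.

Lemma sigma_finite_product d1 d2 (T1 : measurableType d1) (T2 : measurableType d2)
    (R : realType) (m1 : {sigma_finite_measure set T1 -> \bar R})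
    (m2 : {sigma_finite_measure set T2 -> \bar R}) :
  sigma_finite setT (m1 \x m2)%E.
Proof.
have /sigma_finiteP[F [TF ndF Foo]] := sigma_finiteT m1.
have /sigma_finiteP[G [TG ndG Goo]] := sigma_finiteT m2.
exists (fun k => F k `*` G k) => [|k].
  rewrite -setXTT TF TG; apply/seteqP; split=> -[x y] /=.
    move=> [[k _ Fx] [l _ Gy]]; exists (maxn k l) => //; split.
      by move: x Fx; exact/subsetPset/ndF/leq_maxl.
    by move: y Gy; exact/subsetPset/ndG/leq_maxr.
  by move=> [k _ [Fx Gy]]; split; exists k.
have [mF Fk] := Foo k; have [mG Gk] := Goo k; split; first exact: measurableX.
by rewrite product_measure1E// lte_mul_pinfty// ge0_fin_numE.
Qed.

Section linear_invariance.
Context (R : realType).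
Local Notation lebn := (borel_lebesgue_rV R).
Local Notation pushm m mf :=
  (measure_function_pushforward__canonical__measure_function_Measure m mf).

Definition cube (n : nat) (r : R) : set 'rV[R]_n :=
  [set v | forall i, v ord0 i \in `[- r, r]].

Lemma measurable_cube (n : nat) (r : R) : measurable (@cube n r).
Proof.
rewrite (_ : @cube n r = \bigcap_(i in [set: 'I_n]) (coord_rV i @^-1` `[- r, r]%classic)).
  apply: fin_bigcap_measurable => [|i _]; first exact: finite_finset.
  by apply: measurable_preimageT => //; exact: measurable_coord_rV.
by apply/seteqP; split => v vr i; [move=> _; exact: vr|exact: (vr i I)].
Qed.

Lemma lebesgue_cube (n : nat) (r : R) : 0 <= r -> lebn n (@cube n r) = ((r *+ 2) ^+ n)%:E.
Proof.
move=> r0; rewrite (@borel_lebesgue_rV_box R n (fun=> `[- r, r]%classic))//.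
rewrite (eq_bigr (fun=> (r *+ 2)%:E)) => [|i _].
  by rewrite prodEFin prodr_const card_ord.
rewrite /= lebesgue_measure_itv/= lte_fin opprK -mulr2n.
case: ifPn => //; rewrite -leNgt => rr; congr EFin; lra.
Qed.

Lemma cubeN (n : nat) (r : R) (v : 'rV[R]_n) : cube r v -> cube r (- v).
Proof. by move=> vr i; have := vr i; rewrite mxE !in_itv /=; lra. Qed.

Lemma dotvE (n : nat) (u v : 'rV[R]_n) : dotv u v = \sum_i u ord0 i * v ord0 i.
Proof. by rewrite /dotv mxE; apply: eq_bigr => i _; rewrite mxE. Qed.

(** The image measure is translation invariant and agrees with the original on the Euclidean unit
    ball, which [Q] preserves. A cube inside the ball and one around it show that its measure is
    positive and finite. *)
Lemma lebesgue_rV_orthogonal (n : nat) (Q : 'M[R]_n) (A : set 'rV[R]_n) :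
  Q *m Q^T = 1%:M -> measurable A -> lebn n ((fun v => v *m Q) @^-1` A) = lebn n A.
Proof.
move=> Q1 mA; have Q1' : Q^T *m Q = 1%:M by exact: mulmx1C.
have mQ := measurable_mulmx_rV Q.
pose S : set 'rV[R]_n := [set x | dotv x x <= 1].
have mS : measurable S.
  rewrite (_ : S = (fun x : 'rV[R]_n => \sum_i coord_rV i x * coord_rV i x) @^-1` `]-oo, 1]%classic).
    apply: measurable_preimageT => //.
    apply: measurable_sum => j; apply: measurable_funM; exact: measurable_coord_rV.
  by apply/seteqP; split => v; rewrite /S/preimage/= in_itv/= dotvE.
have S_sub : S `<=` cube 1.
  move=> v; rewrite /S /= dotvE => vv i; rewrite in_itv/= -ler_norml.
  rewrite -(@ler_pXn2r _ 2)// ?nnegrE// expr1n real_normK ?num_real//.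
  apply: le_trans vv; rewrite (bigD1 i)//= expr2 lerDl sumr_ge0// => j _.
  by rewrite -expr2 sqr_ge0.
(* If all [|v_i| <= r <= 1], the sum of the squares is at most [n r <= 1]; the successor covers
   [n = 0]. *)
pose r : R := n.+1%:R^-1.
have r0 : 0 < r by rewrite invr_gt0.
have sub_S : cube r `<=` S.
  move=> v vr; rewrite /S /= dotvE.
  apply: (@le_trans _ _ (\sum_(i < n) r)).
    apply: ler_sum => i _; have := vr i; rewrite in_itv/= => /andP[h1 h2].
    have r1 : r <= 1 by rewrite invf_le1// ler1n.
    by nra.
  rewrite sumr_const card_ord -mulr_natr -ler_pdivlMl// invrK mulr1 ler_nat//.
apply: (@translation_invariant_unique R n (lebn n) (pushm (lebn n) mQ) S).
- apply: (@sigma_finite_pushforward _ _ _ _ _ _ _ (fun v => v *m Q^T)).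
    exact: sigma_finiteT.
    exact: measurable_mulmx_rV.
  by move=> v; rewrite -mulmxA Q1 mulmx1.
- exact: lebesgue_rV_translation.
- move=> w B mB; rewrite /pushforward -[RHS](lebesgue_rV_translation (w *m Q^T)).
    by congr (lebn n _); apply/seteqP; split => v; rewrite /preimage/= mulmxDl -(mulmxA w) Q1' mulmx1.
  exact: measurable_preimageT.
- exact: mS.
- move=> x; rewrite /S /= !dotvE => x1.
  by rewrite (eq_bigr (fun i => x ord0 i * x ord0 i))// => i _; rewrite !mxE mulrNN.
- apply: (@lt_le_trans _ _ (lebn n (cube r))).
    by rewrite lebesgue_cube ?ltW// lte_fin exprn_gt0// mulrn_wgt0.
  apply: le_measure; rewrite ?inE//; exact: measurable_cube.
- apply: (@le_lt_trans _ _ (lebn n (cube 1))).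
    by apply: le_measure; rewrite ?inE//; exact: measurable_cube.
  by rewrite lebesgue_cube// ltry.
- rewrite /pushforward; congr (lebn n _); apply/seteqP.
  split => v; rewrite /preimage /S /= /dotv trmx_mul mulmxA -(mulmxA v) Q1 mulmx1//.
- exact: mA.
Qed.

Lemma integral_rV_orthogonal (n : nat) (Q : 'M[R]_n) (f : 'rV[R]_n -> \bar R) :
  Q *m Q^T = 1%:M -> measurable_fun setT f -> (forall x, 0 <= f x)%E ->
  (\int[lebn n]_v f (v *m Q)%R = \int[lebn n]_v f v)%E.
Proof.
move=> Q1 mf f0; have mQ := measurable_mulmx_rV Q.
transitivity (\int[pushm (lebn n) mQ]_x f x)%E.
  by rewrite (ge0_integral_pushforward mQ _ measurableT mf).
apply: eq_measure_integral => A mA _; exact: lebesgue_rV_orthogonal.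
Qed.

Lemma measurable_scale_rV (n : nat) (c : R) :
  measurable_fun setT (fun v : 'rV[R]_n => c *: v).
Proof.
rewrite (_ : (fun _ => _) = fun v => v *m (c%:M)); first exact: measurable_mulmx_rV.
by apply/funext => v; rewrite mul_mx_scalar.
Qed.

Lemma lebesgue_rV_scale (n : nat) (c : R) (A : set 'rV[R]_n) : 0 < c -> measurable A ->
  (lebn n A = (c ^+ n)%:E * lebn n ((fun v => c *: v) @^-1` A))%E.
Proof.
move=> c0 mA; have mc := @measurable_scale_rV n c.
have cn0 : 0 < c ^+ n by rewrite exprn_gt0.
pose nu : {measure set 'rV[R]_n -> \bar R} := mscale (NngNum (ltW cn0)) (pushm (lebn n) mc).
apply/esym; apply: (@translation_invariant_unique R n (lebn n) nu (cube 1)).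
- have [F TF Foo] := @sigma_finite_pushforward _ _ _ _ _ (lebn n) ( *:%R c) ( *:%R c^-1)
    (sigma_finiteT _) (@measurable_scale_rV n _) (fun v => scalerK (lt0r_neq0 c0) v).
  exists F => // k; have [mF Fk] := Foo k; split=> //.
  by rewrite /nu /= /mscale/= lte_mul_pinfty// lee_fin ltW.
- exact: lebesgue_rV_translation.
- move=> w B mB; rewrite /nu /= /mscale /pushforward; congr (_ * _)%E.
  rewrite -[RHS](lebesgue_rV_translation (c^-1 *: w)); last exact: measurable_preimageT.
  by congr (lebn n _); apply/seteqP; split => v; rewrite /preimage/= scalerDr scalerA mulfV ?scale1r// gt_eqF.
- exact: measurable_cube.
- exact: cubeN.
- by rewrite lebesgue_cube// lte_fin exprn_gt0.
- by rewrite lebesgue_cube// ltry.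
- transitivity ((c ^+ n)%:E * lebn n (cube c^-1))%E.
    congr (_ * lebn n _)%E; apply/seteqP; split => v vc i; have := vc i;
      rewrite ?mxE !in_itv/= -!ler_norml normrM gtr0_norm// => h.
      by rewrite -(ler_pM2l c0) mulfV ?gt_eqF.
    by move: h; rewrite -(ler_pM2l c0) mulfV ?gt_eqF.
  rewrite !lebesgue_cube ?invr_ge0 ?(ltW c0)// -EFinM -exprMn; congr (_ ^+ _)%:E.
  by rewrite mulrnAr mulfV ?gt_eqF.
- exact: mA.
Qed.

Definition row_mx_pair (m n : nat) (p : 'rV[R]_m * 'rV[R]_n) : 'rV[R]_(m + n) :=
  row_mx p.1 p.2.

Lemma measurable_row_mx (m n : nat) : measurable_fun setT (@row_mx_pair m n).
Proof.
apply: measurable_fun_rV => i; case: (split_ordP i) => j ->.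
  rewrite (_ : (fun _ => _) = coord_rV j \o fst).
    by apply: measurableT_comp => //; exact: measurable_coord_rV.
  by apply/funext => p; rewrite /coord_rV /= row_mxEl.
rewrite (_ : (fun _ => _) = coord_rV j \o snd).
  by apply: measurableT_comp => //; exact: measurable_coord_rV.
by apply/funext => p; rewrite /coord_rV /= row_mxEr.
Qed.

Lemma integral_rV_translation (n : nat) (w : 'rV[R]_n) (f : 'rV[R]_n -> \bar R) :
  measurable_fun setT f -> (forall x, 0 <= f x)%E ->
  (\int[lebn n]_v f (v + w)%R = \int[lebn n]_v f v)%E.
Proof.
move=> mf f0; have mw := measurable_rV_addr w.
transitivity (\int[pushm (lebn n) mw]_x f x)%E.
  by rewrite (ge0_integral_pushforward mw _ measurableT mf).
apply: eq_measure_integral => A mA _; exact: lebesgue_rV_translation.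
Qed.

(** Both measures are translation invariant and give the cube of half-side 1 the value [2^(m+n)]. *)
Lemma lebesgue_rV_row_mx (m n : nat) (A : set 'rV[R]_(m + n)) : measurable A ->
  (lebn m \x lebn n)%E (@row_mx_pair m n @^-1` A) = lebn (m + n) A.
Proof.
move=> mA; have mr := @measurable_row_mx m n.
apply: (@translation_invariant_unique R _ (lebn (m + n)) (pushm (lebn m \x lebn n)%E mr) (cube 1)).
- apply: (@sigma_finite_pushforward _ _ _ _ _ _ _ (fun v => (lsubmx v, rsubmx v))).
    exact: sigma_finite_product.
    apply/measurable_fun_pairP; split; apply: measurable_fun_rV => i;
    rewrite /coord_rV /=; under eq_fun do rewrite mxE; exact: measurable_coord_rV.
  by move=> [u v]; rewrite /row_mx_pair /= row_mxKl row_mxKr.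
- exact: lebesgue_rV_translation.
- move=> w B mB; rewrite /= /pushforward.
  have mB' := measurable_preimageT mr mB.
  pose f (p : 'rV[R]_m * 'rV[R]_n) : \bar R := (\1_B (row_mx_pair p))%:E.
  have mf : measurable_fun setT f.
    by apply/measurable_EFinP; exact: (measurableT_comp (measurable_indic mB) mr).
  have f0 p : (0 <= f p)%E by rewrite lee_fin.
  transitivity (\int[lebn m \x lebn n]_p f ((p.1 + lsubmx w)%R, (p.2 + rsubmx w)%R))%E.
    rewrite -[X in (_ \x _)%E X]setIT -integral_indic; [|exact: measurableT|]; last first.
      exact: (measurable_preimageT mr (measurable_preimageT (measurable_rV_addr w) mB)).
    apply: eq_integral => -[u v] _; rewrite /f /row_mx_pair /= -add_row_mx hsubmxK.
    by rewrite !indicE.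
  transitivity (\int[lebn m \x lebn n]_p f p)%E; last first.
    by rewrite -[X in (_ \x _)%E X]setIT -integral_indic.
  have mfw : measurable_fun setT (fun p : 'rV[R]_m * 'rV[R]_n => f (p.1 + lsubmx w, p.2 + rsubmx w)).
    apply: (measurableT_comp mf); apply/measurable_fun_pairP; split.
      exact: (measurableT_comp (measurable_rV_addr _) measurable_fst).
    exact: (measurableT_comp (measurable_rV_addr _) measurable_snd).
  rewrite (fubini_tonelli1 _ mfw) => [|p]; last exact: f0.
  rewrite (fubini_tonelli1 _ mf f0) /fubini_F -[RHS](integral_rV_translation (lsubmx w)); last 2 first.
  - exact: measurable_fun_fubini_tonelli_F.
  - by move=> u; exact: integral_ge0.
  apply: eq_integral => u _.
  rewrite -[RHS](integral_rV_translation (rsubmx w))//.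
  exact: (measurableT_comp mf (pair1_measurable _)).
- exact: measurable_cube.
- exact: cubeN.
- by rewrite lebesgue_cube// lte_fin exprn_gt0.
- by rewrite lebesgue_cube// ltry.
- transitivity ((lebn m \x lebn n)%E (cube 1 `*` cube 1)).
    congr ((_ \x _)%E _); apply/seteqP; split => -[u v]; rewrite /preimage /= /row_mx_pair /=.
      move=> h; split => i; first by have := h (lshift n i); rewrite row_mxEl.
      by have := h (rshift m i); rewrite row_mxEr.
    by move=> [h1 h2] i; case: (split_ordP i) => j ->; rewrite (row_mxEl, row_mxEr).
  rewrite product_measure1E; [|exact: measurable_cube..].
  rewrite lebesgue_cube// lebesgue_cube//.
  transitivity ((2 ^+ m)%:E * (2 ^+ n)%:E : \bar R)%E; last by rewrite -EFinM exprD.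
  by congr (_ * _)%E; exact: lebesgue_cube.
- exact: mA.
Qed.

Lemma integral_row_mx (m n : nat) (f : 'rV[R]_(m + n) -> \bar R) :
  measurable_fun setT f -> (forall x, 0 <= f x)%E ->
  (\int[lebn (m + n)]_z f z = \int[lebn m]_u \int[lebn n]_v f (row_mx u v))%E.
Proof.
move=> mf f0; have mr := @measurable_row_mx m n.
transitivity (\int[lebn m \x lebn n]_p f (row_mx_pair p))%E; last first.
  by rewrite fubini_tonelli1//; exact: (measurableT_comp mf mr).
transitivity (\int[pushm (lebn m \x lebn n)%E mr]_x f x)%E.
  by apply: eq_measure_integral => A mA _; apply/esym; exact: lebesgue_rV_row_mx.
by rewrite (ge0_integral_pushforward mr _ measurableT mf).
Qed.

End linear_invariance.

(** Put [c = (1 - l) a + l b] and [m = l b / c]. The rescaled sets [A / a] and [B / b] have volume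
    1, and their combination with weight [m] lies in [C / c], so Prekopa-Leindler for indicator
    functions gives [C / c] volume at least 1. Writing the volumes as powers avoids roots. *)
Lemma brunn_minkowski (R : realType) (p : nat) (l a b : R) (A B C : set 'rV[R]_p) :
  0 < l < 1 -> 0 < a -> 0 < b -> measurable A -> measurable B -> measurable C ->
  (forall x y, A x -> B y -> C ((1 - l) *: x + l *: y)) ->
  borel_lebesgue_rV R p A = (a ^+ p)%:E -> borel_lebesgue_rV R p B = (b ^+ p)%:E ->
  ((((1 - l) * a + l * b) ^+ p)%:E <= borel_lebesgue_rV R p C)%E.
Proof.
move=> l01 a0 b0 mA mB mC ABC Aa Bb; have /andP[l0 l1] := l01.
have l1' : 0 < 1 - l by rewrite subr_gt0.
pose c := (1 - l) * a + l * b.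
have c0 : 0 < c by rewrite addr_gt0// mulr_gt0.
pose m := l * b / c.
have m1E : 1 - m = (1 - l) * a / c by rewrite /m /c; field; rewrite gt_eqF.
have m01 : 0 < m < 1.
  by rewrite divr_gt0 ?mulr_gt0//= -subr_gt0 m1E divr_gt0// mulr_gt0.
have ms (r : R) (X : set 'rV[R]_p) : measurable X -> measurable (( *:%R r) @^-1` X).
  by move=> mX; apply: measurable_preimageT => //; exact: measurable_scale_rV.
have unit (r : R) (X : set 'rV[R]_p) : 0 < r -> measurable X ->
    borel_lebesgue_rV R p X = (r ^+ p)%:E -> borel_lebesgue_rV R p (( *:%R r) @^-1` X) = 1%E.
  move=> r0 mX; rewrite (lebesgue_rV_scale r0 mX) => /(congr1 (fun z => ((r ^+ p)^-1)%:E * z)%E).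
  by rewrite muleA -!EFinM mulVf ?mul1e// gt_eqF// exprn_gt0.
have : pl m (borel_lebesgue_rV R p (( *:%R a) @^-1` A)) (borel_lebesgue_rV R p (( *:%R b) @^-1` B))
   (borel_lebesgue_rV R p (( *:%R c) @^-1` C)).
  have I (r : R) (X : set 'rV[R]_p) : measurable X -> borel_lebesgue_rV R p (( *:%R r) @^-1` X) =
      (\int[borel_lebesgue_rV R p]_x (\1_(( *:%R r) @^-1` X) x)%:E)%E.
    by move=> mX; rewrite integral_indic ?setIT//; exact: ms.
  rewrite !I//; apply: prekopa_leindler => //;
    try (by apply/measurable_EFinP; apply: measurable_indic; exact: ms);
    try by (move=> x; rewrite lee_fin).
  move=> x y s t s0 t0; rewrite !lte_fin !indicE.
  have [/set_mem xA|_] := boolP (x \in _); last by rewrite ltNge (ltW s0).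
  have [/set_mem yB|_] := boolP (y \in _); last by rewrite (ltNge t) (ltW t0).
  move=> /ltW s1 /ltW t1.
  rewrite mem_set ?lee_fin; last first.
    rewrite /preimage /= scalerDr !scalerA m1E.
    have -> : c * ((1 - l) * a / c) = (1 - l) * a by field; rewrite gt_eqF.
    have -> : c * m = l * b by rewrite /m; field; rewrite gt_eqF.
    by rewrite -!scalerA; exact: ABC.
  have /andP[m0 m1] := m01.
  have le1 (r z : R) : 0 < r -> r <= 1 -> 0 <= z -> r `^ z <= 1.
    move=> r0 r1 z0; have <- : 1 `^ z = 1 :> R by rewrite powR1.
    by rewrite ge0_ler_powR// nnegrE ltW.
  by rewrite -[leRHS](mulr1 1) ler_pM ?powR_ge0// le1// ?subr_ge0 ltW.
rewrite (unit a A)// (unit b B)// (lebesgue_rV_scale c0 mC) => h.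
rewrite -[leLHS]mule1; apply: lee_wpmul2l; first by rewrite lee_fin exprn_ge0// ltW.
rewrite leNgt; apply/negP => C1.
pose C' := borel_lebesgue_rV R p (( *:%R c) @^-1` C).
have C'fin : C' \is a fin_num.
  by rewrite ge0_fin_numE; [exact: lt_trans C1 (ltry _)|exact: measure_ge0].
have := pl_EFin m01 ler01 ler01 (fine_ge0 (measure_ge0 _ _ : 0 <= C')%E).
rewrite fineK// => /(_ h); rewrite !powR1 mulr1; apply/negP; rewrite -ltNge.
by rewrite -lte_fin fineK.
Qed.

(** * Berwald's inequality *)

Section gamma.
Context (R : realType).
Local Notation mu := (@lebesgue_measure R).

Lemma integral_expn (m : nat) (a : R) : 0 <= a ->
  (\int[mu]_(s in `]0%R, a[) (m.+1%:R * s ^+ m)%:E)%E = (a ^+ m.+1)%:E.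
Proof.
rewrite le_eqVlt => /predU1P[<-|a0].
  by rewrite set_itv_ge ?integral_set0 ?expr0n// bnd_simp ltxx.
have cX k : continuous (fun x : R => x ^+ k) by exact: exprn_continuous.
rewrite -(@integral_itv_bndoo _ 0 a _ true false); last first.
  apply/measurable_EFinP/measurable_funTS; apply: measurable_funM => //.
rewrite (@continuous_FTC2 _ _ (fun x => x ^+ m.+1))//.
- by rewrite expr0n sube0.
- by apply: continuous_subspaceT => x; apply: cvgM; [exact: cvg_cst|exact: cX].
- split.
  + by move=> x _; exact: exprn_derivable.
  + by apply/cvg_at_right_filter; exact: cX.
  + by apply/cvg_at_left_filter; exact: cX.
- by move=> x _; rewrite exp_derive1.
Qed.

Lemma integral_expRN_tail (s : R) :
  (\int[mu]_(u in `]s, +oo[) (expR (- u))%:E)%E = (expR (- s))%:E.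
Proof.
have cE : continuous (fun x : R => expR (- x)).
  move=> x; apply: continuous_comp; first exact: opp_continuous.
  exact: continuous_expR.
rewrite integral_itv_obnd_cbnd; last first.
  apply/measurable_EFinP/measurable_funTS; exact: continuous_measurable_fun.
rewrite (@ge0_continuous_FTC2y _ _ (fun x => - expR (- x)) _ 0)//.
- by rewrite sub0e EFinN oppeK.
- by apply: continuous_subspaceT.
- by rewrite -oppr0; apply: cvgN; exact: cvgr_expR.
- by apply/cvg_at_right_filter; apply: cvgN; exact: cE.
- move=> x _; rewrite derive1_comp// derive1N// derive1_id mulN1r derive1_comp// derive1E.
  have /funeqP -> := @derive_expR R.
  by rewrite derive1N// derive1_id mulrN mulr1 opprK.
Qed.

(** The recursion is Tonelli on [0 < s < u]: there [u^(m+1)] is the integral of [(m + 1) s^m] over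
    [s < u], and [exp(-s)] that of [exp(-u)] over [u > s]. *)
Lemma integral_gamma (m : nat) :
  (\int[mu]_(s in `]0%R, +oo[) (s ^+ m * expR (- s))%:E)%E = (m`!%:R)%:E.
Proof.
elim: m => [|m IH].
  rewrite fact0 -(expR0 R) -[in RHS]oppr0 -integral_expRN_tail.
  by apply: eq_integral => s _; rewrite expr0 mul1r.
rewrite factS natrM EFinM -IH -ge0_integralZl_EFin//; last 2 first.
  move=> s /=; rewrite in_itv/= andbT => s0.
  by rewrite lee_fin mulr_ge0 ?expR_ge0// exprn_ge0// ltW.
  apply/measurable_EFinP/measurable_funTS; apply: measurable_funM; first exact: exprn_measurable.
  apply: measurableT_comp => //; exact: measurable_funN.
pose S : set (measurableTypeR R * measurableTypeR R) :=
  [set p | (0 < (p.2 : R)) /\ (p.2 : R) < (p.1 : R)].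
have mS : measurable S.
  have -> : S = (fun p => 0 < p.2) @^-1` [set true] `&` (fun p => p.2 < p.1) @^-1` [set true].
    by apply/seteqP; split.
  apply: measurableI; apply: measurable_preimageT => //; exact: measurable_fun_ltr.
pose g (p : measurableTypeR R * measurableTypeR R) : \bar R :=
  (m.+1%:R * `|p.2 : R| ^+ m * expR (- (p.1 : R)) * \1_S p)%:E.
have mg : measurable_fun setT g.
  apply/measurable_EFinP; apply: measurable_funM; last exact: measurable_indic.
  apply: measurable_funM.
    apply: measurable_funM => //; apply: measurable_funX.
    by apply: measurableT_comp => //; exact: measurable_snd.
  by apply: measurableT_comp => //; apply: measurable_funN; exact: measurable_fst.
have g0 p : (0 <= g p)%E.
  by rewrite lee_fin mulr_ge0// mulr_ge0 ?expR_ge0// mulr_ge0// exprn_ge0.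
transitivity (\int[mu]_u \int[mu]_s g (u, s))%E.
  rewrite integral_mkcond; apply: eq_integral => u _; rewrite patchE.
  case: ifPn; rewrite !(inE, notin_setE) /= in_itv/= andbT => u0; last first.
    apply/esym/integral0_eq => s _; rewrite /g indicE memNset ?mulr0// => -[/= s0 su].
    by apply: u0; exact: lt_trans su.
  rewrite EFinM -(integral_expn m (ltW u0)) -ge0_integralZr//; last 2 first.
  - by apply/measurable_EFinP; apply: measurable_funM => //; exact: exprn_measurable.
  - move=> s; rewrite /= in_itv/= => /andP[s0 _].
    by rewrite lee_fin mulr_ge0// exprn_ge0// ltW.
  rewrite integral_mkcond; apply: eq_integral => s _; rewrite patchE /g.
  case: ifPn; rewrite !(inE, notin_setE) /= in_itv/= => su.
    have /andP[s0 _] := su.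
    by rewrite indicE mem_set ?mulr1 ?gtr0_norm ?EFinM//; apply/andP.
  by rewrite indicE memNset ?mulr0// => /andP.
rewrite fubini_tonelli// [RHS]integral_mkcond; apply: eq_integral => s _; rewrite patchE.
case: ifPn; rewrite !(inE, notin_setE) /= in_itv/= andbT => s0; last first.
  by apply/integral0_eq => u _; rewrite /g indicE memNset ?mulr0// => -[].
rewrite -EFinM mulrA [in RHS]EFinM -integral_expRN_tail -ge0_integralZl_EFin//; last 2 first.
- by apply/measurable_EFinP/measurable_funTS; apply: measurableT_comp.
- by rewrite mulr_ge0// exprn_ge0// ltW.
rewrite [RHS]integral_mkcond; apply: eq_integral => u _; rewrite patchE /g.
case: ifPn; rewrite !(inE, notin_setE) /= in_itv/= andbT => su.
  by rewrite indicE mem_set ?mulr1 ?gtr0_norm ?EFinM.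
by rewrite indicE memNset ?mulr0// => -[].
Qed.

End gamma.

(* [N] is log-concave and [V expR (- s)] is log-linear with the same value at 0,
   so they cross once; equality of the moments of order [p] fixes the sign of the
   difference of the moments of higher order. *)
Lemma log_concave_moment_le (R : realType) (p q : nat) (V K : R) (N : R -> R) :
  measurable_fun setT N -> (forall t, 0 <= N t) -> 0 < V -> N 0 = V ->
  (forall l t1 t2, 0 < l < 1 -> 0 <= t1 -> 0 <= t2 ->
    N t1 `^ (1 - l) * N t2 `^ l <= N ((1 - l) * t1 + l * t2)) ->
  (forall t, K <= t -> N t = 0) ->
  (\int[lebesgue_measure]_(s in `]0%R, +oo[) (s ^+ p * N s)%:E = (V * p`!%:R)%:E)%E ->
  (\int[lebesgue_measure]_(s in `]0%R, +oo[) (s ^+ (p + q) * N s)%:E <=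
    (V * (p + q)`!%:R)%:E)%E.
Proof.
move=> mN N0 V0 N0V logN NK momp.
pose E s := V * expR (- s).
have E0 s : 0 < E s by rewrite mulr_gt0// expR_gt0.
(* The infimum [t0] of [B] is the crossing point. The vanishing of [N] from [K] on makes [B]
   nonempty; the maximum with 1 keeps the witness positive. *)
pose B := [set t | 0 < t /\ N t < E t].
have BK : B (Num.max K 1).
  split; first by rewrite lt_max ltr01 orbT.
  by rewrite NK ?E0// le_max lexx.
have B_lb : has_lbound B by exists 0 => t [/ltW].
pose t0 := inf B.
have t0_ge0 : 0 <= t0 by apply: lb_le_inf; [exists (Num.max K 1)|move=> t [/ltW]].
have lt_t0 t : 0 < t -> t < t0 -> E t <= N t.
  move=> t_gt0 tt0; rewrite leNgt; apply/negP => NE.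
  by move: tt0; rewrite ltNge => /negP; apply; exact: ge_inf.
(* Some [t' < t] has [N t' < E t']. On the segment from 0 to [t], log-concavity of [N],
   log-linearity of [E] and [N 0 = E 0] would turn [N t > E t] into [N t' >= E t']. *)
have gt_t0 t : t0 < t -> N t <= E t.
  move=> t0t; rewrite leNgt; apply/negP => NE.
  have [t' [t'0 t'E] t't] : exists2 t', B t' & t' < t.
    by apply: inf_lt => //; exists (Num.max K 1).
  have t_gt0 : 0 < t by rewrite (le_lt_trans t0_ge0).
  have l01 : 0 < t' / t < 1 by rewrite divr_gt0//= ltr_pdivrMr// mul1r.
  have := logN _ 0 t l01 (lexx _) (ltW t_gt0).
  rewrite mulr0 add0r divfK ?gt_eqF// N0V; apply/negP; rewrite -ltNge.
  apply: lt_le_trans t'E _.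
  have /andP[l0 l1] := l01.
  have -> : E t' = V `^ (1 - t' / t) * E t `^ (t' / t).
    rewrite /E powRM ?(ltW V0) ?expR_ge0// mulrA -powRD; last by rewrite subrK oner_eq0.
    rewrite subrK powRr1 ?(ltW V0)// -expRM; congr (_ * expR _).
    by field; rewrite gt_eqF.
  apply: ler_wpM2l; first exact: powR_ge0.
  by apply: ge0_ler_powR; rewrite ?nnegrE ?(ltW l0)// ltW.
(* The difference of the sides is [s^p (s^q - t0^q) (E s - N s)], whose last two factors never have
   opposite signs. After integration the terms with [t0^q] cancel, the moments of order [p] being
   equal. *)
have ptw s : 0 < s ->
    s ^+ (p + q) * N s + t0 ^+ q * (s ^+ p * E s) <=
    s ^+ (p + q) * E s + t0 ^+ q * (s ^+ p * N s).
  move=> s0; rewrite -subr_ge0.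
  have -> : s ^+ (p + q) * E s + t0 ^+ q * (s ^+ p * N s) -
     (s ^+ (p + q) * N s + t0 ^+ q * (s ^+ p * E s)) =
     s ^+ p * ((s ^+ q - t0 ^+ q) * (E s - N s)) by rewrite exprD; ring.
  apply: mulr_ge0; first by rewrite exprn_ge0// ltW.
  have [st0|st0|->] := ltgtP s t0.
  - apply: mulr_le0; rewrite subr_le0; last exact: lt_t0.
    by rewrite lerXn2r ?nnegrE ?(ltW s0) ?(ltW st0).
  - apply: mulr_ge0; rewrite subr_ge0; last exact: gt_t0.
    by rewrite lerXn2r ?nnegrE ?(ltW s0) ?(ltW st0).
  - by rewrite subrr mul0r.
have mX k (f : R -> R) : measurable_fun setT f ->
    measurable_fun (`]0, +oo[%classic : set R) (fun s => (s ^+ k * f s)%:E).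
  move=> mf; apply/measurable_EFinP/measurable_funTS; apply: measurable_funM => //.
have mE : measurable_fun setT E.
  by apply: measurable_funM => //; apply: measurableT_comp.
have X0 k (f : R -> R) : (forall s, 0 <= f s) ->
    forall s, (`]0, +oo[%classic : set R) s -> (0 <= (s ^+ k * f s)%:E)%E.
  by move=> f0 s; rewrite /= in_itv/= andbT => s0; rewrite lee_fin mulr_ge0// exprn_ge0// ltW.
have E_ge0 s : 0 <= E s by exact: ltW.
have IE k : (\int[lebesgue_measure]_(s in `]0%R, +oo[) (s ^+ k * E s)%:E = (V * k`!%:R)%:E)%E.
  rewrite EFinM -integral_gamma -ge0_integralZl_EFin//; last 3 first.
  - by apply: (X0 k (fun s => expR (- s))) => s; exact: expR_ge0.
  - by apply: (mX k (fun s => expR (- s))); apply: measurableT_comp.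
  - exact: ltW.
  by apply: eq_integral => s _; rewrite -EFinM /E; congr EFin; ring.
have tq0 : 0 <= t0 ^+ q by rewrite exprn_ge0.
have : (\int[lebesgue_measure]_(s in `]0%R, +oo[)
     ((s ^+ (p + q) * N s)%:E + (t0 ^+ q)%:E * (s ^+ p * E s)%:E) <=
   \int[lebesgue_measure]_(s in `]0%R, +oo[)
     ((s ^+ (p + q) * E s)%:E + (t0 ^+ q)%:E * (s ^+ p * N s)%:E))%E.
  apply: ge0_le_integral => //.
  - by move=> s s0; rewrite adde_ge0 ?mule_ge0 ?X0 ?lee_fin.
  - by apply: emeasurable_funD; [exact: mX|apply: measurable_funeM; exact: mX].
  - by apply: emeasurable_funD; [exact: mX|apply: measurable_funeM; exact: mX].
  - move=> s; rewrite /= in_itv/= andbT => s0.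
    by rewrite -!EFinM -!EFinD lee_fin ptw.
rewrite !ge0_integralD//; try exact: mX; try exact: X0;
  try (by apply: measurable_funeM; exact: mX);
  try by (move=> s s0; rewrite mule_ge0 ?lee_fin ?X0// -lee_fin; exact: X0).
rewrite !ge0_integralZl//; try exact: mX; try exact: X0; try by rewrite lee_fin.
by rewrite !IE momp -EFinM leeD2rE.
Qed.

Section berwald.
Context d (T : measurableType d) (R : realType).
Context (mu : {sigma_finite_measure set T -> \bar R}).

Lemma integral_expn_layer (h : T -> R) (m : nat) :
  measurable_fun setT h -> (forall x, 0 <= h x) ->
  (\int[mu]_x (h x ^+ m.+1)%:E =
   \int[lebesgue_measure]_(s in `]0%R, +oo[)
      ((m.+1%:R * s ^+ m)%:E * mu [set x | (s%:E < (h x)%:E)%E]))%E.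
Proof.
move=> mh h0.
(* The absolute value makes the weight nonnegative on the whole line, as [layer_cake_weight]
   requires. *)
pose w (s : R) := m.+1%:R * `|s| ^+ m.
transitivity (\int[lebesgue_measure]_(s in `]0%R, +oo[)
   ((w s)%:E * mu [set x | (s%:E < (h x)%:E)%E]))%E; last first.
  apply: eq_integral => s; rewrite inE /= in_itv/= andbT => s0.
  by rewrite /w gtr0_norm.
rewrite -(@layer_cake_weight _ _ _ mu (EFin \o h) w).
- apply: eq_integral => x _.
  rewrite -(integral_expn m (h0 x)) (_ : [set s | _] = `]0, h x[%classic); last first.
    by apply/seteqP; split => s /=; rewrite in_itv /= lte_fin; [move=> [-> ->]|move=> /andP[]].
  apply: eq_integral => s; rewrite inE /= in_itv/= => /andP[s0 _].
  by rewrite /w gtr0_norm.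
- exact/measurable_EFinP.
- by apply: measurable_funM => //; apply: measurable_funX.
- by move=> s; rewrite /w mulr_ge0// exprn_ge0.
Qed.

(* Berwald-Borell: the normalised moments of a function with log-concave
   distribution tail decrease. *)
Lemma berwald (h : T -> R) (p : nat) (K V : R) :
  measurable_fun setT h -> (forall x, 0 <= h x <= K) -> 0 < V ->
  mu [set x | 0 < h x] = V%:E ->
  (forall l t1 t2, 0 < l < 1 -> 0 <= t1 -> 0 <= t2 ->
    pl l (mu [set x | t1 < h x]) (mu [set x | t2 < h x])
       (mu [set x | (1 - l) * t1 + l * t2 < h x])) ->
  exists c, [/\ 0 < c,
    (\int[mu]_x (h x ^+ p.+1)%:E = (V * (c ^+ p.+1 * p.+1`!%:R))%:E)%E &
    forall q, (\int[mu]_x (h x ^+ (p.+1 + q))%:E <=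
       (V * (c ^+ (p.+1 + q) * (p.+1 + q)`!%:R))%:E)%E].
Proof.
move=> mh hK V0 muV hpl.
have h0 x : 0 <= h x by case/andP: (hK x).
have mS t : measurable [set x | t < h x].
  rewrite (_ : [set x | _] = [set x | (t%:E < (h x)%:E)%E]).
    by apply: measurable_superlevel; exact/measurable_EFinP.
  by apply/seteqP; split => x; rewrite /= lte_fin.
have muS t : 0 <= t -> (mu [set x | (t < h x)%R] <= V%:E)%E.
  move=> t0; rewrite -muV; apply: le_measure; rewrite ?inE//.
  by move=> x /=; exact: le_lt_trans.
have muSfin t : 0 <= t -> mu [set x | t < h x] \is a fin_num.
  by move=> t0; rewrite ge0_fin_numE// (le_lt_trans (muS _ t0))// ltry.
have mhX m : measurable_fun setT (fun x => (h x ^+ m)%:E).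
  by apply/measurable_EFinP; exact: measurable_funX.
pose I := (\int[mu]_x (h x ^+ p.+1)%:E)%E.
have I_ge0 : (0 <= I)%E.
  by apply: integral_ge0 => x _; rewrite lee_fin exprn_ge0.
have Ioo : (I < +oo)%E.
  apply: (@le_lt_trans _ _ (\int[mu]_x ((K ^+ p.+1)%:E * (\1_[set x | (0 < h x)%R] x)%:E))%E).
    apply: ge0_le_integral => //.
    - by move=> x _; rewrite lee_fin exprn_ge0.
    - by apply: measurable_funeM; exact/measurable_EFinP.
    - move=> x _; rewrite -EFinM lee_fin indicE.
      have [h_gt0|] := ltP 0 (h x).
        rewrite mem_set// mulr1 lerXn2r ?nnegrE//; have /andP[_ ?] := hK x => //.
        exact: le_trans (h0 x) _.
      move=> hx0; have hxE : h x = 0 by apply/eqP; rewrite eq_le hx0 h0.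
      rewrite hxE expr0n/= memNset ?mulr0//= hxE ltxx.
      by [].
  rewrite ge0_integralZl_EFin//; last 2 first.
  - exact/measurable_EFinP.
  - have [/eqP e|/set0P[x _]] := boolP ([set: T] == set0).
      move: muV; rewrite (_ : [set x | _] = set0) ?measure0; last first.
        by rewrite -subset0 -e.
      by move=> [/esym V00]; move: V0; rewrite V00 ltxx.
    by rewrite exprn_ge0//; have /andP[_ ?] := hK x; exact: le_trans (h0 x) _.
  by rewrite integral_indic// setIT [X in (_ * X)%E](_ : _ = V%:E)// -EFinM ltry.
have I_gt0 : (0 < I)%E.
  rewrite lt_neqAle I_ge0 andbT; apply/eqP => I0.
  have : (\int[mu]_x `|(h x ^+ p.+1)%:E| = 0)%E.
    by rewrite I0; apply: eq_integral => x _; rewrite gee0_abs// lee_fin exprn_ge0.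
  move/(ae_eq_integral_abs mu measurableT (mhX _)) => [A [mA A0 sA]].
  have : (mu [set x | (0 < h x)%R] <= mu A)%E.
    apply: le_measure; rewrite ?inE// => x /= hx; apply: sA => /= /(_ Logic.I).
    by move=> /eqP; rewrite eqe expf_eq0/= gt_eqF.
  by rewrite muV A0 lee_fin leNgt V0.
have Ifin : I \is a fin_num by rewrite ge0_fin_numE.
have fI0 : 0 < fine I by rewrite fine_gt0// I_gt0.
(* The scale for which the tail [V exp(-t / c)] has the same moment of order [p + 1] as [h]. A
   moment of order [m + 1] of [h / c] is [m + 1] times the integral of [s^m N s], so
   [log_concave_moment_le] is used with [p], one less than the order of the moment. *)
pose c := (fine I / (V * p.+1`!%:R)) `^ (p.+1%:R^-1).
have f0 : 0 < p.+1`!%:R :> R by rewrite ltr0n fact_gt0.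
have c0 : 0 < c by rewrite powR_gt0// divr_gt0// mulr_gt0.
have cE : c ^+ p.+1 = fine I / (V * p.+1`!%:R).
  rewrite -powR_mulrn ?ltW// /c -powRrM mulVf ?pnatr_eq0// powRr1//.
  by rewrite ltW// divr_gt0// mulr_gt0.
have IE : I = (V * (c ^+ p.+1 * p.+1`!%:R))%:E.
  rewrite -(fineK Ifin); congr EFin; rewrite cE; field.
  by rewrite !gt_eqF.
exists c; split => // q.
pose g x := h x / c.
have mg : measurable_fun setT g by exact: measurable_funM.
have g0 x : 0 <= g x by rewrite divr_ge0// ltW.
pose N t := fine (mu [set x | (t%:E < (g x)%:E)%E]).
have SE t : [set x | (t%:E < (g x)%:E)%E] = [set x | c * t < h x].
  by apply/seteqP; split => x; rewrite /= lte_fin /g ltr_pdivlMr// mulrC.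
have NE t : 0 <= t -> mu [set x | (t%:E < (g x)%:E)%E] = (N t)%:E.
  by move=> t0; rewrite /N fineK// SE muSfin// mulr_ge0// ltW.
have momE m : (\int[mu]_x (g x ^+ m.+1)%:E =
    (m.+1%:R)%:E * \int[lebesgue_measure]_(s in `]0%R, +oo[) (s ^+ m * N s)%:E)%E.
  rewrite integral_expn_layer// -ge0_integralZl_EFin//; last 2 first.
  - move=> s; rewrite /= in_itv/= andbT => s0; rewrite lee_fin mulr_ge0//.
      by rewrite exprn_ge0// ltW.
    by rewrite fine_ge0.
  - apply/measurable_EFinP; apply: measurable_funM; first exact: exprn_measurable.
    apply: measurable_funTS; apply: measurableT_comp => //.
    by apply: (measurable_distribution_tail mu); exact/measurable_EFinP.
  apply: eq_integral => s; rewrite inE /= in_itv/= andbT => s0.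
  by rewrite NE ?(ltW s0)// -!EFinM mulrA.
have gM m : (\int[mu]_x (h x ^+ m)%:E = (c ^+ m)%:E * \int[mu]_x (g x ^+ m)%:E)%E.
  rewrite -ge0_integralZl_EFin//; last 3 first.
  - by move=> x _; rewrite lee_fin exprn_ge0.
  - by apply/measurable_EFinP; exact: measurable_funX.
  - by rewrite exprn_ge0// ltW.
  by apply: eq_integral => x _; rewrite -EFinM -exprMn mulrC divfK// gt_eqF.
have mom0 : (\int[lebesgue_measure]_(s in `]0%R, +oo[) (s ^+ p * N s)%:E = (V * p`!%:R)%:E)%E.
  have := gM p.+1; rewrite -/I IE momE factS natrM => /(congr1 (fun z => ((c ^+ p.+1 * p.+1%:R)^-1)%:E * z)%E).
  have cp0 : c ^+ p.+1 != 0 by rewrite expf_neq0// gt_eqF.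
  rewrite !muleA -!EFinM -[_^-1 * _ * _]mulrA mulVf ?mul1e ?mulf_neq0// => <-.
  by congr EFin; field; rewrite cp0 addrC natr1 pnatr_eq0.
have mN : measurable_fun setT N.
  apply: measurableT_comp => //.
  by apply: (measurable_distribution_tail mu); exact/measurable_EFinP.
have N0 t : 0 <= N t by rewrite fine_ge0.
have := @log_concave_moment_le R p q V (K / c + 1) N mN N0 V0.
have -> : N 0 = V by rewrite /N SE mulr0 muV.
move=> /(_ erefl) H.
rewrite addSn gM momE muleA -EFinM.
have {}H : (\int[lebesgue_measure]_(s in `]0%R, +oo[) (s ^+ (p + q) * N s)%:E <= (V * (p + q)`!%:R)%:E)%E.
  apply: H => //.
    move=> l t1 t2 l01 t10 t20; apply: pl_EFin => //.
    have t30 : 0 <= (1 - l) * t1 + l * t2.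
      by case/andP: l01 => l0 l1; rewrite addr_ge0// mulr_ge0// ?subr_ge0 ltW.
    rewrite -!NE// !SE mulrDr (mulrCA c (1 - l)) (mulrCA c l).
    by apply: hpl => //; rewrite mulr_ge0// ltW.
  move=> t Kt; rewrite /N SE (_ : [set x | _] = set0) ?measure0//.
  rewrite -subset0 => x /=; apply/negP; rewrite -leNgt.
  apply: le_trans (_ : K <= _); first by case/andP: (hK x).
  by rewrite mulrC -ler_pdivrMr// (le_trans _ Kt)// lerDl.
apply: le_trans (lee_wpmul2l _ H) _; first by rewrite lee_fin mulr_ge0// exprn_ge0// ltW.
by rewrite -EFinM lee_fin factS natrM le_eqVlt; apply/orP; left; apply/eqP; ring.
Qed.

End berwald.

(** * Bounded log-concave functions and their fibers *)

Section graph_measure.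
Context (R : realType) (k : nat).

(** The measure on the pairs [z = (w, s)], bundled as sigma-finite because [berwald] is stated for
    such measures. *)
Definition rV_lebesgue_prod :
    {sigma_finite_measure set ('rV[R]_k * measurableTypeR R)%type -> \bar R} :=
  sval (sigma_finite_measure_of (sigma_finite_product (borel_lebesgue_rV R k)
    (@lebesgue_measure R))).

Lemma rV_lebesgue_prodE :
  rV_lebesgue_prod = (borel_lebesgue_rV R k \x @lebesgue_measure R)%E :> (set _ -> \bar R).
Proof. exact: (svalP (sigma_finite_measure_of _)). Qed.

Lemma integral_rV_lebesgue_prod (f : 'rV[R]_k * measurableTypeR R -> \bar R) :
  measurable_fun setT f -> (forall z, 0 <= f z)%E ->
  (\int[rV_lebesgue_prod]_z f z =
   \int[borel_lebesgue_rV R k]_w \int[lebesgue_measure]_s f (w, s))%E.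
Proof. by move=> mf f0; rewrite rV_lebesgue_prodE fubini_tonelli1. Qed.

Lemma measure_rV_lebesgue_prod (A : set ('rV[R]_k * measurableTypeR R)%type) :
  rV_lebesgue_prod A =
  (\int[borel_lebesgue_rV R k]_w @lebesgue_measure R [set s | A (w, s)])%E.
Proof.
rewrite rV_lebesgue_prodE; apply: eq_integral => w _ /=; congr lebesgue_measure.
by apply/seteqP; split => s; rewrite /xsection /= inE.
Qed.

End graph_measure.

(** [J] bounds the heights and [K] the support in both variables; together they make the fiber
    volumes at positive heights finite, as well as the measure of the set of [(w, s)] with a fiber
    of positive volume. *)
Definition bounded_log_concave (R : realType) (k p : nat)
    (F : 'rV[R]_k -> 'rV[R]_p -> \bar R) (J K : R) : Prop :=
  [/\ measurable_fun setT (fun z => F z.1 z.2),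
      (forall w a, (0 <= F w a <= J%:E)%E),
      (forall w a, (0 < F w a)%E -> cube K w /\ cube K a) &
      forall l w1 a1 w2 a2, 0 < l < 1 -> pl l (F w1 a1) (F w2 a2)
        (F ((1 - l) *: w1 + l *: w2) ((1 - l) *: a1 + l *: a2))].

Section fiber_volume.
Context (R : realType) (k p : nat).
Context (F : 'rV[R]_k -> 'rV[R]_p.+1 -> \bar R).
Local Notation lebn := (borel_lebesgue_rV R).
Local Notation T := ('rV[R]_k * measurableTypeR R)%type.

Definition fiber_vol (z : T) : \bar R := lebn p.+1 [set a | ((z.2 : R)%:E < F z.1 a)%E].

(** The side of a cube with the volume of the fiber; in these terms Brunn-Minkowski is concavity.
    The value 0 at heights [s <= 0] confines the base to positive heights and discards the fibers at
    negative heights, which are the whole space. *)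
Definition fiber_radius (z : T) : R :=
  if 0 < (z.2 : R) then fine (fiber_vol z) `^ (p.+1%:R^-1) else 0.

Context (J K : R) (K0 : 0 <= K) (blcF : bounded_log_concave F J K).

Let mF : measurable_fun setT (fun z => F z.1 z.2). Proof. by case: blcF. Qed.
Let F0 w a : (0 <= F w a)%E. Proof. by have [_ /(_ w a)/andP[]] := blcF. Qed.
Let FJ w a : (F w a <= J%:E)%E. Proof. by have [_ /(_ w a)/andP[]] := blcF. Qed.
Let Fcube w a : (0 < F w a)%E -> cube K w /\ cube K a.
Proof. by have [_ _ + _] := blcF; apply. Qed.
Let Fpl l w1 a1 w2 a2 : 0 < l < 1 -> pl l (F w1 a1) (F w2 a2)
        (F ((1 - l) *: w1 + l *: w2) ((1 - l) *: a1 + l *: a2)).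
Proof. by have [_ _ _] := blcF; apply. Qed.

Lemma measurable_fiber (z : T) : measurable [set a | ((z.2 : R)%:E < F z.1 a)%E].
Proof.
apply: measurable_superlevel; exact: (measurableT_comp mF (pair1_measurable z.1)).
Qed.

Lemma measurable_fiber_vol : measurable_fun setT fiber_vol.
Proof.
pose S : set (T * 'rV[R]_p.+1) := [set y | ((y.1.2 : R)%:E < F y.1.1 y.2)%E].
have mS : measurable S.
  rewrite -[X in measurable X]setTI; apply: measurable_lte => //.
    apply/measurable_EFinP.
    exact: (measurableT_comp measurable_snd measurable_fst).
  have m3 : measurable_fun setT (fun y : T * 'rV[R]_p.+1 => (y.1.1, y.2)).
    apply/measurable_fun_pairP; split; last exact: measurable_snd.
    exact: (measurableT_comp measurable_fst measurable_fst).
  exact: (measurableT_comp mF m3).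
have := measurable_fun_xsection (lebn p.+1) mS; congr measurable_fun.
apply/funext => z; rewrite /= /fiber_vol; congr (lebn p.+1 _).
by apply/seteqP; split => a; rewrite /xsection /= inE.
Qed.

Lemma fiber_vol_le (z : T) : 0 <= (z.2 : R) -> (fiber_vol z <= ((K *+ 2) ^+ p.+1)%:E)%E.
Proof.
move=> z0; rewrite -lebesgue_cube//; apply: le_measure; rewrite ?inE.
- exact: measurable_fiber.
- exact: measurable_cube.
- by move=> a /= za; have [] := Fcube (le_lt_trans _ za); rewrite ?lee_fin.
Qed.

Lemma fiber_vol_fin (z : T) : 0 <= (z.2 : R) -> fiber_vol z \is a fin_num.
Proof. by move=> z0; rewrite ge0_fin_numE ?(le_lt_trans (fiber_vol_le z0)) ?ltry ?measure_ge0. Qed.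

Lemma measurable_fiber_radius : measurable_fun setT fiber_radius.
Proof.
apply: measurable_fun_ifT => //.
  by apply: measurable_fun_ltr => //; exact: measurable_snd.
apply: (measurableT_comp (measurable_powR _)).
by apply: measurableT_comp => //; exact: measurable_fiber_vol.
Qed.

Lemma fiber_radiusX (z : T) : 0 < (z.2 : R) -> (fiber_radius z ^+ p.+1)%:E = fiber_vol z.
Proof.
move=> z0; rewrite /fiber_radius z0 -powR_mulrn ?powR_ge0// -powRrM mulVf ?pnatr_eq0//.
by rewrite powRr1 ?fine_ge0// ?measure_ge0// fineK// fiber_vol_fin// ltW.
Qed.

Lemma fiber_radius_ge0 (z : T) : 0 <= fiber_radius z.
Proof. by rewrite /fiber_radius; case: ifP => // _; exact: powR_ge0. Qed.

Lemma fiber_radius_le (z : T) : fiber_radius z <= K *+ 2.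
Proof.
case: (boolP (0 < (z.2 : R))) => z0; last by rewrite /fiber_radius (negbTE z0) mulrn_wge0.
rewrite -(@ler_pXn2r _ p.+1)// ?nnegrE ?fiber_radius_ge0 ?mulrn_wge0//.
by rewrite -lee_fin fiber_radiusX// fiber_vol_le// ltW.
Qed.

Lemma fiber_radius_gt0 (z : T) :
  (0 < fiber_radius z) = (0 < (z.2 : R)) && (0 < fiber_vol z)%E.
Proof.
case: (boolP (0 < (z.2 : R))) => z0; last by rewrite /fiber_radius (negbTE z0) ltxx.
by rewrite -fiber_radiusX// lte_fin !lt_def fiber_radius_ge0 exprn_ge0 ?fiber_radius_ge0//= expf_eq0.
Qed.

Lemma fiber_radius0 (z : T) : ~~ (0 < (z.2 : R)) -> fiber_radius z = 0.
Proof. by rewrite /fiber_radius => /negbTE ->. Qed.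

Local Opaque fiber_radius.

Let leX (x y : R) : 0 <= x -> 0 <= y -> x ^+ p.+1 <= y ^+ p.+1 -> x <= y.
Proof. by move=> x0 y0; rewrite ler_pXn2r ?nnegrE. Qed.

Let convex_lt (l a b x y : R) : 0 < l < 1 -> a < x -> b < y ->
  (1 - l) * a + l * b < (1 - l) * x + l * y.
Proof.
by move=> /andP[l0 l1] ax b_y; apply: ltrD; rewrite ltr_pM2l// subr_gt0.
Qed.

Let le_of_EFin (x y : R) (a b : \bar R) : x%:E = a -> y%:E = b -> (a <= b)%E -> x <= y.
Proof. by move=> <- <-; rewrite lee_fin. Qed.

Lemma fiber_radius_le_mono (w : 'rV[R]_k) (s t : R) : 0 < s -> s <= t ->
  fiber_radius (w, t) <= fiber_radius (w, s).
Proof.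
move=> s0 st; have t0 := lt_le_trans s0 st.
apply: leX; [exact: fiber_radius_ge0|exact: fiber_radius_ge0|].
apply: (le_of_EFin (fiber_radiusX (z := (w, t)) t0) (fiber_radiusX (z := (w, s)) s0)).
apply: le_measure; rewrite ?inE; [exact: measurable_fiber|exact: measurable_fiber|].
by move=> a /=; apply: le_lt_trans; rewrite lee_fin.
Qed.

(** Log-concavity of [F] combines the heights geometrically and puts the Minkowski combination of
    the two fibers inside the fiber over the combined point. *)
Lemma fiber_radius_concave (l : R) (w1 w2 : 'rV[R]_k) (s1 s2 : R) : 0 < l < 1 ->
  0 < fiber_radius (w1, s1) -> 0 < fiber_radius (w2, s2) ->
  (1 - l) * fiber_radius (w1, s1) + l * fiber_radius (w2, s2) <=
  fiber_radius ((1 - l) *: w1 + l *: w2, s1 `^ (1 - l) * s2 `^ l).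
Proof.
move=> l01 r1 r2; have /andP[l0 l1] := l01.
have s10 : 0 < s1 by have := r1; rewrite fiber_radius_gt0 => /andP[].
have s20 : 0 < s2 by have := r2; rewrite fiber_radius_gt0 => /andP[].
have s0 : 0 < s1 `^ (1 - l) * s2 `^ l by rewrite mulr_gt0// powR_gt0.
apply: leX; [|exact: fiber_radius_ge0|].
  have l1' : 0 <= 1 - l by rewrite subr_ge0 ltW.
  exact: (addr_ge0 (mulr_ge0 l1' (ltW r1)) (mulr_ge0 (ltW l0) (ltW r2))).
apply: (le_of_EFin erefl (fiber_radiusX (z := (_, _)) s0)).
apply: (@brunn_minkowski _ _ l _ _ _ _ _ l01 r1 r2 (measurable_fiber (w1, s1))
  (measurable_fiber (w2, s2))); first exact: measurable_fiber.
- by move=> a1 a2 /= h1 h2; exact: (pl_lt l01 (@Fpl l w1 a1 w2 a2 l01) s10 s20 h1 h2).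
- exact/esym/(fiber_radiusX (z := (w1, s1)) s10).
- exact/esym/(fiber_radiusX (z := (w2, s2)) s20).
Qed.

Lemma measurable_fiber_radius_gt (t : R) : measurable [set z | t < fiber_radius z].
Proof.
rewrite (_ : [set z | _] = [set z | (t%:E < (fiber_radius z)%:E)%E]).
  by apply: measurable_superlevel; apply/measurable_EFinP; exact: measurable_fiber_radius.
by apply/seteqP; split => x; rewrite /= lte_fin.
Qed.

(** For fixed [w] the radius decreases in the height, so the heights with radius above [t >= 0] form
    an interval starting at 0, and every positive height below its length belongs to it. Concavity
    of the radius thus gives [pl] for these lengths, which Prekopa-Leindler integrates over [w]. *)
Lemma fiber_radius_tail_pl (l t1 t2 : R) : 0 < l < 1 -> 0 <= t1 -> 0 <= t2 ->
  pl l (rV_lebesgue_prod R k [set z | t1 < fiber_radius z])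
       (rV_lebesgue_prod R k [set z | t2 < fiber_radius z])
       (rV_lebesgue_prod R k [set z | (1 - l) * t1 + l * t2 < fiber_radius z]).
Proof.
move=> l01 t10 t20; have /andP[l0 l1] := l01.
have m_tail t : measurable_fun setT
    (fun w => @lebesgue_measure R [set s | t < fiber_radius (w, s)]).
  have := measurable_fun_xsection (@lebesgue_measure R) (measurable_fiber_radius_gt t).
  congr measurable_fun; apply/funext => w /=; congr lebesgue_measure.
  by apply/seteqP; split => s; rewrite /xsection /= inE.
have m_sec t w : measurable [set s : measurableTypeR R | t < fiber_radius (w, s)].
  exact: (measurable_preimageT (pair1_measurable w) (measurable_fiber_radius_gt t)).
have mem_tail t w s : 0 <= t -> 0 < s ->
    (s%:E < @lebesgue_measure R [set s | (t < fiber_radius (w, s))%R])%E ->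
    t < fiber_radius (w, s).
  move=> t0 s0 sm; rewrite ltNge; apply/negP => rt.
  suff : (@lebesgue_measure R [set s | (t < fiber_radius (w, s))%R] <= s%:E)%E.
    by rewrite leNgt sm.
  apply: (@le_trans _ _ (@lebesgue_measure R `]0, s[%classic)); last first.
    by rewrite lebesgue_measure_itv/= lte_fin s0 -EFinB subr0.
  apply: le_measure; rewrite ?inE// => u /= tu; rewrite in_itv /=.
  have := le_lt_trans t0 tu; rewrite fiber_radius_gt0 => /andP[/= u0 _]; rewrite u0 /=.
  rewrite ltNge; apply/negP => su.
  by have := lt_le_trans tu (le_trans (fiber_radius_le_mono w s0 su) rt); rewrite ltxx.
rewrite !measure_rV_lebesgue_prod; apply: prekopa_leindler => //;
  [exact: m_tail|exact: m_tail|exact: m_tail|move=> w1 w2 s1 s2 s10 s20 h1 h2].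
have r1 := mem_tail _ _ _ t10 s10 h1; have r2 := mem_tail _ _ _ t20 s20 h2.
set s := s1 `^ (1 - l) * s2 `^ l.
have s0 : 0 < s by rewrite mulr_gt0// powR_gt0.
apply: (@le_trans _ _ (@lebesgue_measure R `]0, s]%classic)).
  by rewrite lebesgue_measure_itv/= lte_fin s0 -EFinB subr0.
apply: le_measure; rewrite ?inE; [by []|exact: m_sec|].
move=> u /=; rewrite in_itv /= => /andP[u0 us].
apply: lt_le_trans (fiber_radius_le_mono _ u0 us).
apply: lt_le_trans (fiber_radius_concave l01 (le_lt_trans t10 r1) (le_lt_trans t20 r2)).
exact: (convex_lt l01 r1 r2).
Qed.

Lemma integral_fiber_radius :
  (\int[rV_lebesgue_prod R k]_z (fiber_radius z ^+ p.+1)%:E =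
   \int[lebn k]_w \int[lebn p.+1]_a F w a)%E.
Proof.
rewrite integral_rV_lebesgue_prod; last 2 first.
- by apply/measurable_EFinP; apply: measurable_funX; exact: measurable_fiber_radius.
- by move=> z; rewrite lee_fin exprn_ge0// fiber_radius_ge0.
apply: eq_integral => w _; rewrite [RHS]layer_cake//; last first.
  exact: (measurableT_comp mF (pair1_measurable w)).
rewrite [RHS]integral_mkcond; apply: eq_integral => s _; rewrite patchE.
case: ifPn; rewrite !(inE, notin_setE) /= in_itv/= andbT => s0.
  exact: (fiber_radiusX (z := (w, s)) s0).
by rewrite fiber_radius0 ?expr0n//=; exact/negP.
Qed.

Lemma fiber_radius_support_lty :
  (rV_lebesgue_prod R k [set z | (0 < fiber_radius z)%R] < +oo)%E.
Proof.
apply: (@le_lt_trans _ _ (rV_lebesgue_prod R k (cube K `*` `]0, J]%classic))).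
  apply: le_measure; rewrite ?inE.
  - exact: measurable_fiber_radius_gt.
  - by apply: measurableX => //; exact: measurable_cube.
  move=> [w s] /=; rewrite fiber_radius_gt0 /= => /andP[s0 v0].
  have [a sa] : exists a, (s%:E < F w a)%E.
    apply: contrapT => /forallNP h; move: v0; rewrite /fiber_vol.
    rewrite (_ : [set a | _] = set0) ?measure0 ?ltxx//.
    by rewrite -subset0 => a /= /h.
  split; first by have [] := Fcube (lt_trans (_ : 0 < s%:E)%E sa); rewrite ?lte_fin.
  by rewrite in_itv/= s0 -lee_fin (le_trans (ltW sa)).
rewrite rV_lebesgue_prodE product_measure1E//; last exact: measurable_cube.
have cK : lebn k (cube K) \is a fin_num by rewrite lebesgue_cube.
apply: lte_mul_pinfty; [exact: measure_ge0|exact: cK|].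
by rewrite /= lebesgue_measure_itv/=; case: ifP => _; rewrite ?ltry.
Qed.

End fiber_volume.

Lemma young_expn (R : realType) (p q : nat) (x y : R) : 0 <= x -> 0 <= y ->
  x ^+ p.+1 * y ^+ q.+1 <=
  (p.+1%:R / (p.+1 + q.+1)%:R) * x ^+ (p.+1 + q.+1) +
  (q.+1%:R / (p.+1 + q.+1)%:R) * y ^+ (p.+1 + q.+1).
Proof.
move=> x0 y0; set n := (p.+1 + q.+1)%N.
have n0 : 0 < n%:R :> R by rewrite ltr0n.
have := @conjugate_powR R (x ^+ p.+1) (y ^+ q.+1) (n%:R / p.+1%:R) (n%:R / q.+1%:R)
  (exprn_ge0 _ x0) (exprn_ge0 _ y0).
have powE (z : R) m : 0 <= z -> (z ^+ m.+1) `^ (n%:R / m.+1%:R) = z ^+ n.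
  move=> z0; rewrite -powR_mulrn// -powRrM mulrC divfK ?pnatr_eq0// powR_mulrn//.
rewrite !powE// !divr_gt0// !invf_div => /(_ isT isT).
rewrite -mulrDl -natrD divff ?gt_eqF// => /(_ erefl).
by rewrite mulrC (mulrC (x ^+ n)) (mulrC (y ^+ n)) (mulrC (y ^+ q.+1)).
Qed.

(** Young's inequality for [x / c] and [y / d]. With Berwald's scales for [c] and [d], the two
    moment bounds, proportional to [c^n] and [d^n] for [n = p + q + 2], enter with total weight
    [c^(p+1) d^(q+1)]. *)
Lemma young_expn_scaled (R : realType) (p q : nat) (x y c d : R) :
  0 <= x -> 0 <= y -> 0 < c -> 0 < d ->
  x ^+ p.+1 * y ^+ q.+1 <=
  c ^+ p.+1 * d ^+ q.+1 * (p.+1%:R / (p.+1 + q.+1)%:R) / c ^+ (p.+1 + q.+1) *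
    x ^+ (p.+1 + q.+1) +
  c ^+ p.+1 * d ^+ q.+1 * (q.+1%:R / (p.+1 + q.+1)%:R) / d ^+ (p.+1 + q.+1) *
    y ^+ (p.+1 + q.+1).
Proof.
move=> x0 y0 c0 d0.
have := young_expn p q (divr_ge0 x0 (ltW c0)) (divr_ge0 y0 (ltW d0)).
have cd0 : 0 < c ^+ p.+1 * d ^+ q.+1 by rewrite mulr_gt0// exprn_gt0.
rewrite !exprMn !exprVn => /(ler_wpM2l (ltW cd0)).
have cp : c ^+ p.+1 != 0 by rewrite expf_neq0// gt_eqF.
have dp : d ^+ q.+1 != 0 by rewrite expf_neq0// gt_eqF.
have -> : c ^+ p.+1 * d ^+ q.+1 * (x ^+ p.+1 / c ^+ p.+1 * (y ^+ q.+1 / d ^+ q.+1)) =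
   x ^+ p.+1 * y ^+ q.+1 by rewrite mulrACA !(mulrC (_ ^+ _) (_ / _)) !divfK.
move=> /le_trans; apply; rewrite le_eqVlt; apply/orP; left; apply/eqP.
move: (c ^+ (p.+1 + q.+1))^-1 (d ^+ (p.+1 + q.+1))^-1 (_%:R^-1) => u v n; ring.
Qed.

Lemma integral_young d (T : measurableType d) (R : realType)
    (mu : {measure set T -> \bar R}) (p q : nat) (f g : T -> R) (v a b : R) :
  measurable_fun setT f -> measurable_fun setT g ->
  (forall x, 0 <= f x) -> (forall x, 0 <= g x) -> 0 < a -> 0 < b ->
  (\int[mu]_x (f x ^+ (p.+1 + q.+1))%:E <=
     (v * (a ^+ (p.+1 + q.+1) * (p.+1 + q.+1)`!%:R))%:E)%E ->
  (\int[mu]_x (g x ^+ (q.+1 + p.+1))%:E <=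
     (v * (b ^+ (q.+1 + p.+1) * (q.+1 + p.+1)`!%:R))%:E)%E ->
  (\int[mu]_x (f x ^+ p.+1 * g x ^+ q.+1)%:E <=
     (v * (a ^+ p.+1 * b ^+ q.+1 * (p.+1 + q.+1)`!%:R))%:E)%E.
Proof.
move=> mf mg f0 g0 a0 b0; rewrite (addnC q.+1).
set n := (p.+1 + q.+1)%N => hf hg.
pose A := a ^+ p.+1 * b ^+ q.+1 * (p.+1%:R / n%:R) / a ^+ n.
pose B := a ^+ p.+1 * b ^+ q.+1 * (q.+1%:R / n%:R) / b ^+ n.
have ab0 : 0 <= a ^+ p.+1 * b ^+ q.+1 by rewrite mulr_ge0 ?exprn_ge0 ?(ltW a0) ?(ltW b0).
have A0 : 0 <= A by rewrite mulr_ge0 ?invr_ge0 ?exprn_ge0 ?(ltW a0)// mulr_ge0 ?divr_ge0.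
have B0 : 0 <= B by rewrite mulr_ge0 ?invr_ge0 ?exprn_ge0 ?(ltW b0)// mulr_ge0 ?divr_ge0.
have mX (h : T -> R) m : measurable_fun setT h -> measurable_fun setT (fun x => (h x ^+ m)%:E).
  by move=> mh; apply/measurable_EFinP; exact: measurable_funX.
have X0 (h : T -> R) m : (forall x, 0 <= h x) -> forall x, setT x -> (0 <= (h x ^+ m)%:E)%E.
  by move=> h0 x _; rewrite lee_fin exprn_ge0.
apply: (@le_trans _ _ (\int[mu]_x (A%:E * (f x ^+ n)%:E + B%:E * (g x ^+ n)%:E))%E).
  apply: ge0_le_integral => //.
  - by move=> x _; rewrite lee_fin mulr_ge0// exprn_ge0.
  - by apply/measurable_EFinP; apply: measurable_funM; apply: measurable_funX.
  - by apply: emeasurable_funD; apply: measurable_funeM; exact: mX.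
  - move=> x _; rewrite -!EFinM -EFinD lee_fin.
    exact: (young_expn_scaled p q (f0 x) (g0 x) a0 b0).
rewrite ge0_integralD//; last 4 first.
- by move=> x _; rewrite mule_ge0// ?lee_fin// exprn_ge0.
- by apply: measurable_funeM; exact: mX.
- by move=> x _; rewrite mule_ge0// ?lee_fin// exprn_ge0.
- by apply: measurable_funeM; exact: mX.
rewrite ge0_integralZl_EFin//; [|exact: X0|exact: mX].
rewrite ge0_integralZl_EFin//; [|exact: X0|exact: mX].
have hA := lee_wpmul2l (_ : (0 <= A%:E)%E) hf; have hB := lee_wpmul2l (_ : (0 <= B%:E)%E) hg.
rewrite !lee_fin in hA hB; apply: le_trans (leeD (hA A0) (hB B0)) _.
rewrite -!EFinM -EFinD lee_fin le_eqVlt; apply/orP; left; apply/eqP.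
have an : a ^+ n != 0 by rewrite expf_neq0// gt_eqF.
have bn : b ^+ n != 0 by rewrite expf_neq0// gt_eqF.
have nE : n%:R = p.+1%:R + q.+1%:R :> R by rewrite natrD.
have n0 : p.+1%:R + q.+1%:R != 0 :> R by rewrite -nE pnatr_eq0.
rewrite /A /B nE; move: an bn n0 n`!%:R => + + + w.
move: (a ^+ n) (b ^+ n) p.+1%:R q.+1%:R (a ^+ p.+1) (b ^+ q.+1) => an bn P Q ap bq an0 bn0 PQ0.
by field; rewrite an0 bn0 PQ0.
Qed.

Local Opaque fiber_radius.

Section fiber_inequality.
Context (R : realType) (k p q : nat).
Context (F : 'rV[R]_k -> 'rV[R]_p.+1 -> \bar R) (G : 'rV[R]_k -> 'rV[R]_q.+1 -> \bar R).
Context (J K : R) (K0 : 0 <= K).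
Context (blcF : bounded_log_concave F J K) (blcG : bounded_log_concave G J K).
Local Notation lebn := (borel_lebesgue_rV R).
Local Notation mu := (rV_lebesgue_prod R k).

(** Over [w], the superlevel set of the minimum at height [s] is the product of the two fibers, so
    the layer cake formula yields the product of their volumes. *)
Lemma integral_min_fiber_radius :
  (\int[lebn k]_w \int[lebn p.+1]_a \int[lebn q.+1]_b mine (F w a) (G w b) =
   \int[mu]_z (fiber_radius F z ^+ p.+1 * fiber_radius G z ^+ q.+1)%:E)%E.
Proof.
have [mF F0J _ _] := blcF; have [mG G0J _ _] := blcG.
rewrite integral_rV_lebesgue_prod; last 2 first.
- apply/measurable_EFinP; apply: measurable_funM; apply: measurable_funX.
    exact: (measurable_fiber_radius blcF).
  exact: (measurable_fiber_radius blcG).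
- by move=> z; rewrite lee_fin mulr_ge0// exprn_ge0// fiber_radius_ge0.
apply: eq_integral => w _.
pose m (y : 'rV[R]_p.+1 * 'rV[R]_q.+1) := mine (F w y.1) (G w y.2).
have mm : measurable_fun setT m.
  apply: measurable_mine.
    exact: (measurableT_comp (measurableT_comp mF (pair1_measurable w)) measurable_fst).
  exact: (measurableT_comp (measurableT_comp mG (pair1_measurable w)) measurable_snd).
have m0 y : (0 <= m y)%E.
  by rewrite le_min; case/andP: (F0J w y.1) => ->; case/andP: (G0J w y.2) => ->.
have [nu nuE] := sigma_finite_measure_of (sigma_finite_product (lebn p.+1) (lebn q.+1)).
transitivity (\int[nu]_y m y)%E; first by rewrite nuE fubini_tonelli1.
rewrite layer_cake// [LHS]integral_mkcond; apply: eq_integral => s _; rewrite patchE.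
case: ifPn; rewrite !(inE, notin_setE) /= in_itv/= andbT => s0; last first.
  by rewrite fiber_radius0 ?expr0n ?mul0r//=; exact/negP.
rewrite EFinM (fiber_radiusX K0 blcF)// (fiber_radiusX K0 blcG)// nuE.
rewrite -product_measure1E; last 2 first.
- exact: (measurable_fiber blcF).
- exact: (measurable_fiber blcG).
by congr (product_measure1 _ _ _); apply/seteqP; split => -[a b] /=; rewrite /m lt_min;
  [move=> /andP[]|move=> [-> ->]].
Qed.

(** The hypothesis lets Berwald's inequality act with the same mass [V] on both radii; the factor
    [V] on the left supplies the second mass in the product of the two moments. *)
Lemma fiber_inequality :
  (forall z, (0 < fiber_radius F z) = (0 < fiber_radius G z)) ->
  (mu [set z | (0 < fiber_radius F z)%R] *
    \int[lebn k]_w \int[lebn p.+1]_a \int[lebn q.+1]_b mine (F w a) (G w b) <=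
   'C(p.+1 + q.+1, q.+1)%:R%:E *
    ((\int[lebn k]_w \int[lebn p.+1]_a F w a) * (\int[lebn k]_w \int[lebn q.+1]_b G w b)))%E.
Proof.
move=> FG.
have [mF F0J _ _] := blcF; have [mG G0J _ _] := blcG.
set V := mu _.
have V_fin : V \is a fin_num.
  by rewrite ge0_fin_numE ?measure_ge0//; exact: (fiber_radius_support_lty K0 blcF).
(* Berwald's inequality asks for [V > 0]; if [V = 0], the left side is 0 even when the other factor
   is infinite. *)
have [V0|V0] := eqVneq V 0%E.
  rewrite V0 mul0e mule_ge0 ?lee_fin//; apply: mule_ge0; apply: integral_ge0 => w _;
    apply: integral_ge0 => a _; [by case/andP: (F0J w a)|by case/andP: (G0J w a)].
pose v := fine V.
have VE : V = v%:E by rewrite fineK.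
have v0 : 0 < v by rewrite fine_gt0// lt_def V0 measure_ge0 ltey_eq V_fin.
have rK k' p' (F' : 'rV[R]_k' -> 'rV[R]_p'.+1 -> \bar R) :
    bounded_log_concave F' J K -> forall z, 0 <= fiber_radius F' z <= K *+ 2.
  by move=> blc z; rewrite fiber_radius_ge0 (fiber_radius_le K0 blc).
have VG : mu [set z | 0 < fiber_radius G z] = v%:E.
  have SE : [set z | 0 < fiber_radius G z] = [set z | 0 < fiber_radius F z].
    exact: (funext (fun z => congr1 is_true (esym (FG z)))).
  rewrite SE.
  exact: VE.
have [c [c0 cE cq]] := berwald p (measurable_fiber_radius blcF) (rK _ _ _ blcF) v0 VE
  (fun l t1 t2 => @fiber_radius_tail_pl _ _ _ _ _ _ K0 blcF l t1 t2).
have [d [d0 dE dq]] := berwald q (measurable_fiber_radius blcG) (rK _ _ _ blcG) v0 VG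
  (fun l t1 t2 => @fiber_radius_tail_pl _ _ _ _ _ _ K0 blcG l t1 t2).
rewrite -(integral_fiber_radius K0 blcF) -(integral_fiber_radius K0 blcG) cE dE.
rewrite integral_min_fiber_radius VE.
set n := (p.+1 + q.+1)%N.
have X_le := integral_young (measurable_fiber_radius blcF) (measurable_fiber_radius blcG)
  (fiber_radius_ge0 F) (fiber_radius_ge0 G) c0 d0 (cq q.+1) (dq p.+1).
apply: (@le_trans _ _ (v%:E * (v * (c ^+ p.+1 * d ^+ q.+1 * n`!%:R))%:E)%E).
  by apply: lee_wpmul2l; rewrite ?lee_fin ?(ltW v0).
rewrite -!EFinM lee_fin le_eqVlt; apply/orP; left; apply/eqP.
have -> : n`!%:R = 'C(n, q.+1)%:R * (p.+1`!%:R * q.+1`!%:R) :> R.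
  by rewrite -!natrM -(@bin_fact n q.+1) ?leq_addl// /n addnK (mulnC q.+1`!).
ring.
Qed.

End fiber_inequality.

(** * Integrals over the completed measure *)

Section completion.
Context d (T : measurableType d) (R : realType) (mu : {measure set T -> \bar R}).
Local Open Scope ereal_scope.
Local Notation nu := (@completed_measure_extension _ _ _ mu).
Local Notation cT := (caratheodory_type (mu_ext mu)).

Lemma completed_measureE (A : set T) : measurable A -> nu A = mu A.
Proof. by move=> mA; rewrite /completed_measure_extension measurable_mu_extE. Qed.

Lemma measurable_completed (A : set T) : measurable A -> measurable (A : set cT).
Proof. exact: caratheodory_measurable_mu_ext. Qed.

Lemma measurable_fun_completed d' (T' : measurableType d') (f : T -> T') :
  measurable_fun setT f -> measurable_fun setT (f : cT -> T').
Proof.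
move=> mf _ A mA; apply: measurable_completed.
by rewrite setTI; exact: measurable_preimageT.
Qed.

(** The identity, from the completed to the original sigma-algebra, is measurable and carries [nu]
    to [mu]. *)
Lemma integral_completed (f : T -> \bar R) : measurable_fun setT f ->
  (forall x, 0 <= f x) -> \int[nu]_x f x = \int[mu]_x f x.
Proof.
move=> mf f0.
have mid : measurable_fun setT (id : cT -> T).
  by apply: measurable_fun_completed; exact: measurable_id.
transitivity (\int[measure_function_pushforward__canonical__measure_function_Measure nu mid]_x f x).
  by rewrite (ge0_integral_pushforward mid nu measurableT mf).
apply: eq_measure_integral => A mA _; exact: completed_measureE.
Qed.

Import HBNNSimple.

(** The integral of a nonnegative function is the supremum over the simple functions below it, hence
    monotone even among functions that are not measurable, such as the projections of [f] may be. *)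
Lemma le_integral_lower d' (T' : measurableType d') (m : {measure set T' -> \bar R})
    (f g : T' -> \bar R) :
  (forall x, 0 <= f x) -> (forall x, f x <= g x) ->
  \int[m]_x f x <= \int[m]_x g x.
Proof.
move=> f0 fg; have g0 x : 0 <= g x by exact: le_trans (f0 x) (fg x).
rewrite !ge0_integralTE//; apply: le_ereal_sup => _ [h hf <-].
by exists h => // x; exact: le_trans (hf x) (fg x).
Qed.

Lemma le_integral_completed (f g : T -> \bar R) : measurable_fun setT f ->
  (forall x, 0 <= f x) -> (forall x, f x <= g x) -> \int[mu]_x f x <= \int[nu]_x g x.
Proof.
move=> mf f0 fg; rewrite -integral_completed//; exact: le_integral_lower.
Qed.

(** Take countable covers of [A] whose total measure exceeds the outer measure by at most [1/(m+1)],
    and intersect their unions over [m]. *)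
Lemma mu_ext_hull (A : set T) : exists C, [/\ measurable C, A `<=` C & mu C = mu_ext mu A].
Proof.
have [Aoo|Afin] := eqVneq (mu_ext mu A) +oo.
  exists setT; split => //; rewrite Aoo; apply/eqP; rewrite -leye_eq -Aoo.
  by rewrite -(measurable_mu_extE mu measurableT); exact: le_mu_ext.
have {}Afin : mu_ext mu A \is a fin_num by rewrite ge0_fin_numE ?ltey// mu_ext_ge0.
have cov (m : nat) : exists C, [/\ measurable C, A `<=` C &
    mu C <= mu_ext mu A + (m.+1%:R^-1)%:E].
  have [|_ [F [mF AF] <-] hF] := @lb_ereal_inf_adherent _ [set \sum_(k <oo) mu (F k) | F in measurable_cover A] (m.+1%:R^-1) _ Afin.
    by rewrite invr_gt0.
  exists (\bigcup_k F k); split => //; first exact: bigcupT_measurable.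
  apply: le_trans (ltW hF).
  by apply: measure_sigma_subadditive => //; exact: bigcupT_measurable.
have [C hC] := choice cov.
have mC : measurable (\bigcap_m C m).
  by apply: bigcapT_measurable => m; case: (hC m).
have AC : A `<=` \bigcap_m C m by move=> x Ax m _; have [_ + _] := hC m; exact.
exists (\bigcap_m C m); split => //; apply/eqP; rewrite eq_le; apply/andP; split.
  apply/lee_addgt0Pr => e e0.
  have [m me] : exists m : nat, (m.+1%:R^-1 < e)%R.
    exists (Num.trunc e^-1); rewrite invf_plt ?posrE//; exact: truncnS_gt.
  have [mCm _ Cm] := hC m.
  apply: (@le_trans _ _ (mu (C m))).
    by apply: le_measure; rewrite ?inE// => x; apply.
  by apply: le_trans Cm _; rewrite leeD2l// lee_fin ltW.
by rewrite -(measurable_mu_extE mu mC); exact: le_mu_ext.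
Qed.

End completion.

Section completion_sigma_finite.
Context d (T : measurableType d) (R : realType) (mu : {measure set T -> \bar R}).
Context (smu : sigma_finite setT mu).
Local Open Scope ereal_scope.
Local Notation nu := (@completed_measure_extension _ _ _ mu).
Local Notation cT := (caratheodory_type (mu_ext mu)).

(** In a piece [D m] of finite measure, remove a measurable hull of the part outside [A]. What is
    left lies in [A], and the Caratheodory splitting of [D m] by [A] shows that no measure is lost.
    The pieces exhaust the space. *)
Lemma completed_kernel (A : set T) : measurable (A : set cT) ->
  exists B, [/\ measurable B, B `<=` A & mu B = nu A].
Proof.
have E (X : set T) : measurable X -> mu X = nu X.
  by move=> mX; exact/esym/completed_measureE.
move=> mA; have /sigma_finiteP[D [TD ndD Doo]] := smu.
have piece (m : nat) : exists B, [/\ measurable B, B `<=` A & nu (A `&` D m) <= mu B].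
  have [mD Dfin] := Doo m.
  have [C [mC DC CE]] := mu_ext_hull mu (D m `\` A).
  exists (D m `\` C); split; first exact: measurableD.
    move=> x [Dx Cx]; apply: contrapT => Ax; exact: Cx (DC _ (conj Dx Ax)).
  have Dsplit : mu (D m) = nu (A `&` D m) + mu C.
    rewrite (E _ mD) CE [A `&` _]setIC setDE.
    exact: (mA (D m)).
  have Cfin : mu C \is a fin_num.
    rewrite ge0_fin_numE//; apply: le_lt_trans Dfin.
    rewrite CE; apply: (@le_trans _ _ (nu (D m))); last by rewrite completed_measureE.
    by apply: le_mu_ext; exact: subDsetl.
  rewrite -(leeD2rE _ _ Cfin) -Dsplit.
  rewrite -[X in mu X <= _](setUIDK (D m) C) setUC.
  apply: (@le_trans _ _ (mu (D m `\` C) + mu (D m `&` C))).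
    by apply: measureU2; [exact: measurableD|exact: measurableI].
  rewrite leeD2l//; apply: le_measure; rewrite ?inE//; first exact: measurableI.
have [B hB] := choice piece.
have mB : measurable (\bigcup_m B m) by apply: bigcupT_measurable => m; case: (hB m).
have BA : \bigcup_m B m `<=` A by move=> x [m _]; have [_ + _] := hB m; exact.
exists (\bigcup_m B m); split => //; apply/eqP; rewrite eq_le; apply/andP; split.
  by rewrite (E _ mB); exact: le_mu_ext.
have mAD (m : nat) : measurable (A `&` D m : set cT).
  by apply: measurableI => //; apply: measurable_completed; case: (Doo m).
have AE : \bigcup_m (A `&` D m) = A by rewrite -setI_bigcupr -TD setIT.
have cv : nu (A `&` D m) @[m --> \oo] --> nu A.
  rewrite -[in X in _ --> X]AE; apply: nondecreasing_cvg_mu => //.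
    by rewrite AE.
  by move=> i j ij; apply/subsetPset; apply: setIS; apply/subsetPset; exact: ndD.
rewrite -(cvg_lim _ cv)//; apply: lime_le; first by apply/cvg_ex; exists (nu A).
apply: nearW => m; have [mBm _ h] := hB m; apply: le_trans h _.
by apply: le_measure; rewrite ?inE//; exact: bigcup_sup.
Qed.

Import HBNNSimple.

(** A simple function for the completed sigma-algebra becomes Borel, with the same integral, when
    each level set is replaced by a measurable kernel. So the integral of [g] is bounded once all
    its Borel minorants are. *)
Lemma integral_completed_le (g : T -> \bar R) (c : \bar R) : (forall x, 0 <= g x) ->
  (forall h : T -> \bar R, measurable_fun setT h -> (forall x, 0 <= h x <= g x) ->
     \int[mu]_x h x <= c) ->
  \int[nu]_x g x <= c.
Proof.
move=> g0 hc; rewrite ge0_integralTE//; apply: ge_ereal_sup => _ [h hg <-].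
have [B hB] := choice (fun y : R => completed_kernel (@measurable_sfunP _ _ _ _ h _ (measurable_set1 y))).
(* The kernels are chosen for every real [y]; [w] makes all coefficients nonnegative and leaves the
   values of [h] unchanged. *)
pose w (y : R) := Num.max y 0%R.
have w0 y : (0 <= w y)%R by rewrite le_max lexx orbT.
have wE y : range h y -> w y = y by move=> [x _ <-]; apply/max_idPl; exact: fun_ge0.
pose k (x : T) : \bar R := \sum_(y \in range h) (w y * \1_(B y) x)%:E.
have fh : finite_set (range h) by exact: fimfunP.
have mB y : measurable (B y) by case: (hB y).
have mk1 y : measurable_fun setT (fun x => (w y * \1_(B y) x)%:E).
  by apply/measurable_EFinP; apply: measurable_funM => //; exact: measurable_indic.
have k1_ge0 y x : 0 <= (w y * \1_(B y) x)%:E by rewrite lee_fin mulr_ge0.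
have mk : measurable_fun setT k by apply: emeasurable_fsum => // y; exact: mk1.
have kh x : 0 <= k x <= g x.
  apply/andP; split; first by apply: fsume_ge0 => y _; exact: k1_ge0.
  apply: le_trans (hg x); rewrite fimfunE -fsumEFin//.
  apply: lee_fsum => // y yr; rewrite lee_fin wE//; apply: ler_wpM2l.
    by rewrite -(wE _ yr).
  rewrite !indicE; case: (boolP (x \in B y)) => [/set_mem Bx|_]; last by rewrite ler0n.
  by rewrite mem_set//; have [_ + _] := hB y; exact.
apply: le_trans (hc k mk kh).
rewrite le_eqVlt; apply/orP; left; apply/eqP.
rewrite sintegralE /k ge0_integral_fsum//.
apply: eq_fsbigr => y /set_mem yr.
under eq_integral do rewrite EFinM.
rewrite ge0_integralZl_EFin//; last exact/measurable_EFinP.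
by rewrite integral_indic// setIT wE//; have [_ _ ->] := hB y.
Qed.

End completion_sigma_finite.

(** * Lower semicontinuous regularization *)

Section open_rV.
Context (R : realType) (n : nat).

Lemma ball_rV (x y : 'rV[R]_n) (e : R) :
  0 < e -> ball x e y <-> forall i, `|x ord0 i - y ord0 i| < e.
Proof.
by move=> e0; split=> [[_ h] i|h]; [exact: (h ord0 i)|split=> // i j; rewrite ord1; exact: h].
Qed.

Lemma openP_rV (U : set 'rV[R]_n) :
  open U <-> forall x, U x -> exists2 e, 0 < e & ball x e `<=` U.
Proof.
rewrite openE; split => UE x /UE.
  by move=> /nbhs_ballP[e e0 h]; exists e.
by move=> [e e0 h]; apply/nbhs_ballP; exists e.
Qed.

Lemma measurable_ball_rV (x : 'rV[R]_n) (e : R) : 0 < e -> measurable (ball x e).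
Proof.
move=> e0.
rewrite (_ : ball x e = \bigcap_(i in [set: 'I_n])
    (coord_rV i @^-1` (ball (x ord0 i) e : set (measurableTypeR R)))).
  apply: fin_bigcap_measurable => [|i _]; first exact: finite_finset.
  apply: measurable_preimageT; first exact: measurable_coord_rV.
  exact: measurable_ball.
by apply/seteqP; split => y; rewrite ball_rV// => h i; [move=> _; exact: h|exact: (h i Logic.I)].
Qed.

(** An open set is the union of the balls inside it with rational centers and radii [1/(m+1)], which
    [unpickle] enumerates. *)
Lemma open_measurable_rV (U : set 'rV[R]_n) : open U -> measurable U.
Proof.
move=> /openP_rV oU.
pose c (q : 'rV[rat]_n) : 'rV[R]_n := map_mx ratr q.
pose F (k : nat) : set 'rV[R]_n :=
  if unpickle k is Some (q, m) then
    if `[< ball (c q) (m.+1%:R^-1) `<=` U >] then ball (c q) (m.+1%:R^-1) else set0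
  else set0.
have -> : U = \bigcup_k F k.
  apply/seteqP; split => [x Ux|x [k _]]; last first.
    rewrite /F; case: unpickle => [[q m]|//]; case: asboolP => // h; exact: h.
  have [e e0 eU] := oU _ Ux.
  have [m me] : exists m : nat, m.+1%:R^-1 < e / 2.
    exists (Num.trunc (e / 2)^-1); rewrite invf_plt ?posrE ?divr_gt0//; exact: truncnS_gt.
  have m0 : 0 < m.+1%:R^-1 :> R by rewrite invr_gt0.
  have [q hq] : exists q : 'rV[rat]_n, forall i, `|c q ord0 i - x ord0 i| < m.+1%:R^-1.
    have /choice[g hg] : forall i, exists q : rat, `|ratr q - x ord0 i| < m.+1%:R^-1.
      move=> i; have [q] : exists q : rat, ratr q \in `]x ord0 i - m.+1%:R^-1, x ord0 i + m.+1%:R^-1[.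
        by apply: rat_in_itvoo; rewrite ltrD2l (lt_trans _ m0)// oppr_lt0.
      rewrite in_itv/= => /andP[h1 h2]; exists q.
      by rewrite ltr_norml ltrBrDr ltrBlDr [- _ + _]addrC h1 [_ + x _ _]addrC h2.
    by exists (\row_i g i) => i; rewrite !mxE.
  exists (pickle (q, m)) => //; rewrite /F pickleK; case: asboolP => [_|].
    exact/ball_rV.
  case=> y /(ball_rV _ _ m0) hy; apply: eU; apply/ball_rV => // i.
  rewrite -(subrK (c q ord0 i) (x ord0 i)) -addrA (le_lt_trans (ler_normD _ _))//.
  rewrite (splitr e) ltrD// ?(lt_trans (hy i))//.
  by rewrite distrC (lt_trans (hq i)).
apply: bigcupT_measurable => k; rewrite /F; case: unpickle => [[q m]|//].
by case: ifP => // _; apply: measurable_ball_rV; rewrite invr_gt0.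
Qed.

End open_rV.

Definition pl_concave (R : realType) (n : nat) (g : 'rV[R]_n -> \bar R) : Prop :=
  forall l x y, 0 < l < 1 -> pl l (g x) (g y) (g ((1 - l) *: x + l *: y)).

Definition lower_semicontinuous_rV (R : realType) (n : nat) (g : 'rV[R]_n -> \bar R) :=
  forall s : R, open [set x | (s%:E < g x)%E].

Lemma pl_le (R : realType) (l : R) (a b c a' b' c' : \bar R) :
  (a' <= a)%E -> (b' <= b)%E -> (c <= c')%E -> pl l a b c -> pl l a' b' c'.
Proof.
move=> aa bb cc h s t s0 t0 sa tb; apply: le_trans cc.
by apply: h => //; [exact: lt_le_trans aa|exact: lt_le_trans bb].
Qed.

Lemma ler_powR2 (R : realType) (l a b c d : R) : 0 <= l -> 0 <= 1 - l -> 0 <= a -> 0 <= b ->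
  a <= c -> b <= d -> a `^ (1 - l) * b `^ l <= c `^ (1 - l) * d `^ l.
Proof.
move=> l0 l1 a0 b0 ac bd; apply: ler_pM; rewrite ?powR_ge0//.
  by apply: ge0_ler_powR; rewrite ?nnegrE// (le_trans a0).
by apply: ge0_ler_powR; rewrite ?nnegrE// (le_trans b0).
Qed.

Section cone_regularization.
Context (R : realType) (n : nat) (f : 'rV[R]_n -> R) (c : 'rV[R]_n) (r m : R).
Context (f0 : forall x, 0 <= f x) (fl : log_concave f).
Context (r0 : 0 < r) (m0 : 0 < m) (mf : forall z, ball c r z -> m <= f z).

(** [u] is the lower bound for [f x] that log-concavity gives on the segment from [y] to [z], with
    [f z] lowered to [m]. As [e > 0] and the ball is open, [z] has room to move. *)
Definition cone_witness (x : 'rV[R]_n) (u : R) : Prop :=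
  exists e y z, [/\ 0 < e < 1, ball c r z, x = (1 - e) *: y + e *: z &
    u = f y `^ (1 - e) * m `^ e].

(* A lower semicontinuous log-concave minorant of [f], obtained by mixing the values
   of [f] with its lower bound [m] on a ball.  By [cone_reg_mix] it loses nothing in
   the integral, whereas [f] itself need not be Borel measurable. *)
Definition cone_reg (x : 'rV[R]_n) : \bar R :=
  ereal_sup [set u%:E | u in [set u | u = 0 \/ cone_witness x u]].

Lemma cone_reg_ge0 x : (0 <= cone_reg x)%E.
Proof. by apply: ereal_sup_ubound; exists 0 => //; left. Qed.

Lemma cone_reg_le x : (cone_reg x <= (f x)%:E)%E.
Proof.
apply: ge_ereal_sup => _ [u [->|[e [y [z [/andP[e0 e1] cz -> ->]]]]] <-]; rewrite lee_fin//.
have e01 : 0 <= e <= 1 by rewrite !ltW.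
apply: le_trans (fl y z e01).
by apply: ler_powR2; rewrite ?subr_ge0 ?(ltW e0) ?(ltW e1) ?(ltW m0) ?mf.
Qed.

Lemma cone_reg_gtP (s : R) x : 0 <= s -> (s%:E < cone_reg x)%E ->
  exists2 u, s < u & cone_witness x u.
Proof.
move=> s0 /ereal_sup_gt[_ [u [->|wu] <-]]; rewrite lte_fin; first by rewrite ltNge s0.
by exists u.
Qed.

(** A displacement of [x] is absorbed by [z], moved by [e^-1] times as much, while [y], [e] and
    hence [u] stay the same. *)
Lemma cone_reg_lsc : lower_semicontinuous_rV cone_reg.
Proof.
move=> s; have [s0|s0] := ltP s 0.
  rewrite (_ : [set x | _] = setT); first exact: openT.
  by apply/seteqP; split => x //= _; rewrite (lt_le_trans _ (cone_reg_ge0 x)) ?lte_fin.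
apply/openP_rV => x /= /(cone_reg_gtP s0)[u su [e [y [z [e01 cz xE uE]]]]].
have /andP[e0 e1] := e01.
have [d d0 dz] : exists2 d, 0 < d & ball z d `<=` ball c r.
  by apply: (iffLR (openP_rV _)) cz => //; exact: ball_open.
exists (e * d); first exact: mulr_gt0.
move=> x' /ball_rV xx'; have {}xx' := xx' (mulr_gt0 e0 d0).
apply: (@lt_le_trans _ _ u%:E); first by rewrite lte_fin.
apply: ereal_sup_ubound; exists u => //; right; exists e, y, (z + e^-1 *: (x' - x)); split => //.
  apply: dz; apply/ball_rV => // i; rewrite !mxE opprD addrA subrr sub0r normrN normrM.
  rewrite gtr0_norm ?invr_gt0// mulrC ltr_pdivrMr// mulrC distrC; exact: xx'.
rewrite scalerDr scalerA mulfV ?gt_eqF// scale1r addrA -xE.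
by rewrite addrC subrK.
Qed.

(** Mixing an arbitrary point [x] with a witness over [y] gives a witness with the same [z], and
    log-concavity bounds [f] at its new base point [y'']. *)
Lemma cone_reg_mix l x y : 0 < l < 1 ->
  pl l (f x)%:E (cone_reg y) (cone_reg ((1 - l) *: x + l *: y)).
Proof.
move=> /andP[l0 l1] s t s0 t0; rewrite lte_fin => sx /(cone_reg_gtP (ltW t0))[u tu].
move=> [e [y' [z [/andP[e0 e1] cz yE uE]]]].
have le0 : 0 < l * e by rewrite mulr_gt0.
have le1 : l * e < 1 by rewrite mulr_ilt1// ltW.
have le1' : 0 < 1 - l * e by rewrite subr_gt0.
(* Forced by regrouping [(1 - l) x + l ((1 - e) y' + e z)] as [(1 - l e) y'' + l e z] with
   [y'' = (1 - k) x + k y']. *)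
pose k := l * (1 - e) / (1 - l * e).
have k1E : 1 - k = (1 - l) / (1 - l * e) by rewrite /k; field; rewrite gt_eqF.
have k01 : 0 <= k <= 1.
  rewrite divr_ge0 ?mulr_ge0 ?subr_ge0 ?(ltW l0) ?(ltW e1) ?(ltW le1)//=.
  by rewrite -subr_ge0 k1E divr_ge0 ?subr_ge0 ?(ltW l1) ?(ltW le1).
pose y'' := (1 - k) *: x + k *: y'.
apply: (@le_trans _ _ (f y'' `^ (1 - l * e) * m `^ (l * e))%:E); last first.
  apply: ereal_sup_ubound; exists (f y'' `^ (1 - l * e) * m `^ (l * e)) => //; right.
  exists (l * e), y'', z; split => //; first by rewrite le0.
  rewrite yE !scalerDr !scalerA addrA; congr (_ + _ + _).
    by rewrite k1E mulrCA mulfV ?mulr1 ?gt_eqF.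
  by rewrite /k mulrCA mulfV ?mulr1 ?gt_eqF.
rewrite lee_fin.
apply: (@le_trans _ _ ((f x `^ (1 - k) * f y' `^ k) `^ (1 - l * e) * m `^ (l * e))); last first.
  apply: ler_wpM2r; first exact: powR_ge0.
  apply: ge0_ler_powR; rewrite ?nnegrE ?(ltW le1')// ?mulr_ge0 ?powR_ge0//.
  exact: fl.
rewrite powRM ?powR_ge0// -!powRrM k1E.
have -> : (1 - l) / (1 - l * e) * (1 - l * e) = 1 - l by field; rewrite gt_eqF.
have -> : k * (1 - l * e) = (1 - e) * l by rewrite /k; field; rewrite gt_eqF.
rewrite (mulrC l e) !powRrM -mulrA -powRM ?powR_ge0//.
rewrite -uE; apply: ler_powR2; rewrite ?subr_ge0 ?(ltW l0) ?(ltW l1) ?(ltW s0) ?(ltW t0) ?(ltW sx)//.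
exact: ltW.
Qed.

Lemma cone_reg_concave : pl_concave cone_reg.
Proof.
move=> l x y l01.
exact: (pl_le (cone_reg_le x) (le_refl _) (le_refl _) (@cone_reg_mix l x y l01)).
Qed.

Lemma cone_reg_gt0 : (0 < cone_reg c)%E.
Proof.
apply: (@lt_le_trans _ _ (f c `^ (1 - 2^-1) * m `^ (2^-1))%:E).
  by rewrite lte_fin mulr_gt0// powR_gt0// (lt_le_trans m0)// mf//; exact: ballxx.
apply: ereal_sup_ubound; eexists; last reflexivity; right; exists 2^-1, c, c; split => //.
- by apply/andP; split; lra.
- exact: ballxx.
- by rewrite -scalerDl subrK scale1r.
Qed.

End cone_regularization.

Section truncation.
Context (R : realType) (n : nat) (g : 'rV[R]_n -> \bar R).
Context (g0 : forall x, (0 <= g x)%E) (gl : pl_concave g) (gc : lower_semicontinuous_rV g).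

(** One parameter caps the values and restricts the support to a ball of the sup norm; the ball is
    open and convex, so lower semicontinuity and log-concavity persist. *)
Definition trunc (J : R) (x : 'rV[R]_n) : \bar R :=
  if `[< ball 0 J x >] then mine (g x) J%:E else 0%E.

Lemma trunc_ge0 J x : 0 <= J -> (0 <= trunc J x)%E.
Proof. by move=> J0; rewrite /trunc; case: asboolP => // _; rewrite le_min g0 lee_fin. Qed.

Lemma trunc_gt J x (s : R) : 0 <= s ->
  (s%:E < trunc J x)%E <-> [/\ ball 0 J x, (s%:E < g x)%E & s < J].
Proof.
move=> s0; rewrite /trunc; case: asboolP => [b|nb].
  by rewrite lt_min lte_fin; split => [/andP[]|[_ -> ->]].
by rewrite lte_fin ltNge s0; split => // -[].
Qed.

Lemma trunc_lsc J : 0 <= J -> lower_semicontinuous_rV (trunc J).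
Proof.
move=> J0 s; have [s0|s0] := ltP s 0.
  rewrite (_ : [set x | _] = setT); first exact: openT.
  by apply/seteqP; split => x //= _; rewrite (lt_le_trans _ (trunc_ge0 x J0)) ?lte_fin.
have [sJ|Js] := ltP s J; last first.
  rewrite (_ : [set x | _] = set0); first exact: open0.
  by rewrite -subset0 => x /= /(iffLR (trunc_gt _ _ s0))[_ _]; rewrite ltNge Js.
rewrite (_ : [set x | _] = ball 0 J `&` [set x | (s%:E < g x)%E]).
  by apply: openI; [exact: ball_open|exact: gc].
by apply/seteqP; split => x /=; rewrite trunc_gt// => -[].
Qed.

Lemma trunc_concave J : 0 < J -> pl_concave (trunc J).
Proof.
move=> J0 l x y l01 s t s0 t0 /(iffLR (trunc_gt _ _ (ltW s0)))[bx sx sJ].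
move=> /(iffLR (trunc_gt _ _ (ltW t0)))[b_y ty tJ].
have /andP[l0 l1] := l01.
rewrite /trunc asboolT; last first.
  apply/ball_rV => // i; rewrite !mxE.
  have := (iffLR (ball_rV _ _ J0) bx) i; have := (iffLR (ball_rV _ _ J0) b_y) i.
  rewrite !mxE !sub0r !normrN => yJ xJ; rewrite (le_lt_trans (ler_normD _ _))//.
  have l1' : 0 < 1 - l by rewrite subr_gt0.
  rewrite !normrM (gtr0_norm l1') (gtr0_norm l0).
  have -> : J = (1 - l) * J + l * J by ring.
  by apply: ltrD; rewrite ltr_pM2l.
rewrite le_min; apply/andP; split; first exact: gl.
rewrite lee_fin; apply: le_trans (amgm l01 s0 t0) _.
have -> : J = (1 - l) * J + l * J by ring.
by apply: lerD; apply: ler_wpM2l; rewrite ?subr_ge0 ?(ltW l0) ?(ltW l1) ?(ltW sJ) ?(ltW tJ).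
Qed.

Lemma trunc_le J x : 0 <= J -> (trunc J x <= g x)%E.
Proof. by move=> J0; rewrite /trunc; case: asboolP => // _; rewrite ge_min lexx. Qed.

Lemma trunc_leJ J x : 0 <= J -> (trunc J x <= J%:E)%E.
Proof. by move=> J0; rewrite /trunc; case: asboolP => // _; rewrite ?lee_fin// ge_min lexx orbT. Qed.

Lemma trunc_nd (i j : nat) x : (i <= j)%N -> (trunc i%:R x <= trunc j%:R x)%E.
Proof.
move=> ij; have ijR : (i%:R : R) <= j%:R by rewrite ler_nat.
rewrite {1}/trunc; case: asboolP => [b|_]; last exact: trunc_ge0.
rewrite /trunc asboolT; last exact: le_ball b.
by rewrite le_min !ge_min lexx/= lee_fin ijR orbT.
Qed.

Lemma trunc_gt_near (s : R) x : 0 <= s -> (s%:E < g x)%E ->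
  exists j : nat, (s%:E < trunc j%:R x)%E.
Proof.
move=> s0 sx.
pose M := s + \sum_i `|x ord0 i| + 1.
have sum0 : 0 <= \sum_i `|x ord0 i| by apply: sumr_ge0.
have M0 : 0 < M by rewrite /M; lra.
exists (Num.trunc M).+1; have MJ := truncnS_gt M.
apply/trunc_gt => //; split => //; last by apply: le_lt_trans MJ; rewrite /M; lra.
apply/ball_rV => [|i]; first exact: lt_trans MJ.
rewrite mxE sub0r normrN (le_lt_trans _ MJ)//.
apply: (@le_trans _ _ (\sum_i `|x ord0 i|)); last by rewrite /M; lra.
by rewrite (bigD1 i)//= lerDl sumr_ge0.
Qed.

End truncation.

(** * Log-concave functions whose support has empty interior *)

Section hyperplane.
Context (R : realType) (n : nat).
Local Notation lebn := (borel_lebesgue_rV R n).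

Lemma measurable_dotv (v : 'rV[R]_n) : measurable_fun setT (fun x : 'rV[R]_n => dotv x v).
Proof.
rewrite (_ : (fun _ => _) = fun x => \sum_i coord_rV i x * v ord0 i); last first.
  by apply/funext => x; rewrite dotvE.
by apply: measurable_sum => j; apply: measurable_funM => //; exact: measurable_coord_rV.
Qed.

Lemma dotvDl (u v w : 'rV[R]_n) : dotv (u + v) w = dotv u w + dotv v w.
Proof. by rewrite /dotv mulmxDl mxE. Qed.

Lemma dotvZl (a : R) (u w : 'rV[R]_n) : dotv (a *: u) w = a * dotv u w.
Proof. by rewrite /dotv -scalemxAl mxE. Qed.

(* The translates [H + t v] are disjoint and have the same measure as [H]. *)
Lemma hyperplane_null (v : 'rV[R]_n) (a : R) : dotv v v != 0 ->
  lebn [set x | dotv x v = a] = 0%E.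
Proof.
move=> v0; pose H := [set x : 'rV[R]_n | dotv x v = a].
have mH : measurable H.
  rewrite (_ : H = (fun x => dotv x v) @^-1` [set a])//.
  by apply: measurable_preimageT => //; exact: measurable_dotv.
pose S : set (measurableTypeR R * 'rV[R]_n) := [set p | dotv (p.2 + (p.1 : R) *: v) v = a].
have mS : measurable S.
  rewrite (_ : S = (fun p => dotv p.2 v + (p.1 : R) * dotv v v) @^-1` [set a]); last first.
    by apply/seteqP; split => p; rewrite /S/preimage/= dotvDl dotvZl.
  apply: measurable_preimageT => //; apply: measurable_funD.
    exact: (measurableT_comp (measurable_dotv v) measurable_snd).
  by apply: measurable_funM => //; exact: measurable_fst.
pose g (p : measurableTypeR R * 'rV[R]_n) : \bar R := (\1_S p)%:E.
have mg : measurable_fun setT g by exact/measurable_EFinP.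
have g0 p : (0 <= g p)%E by rewrite lee_fin.
have := @fubini_tonelli _ _ _ _ _ (@lebesgue_measure R) lebn g mg g0.
under eq_integral => t _.
  rewrite /g (_ : (fun y => _) = (fun y => (\1_((fun x => x + (t : R) *: v) @^-1` H) y)%:E)).
    over.
  by apply/funext => y; rewrite !indicE.
have E t : (\int[lebn]_y (\1_((fun x => (x + t *: v)%R) @^-1` H) y)%:E = lebn H)%E.
  rewrite integral_indic//; last exact: (measurable_preimageT (measurable_rV_addr _) mH).
  by rewrite setIT; exact: lebesgue_rV_translation.
under eq_integral do rewrite E.
rewrite integral_cst//= [X in (_ * X)%E](_ : _ = +oo%E); last first.
  by rewrite -set_itvNyy lebesgue_measure_itv.
rewrite [RHS]integral0_eq => [|y _]; last first.
  rewrite /g (_ : (fun x => _) = (fun x => (\1_[set t : measurableTypeR R | S (t, y)] x)%:E)).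
    rewrite integral_indic//; last exact: (measurable_preimageT (pair2_measurable y) mS).
    rewrite setIT; apply/eqP; rewrite eq_le measure_ge0 andbT.
    rewrite -(lebesgue_measure_set1 ((a - dotv y v) / dotv v v)).
    apply: le_measure; rewrite ?inE//.
      exact: (measurable_preimageT (pair2_measurable y) mS).
    move=> t; rewrite /S /= dotvDl dotvZl => <-.
    by rewrite addrAC subrr add0r mulfK.
  by apply/funext => t; rewrite !indicE.
by move/eqP; rewrite mule_eq0 => /orP[/eqP|].
Qed.

End hyperplane.

Section interior.
Context (R : realType) (n : nat).

(** The weight missing from 1 sits at [x0]. The last point is split off and the other weights are
    divided by [1 - c k]. *)
Lemma convex_combination_mem (C : set 'rV[R]_n) (x0 : 'rV[R]_n) (d : nat -> 'rV[R]_n)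
    (c : nat -> R) (k : nat) :
  (forall x y l, C x -> C y -> 0 <= l <= 1 -> C ((1 - l) *: x + l *: y)) ->
  C x0 -> (forall i, (i < k)%N -> C (x0 + d i)) -> (forall i, (i < k)%N -> 0 <= c i) ->
  \sum_(0 <= i < k) c i < 1 ->
  C (x0 + \sum_(0 <= i < k) c i *: d i).
Proof.
move=> cvxC Cx0; elim: k c => [|k IH] c Cd c0 c1; first by rewrite big_geq// addr0.
have ck0 : 0 <= c k by exact: c0.
have sk0 : 0 <= \sum_(0 <= i < k) c i.
  by rewrite big_nat sumr_ge0// => i /andP[_ ik]; apply: c0; exact: ltnW.
move: c1; rewrite !big_nat_recr//= => c1.
have ck1 : 0 < 1 - c k by rewrite subr_gt0 (le_lt_trans _ c1)// lerDr.
have -> : x0 + (\sum_(0 <= i < k) c i *: d i + c k *: d k) =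
   (1 - c k) *: (x0 + \sum_(0 <= i < k) (c i / (1 - c k)) *: d i) + c k *: (x0 + d k).
  rewrite scalerDr scaler_sumr scalerDr.
  under [in RHS]eq_bigr do rewrite scalerA mulrCA mulfV ?gt_eqF// mulr1.
  by rewrite scalerBl scale1r [RHS]addrACA subrK.
apply: cvxC; last by rewrite ck0 -subr_ge0 ltW.
  apply: IH => [i ik|i ik|].
  - by apply: Cd; exact: ltnW.
  - by rewrite divr_ge0 ?(ltW ck1)//; apply: c0; exact: ltnW.
  - by rewrite -mulr_suml ltr_pdivrMr// mul1r ltrBrDr.
exact: Cd.
Qed.

(** In the coordinates [z = x0 + u X] the simplex is [u >= 0], [sum u <= 1], and the center has all
    coordinates [a = 1/(n+1)]. As [M] exceeds the column sums of [|X^-1|], the radius [a^2 / M]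
    moves each coordinate by less than [a^2 <= a]: all stay positive, and for [n > 0] their sum
    stays below [n (a + a^2) = 1 - a^2]. *)
Lemma simplex_ball (C : set 'rV[R]_n) (x0 : 'rV[R]_n) (X : 'M[R]_n) :
  (forall x y l, C x -> C y -> 0 <= l <= 1 -> C ((1 - l) *: x + l *: y)) ->
  C x0 -> (forall i, C (x0 + row i X)) -> X \in unitmx ->
  exists c r, 0 < r /\ ball c r `<=` C.
Proof.
move=> cvxC Cx0 CX uX.
pose a : R := n.+1%:R^-1.
have a0 : 0 < a by rewrite invr_gt0.
pose b : 'rV[R]_n := const_mx a.
pose M := 1 + \sum_i \sum_j `|invmx X i j|.
have M0 : 0 < M.
  by rewrite ltr_pwDl// sumr_ge0// => i _; rewrite sumr_ge0.
pose r := a ^+ 2 / M.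
have r0 : 0 < r by rewrite divr_gt0// exprn_gt0.
exists (x0 + b *m X), r; split => // z /(ball_rV _ _ r0) hz.
pose u := (z - x0) *m invmx X.
have zE : z = x0 + u *m X by rewrite mulmxKV// addrC subrK.
have ub j : `|u ord0 j - a| < a ^+ 2.
  have -> : u ord0 j - a = ((z - (x0 + b *m X)) *m invmx X) ord0 j.
    rewrite opprD addrA mulmxBl mulmxK// [RHS]mxE; congr (_ + _).
    by rewrite [RHS]mxE [in RHS]mxE.
  rewrite mxE (le_lt_trans (ler_norm_sum _ _ _))//.
  apply: (@le_lt_trans _ _ (\sum_i r * `|invmx X i j|)).
    apply: ler_sum => i _; rewrite normrM ler_wpM2r// ltW//.
    by have := hz i; rewrite distrC !mxE.
  rewrite -mulr_sumr /r -mulrA gtr_pMr ?exprn_gt0// mulrC ltr_pdivrMr// mul1r /M.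
  rewrite ltr_pwDl// ler_sum// => i _.
  by rewrite [leRHS](bigD1 j)//= lerDl sumr_ge0.
have a1 : a <= 1 by rewrite invf_le1// ler1n.
have aa : a ^+ 2 <= a by rewrite expr2 ler_piMl// ltW.
have u0 j : 0 < u ord0 j.
  by have := ub j; rewrite ltr_norml => /andP[+ _]; lra.
have su : \sum_j u ord0 j < 1.
  have [n0|n0] := posnP n.
    rewrite big1 ?ltr01// => i; exfalso; have := ltn_ord i; by rewrite [X in (_ < X)%N]n0.
  apply: (@lt_le_trans _ _ (\sum_(j < n) (a + a ^+ 2))).
    apply: ltr_sum => [|j _]; last by have := ub j; rewrite ltr_norml => /andP[_]; lra.
    by apply/hasP; exists (Ordinal n0) => //; rewrite mem_index_enum.
  rewrite sumr_const card_ord -mulr_natr.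
  have na : n%:R * a = 1 - a.
    rewrite /a -natr1; field; by rewrite natr1 pnatr_eq0.
  have -> : (a + a ^+ 2) * n%:R = (n%:R * a) * (1 + a) by ring.
  rewrite na; have -> : (1 - a) * (1 + a) = 1 - a ^+ 2 by ring.
  by rewrite lerBlDr lerDl exprn_ge0// ltW.
pose d (k : nat) := if insub k is Some i then row (i : 'I_n) X else 0.
pose e (k : nat) := if insub k is Some i then u ord0 (i : 'I_n) else 0.
have dE (i : 'I_n) : d i = row i X by rewrite /d valK.
have eE (i : 'I_n) : e i = u ord0 i by rewrite /e valK.
have -> : z = x0 + \sum_(0 <= i < n) e i *: d i.
  rewrite {1}zE mulmx_sum_row big_mkord; congr (_ + _).
  by apply: eq_bigr => i _; rewrite dE eE.
apply: convex_combination_mem => //.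
- by move=> i ni; rewrite -[i]/(val (Ordinal ni)) dE.
- by move=> i ni; rewrite -[i]/(val (Ordinal ni)) eE ltW.
- by rewrite big_mkord; under eq_bigr do rewrite eE.
Qed.

(** Take the largest number [k] of linearly independent displacements from a point [x0] with
    [f x0 > 0] that keep [f] positive. If [k = n], log-concavity bounds [f] on a simplex by its
    least vertex value. If [k < n], maximality confines the support to a hyperplane. *)
Lemma log_concave_interior (f : 'rV[R]_n -> R) :
  (forall x, 0 <= f x) -> log_concave f ->
  (exists c r m, [/\ 0 < r, 0 < m & forall z, ball c r z -> m <= f z]) \/
  (\int[lebesgue_rV R n]_x (f x)%:E = 0)%E.
Proof.
move=> f0 fl.
have [[x0 fx0]|fN] := pselect (exists x0, 0 < f x0); last first.
  right; apply: integral0_eq => x _; congr EFin; apply/eqP; rewrite eq_le f0 andbT leNgt.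
  by apply/negP => fx; apply: fN; exists x.
pose P k := `[< exists X : 'M[R]_(k, n), row_free X /\ forall i, 0 < f (x0 + row i X) >].
have P0 : P 0%N.
  by apply/asboolP; exists 0; split => [|[]//]; rewrite /row_free mxrank0.
have Pn k : P k -> (k <= n)%N.
  by move=> /asboolP[X [/eqP rX _]]; have := rank_leq_col X; rewrite rX.
have exP : exists k, P k by exists 0%N.
pose k := ex_maxn exP Pn.
have [Pk maxk] : P k /\ forall j, P j -> (j <= k)%N.
  by rewrite /k; case: ex_maxnP.
have [kn|kn] := eqVneq k n.
  left; have /asboolP[X [fX fxX]] : P n by rewrite -kn.
  pose m := \big[Num.min/f x0]_i f (x0 + row i X).
  have m0 : 0 < m by rewrite /m; elim/big_ind : _ => // a b a0 b0; rewrite lt_min a0.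
  have mx0 : m <= f x0 by exact: bigmin_le_id.
  have [c [r [r0 cr]]] : exists c r, 0 < r /\ ball c r `<=` [set x | m <= f x].
    apply: (@simplex_ball _ x0 X) => //.
    - move=> x y l /= mx my l01; have /andP[l0 l1] := l01; apply: le_trans (fl x y l l01).
      have -> : m = m `^ (1 - l) * m `^ l.
        by rewrite -powRD ?subrK ?powRr1 ?oner_eq0// ltW.
      by apply: ler_powR2; rewrite ?subr_ge0 ?(ltW m0).
    - by move=> i; exact: bigmin_le_cond.
    - by rewrite -row_free_unit.
  by exists c, r, m; split.
right; have kn' : (k < n)%N by rewrite ltn_neqAle kn Pn.
have /asboolP[X [fX fxX]] := Pk.
have [v v0 Xv] : exists2 v : 'rV[R]_n, v != 0 & X *m v^T = 0.
  have : kermx X^T != 0.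
    by rewrite kermx_eq0 /row_free mxrank_tr (eqP fX) neq_ltn kn'.
  move=> /rowV0Pn[v /sub_kermxP vX v0]; exists v => //.
  by apply: trmx_inj; rewrite trmx_mul trmxK vX trmx0.
have vv : dotv v v != 0.
  rewrite dotvE psumr_eq0 => [|i _]; last by rewrite -expr2 sqr_ge0.
  apply: contra v0 => /allP h; apply/eqP/rowP => i; rewrite mxE; apply/eqP.
  by have := h i; rewrite mem_index_enum mulf_eq0 orbb => /(_ isT).
have fH x : 0 < f x -> dotv x v = dotv x0 v.
  move=> fx; apply/eqP; rewrite -subr_eq0 -mulN1r -dotvZl -dotvDl scaleN1r.
  have [xX|xX] := boolP (x - x0 <= X)%MS.
    by have /submxP[D ->] := xX; rewrite /dotv -mulmxA Xv mulmx0 mxE.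
  (* Otherwise the displacement [x - x0] would extend [X] to [k + 1] independent rows. *)
  exfalso; have : P k.+1.
    pose Y : 'M[R]_(1 + k, n) := col_mx (x - x0) X.
    have fY (i : 'I_(1 + k)) : 0 < f (x0 + row i Y).
      case: (split_ordP i) => j ->; rewrite ?rowKu ?rowKd//.
      by rewrite row_id addrC subrK.
    apply/asboolP; exists Y; split; last exact: fY.
    rewrite /row_free -[\rank Y]/(\rank (col_mx (x - x0) X)) -addsmxE.
    have xr : \rank (x - x0) = 1%N.
      by rewrite rank_rV; apply/eqP; rewrite eqb1; apply: contra xX => /eqP ->; exact: sub0mx.
    rewrite eqn_leq (leq_trans (mxrank_adds_leqif _ _).1) ?(eqP fX) ?xr//=.
    have : (X < x - x0 + X)%MS.
      by rewrite ltmxE addsmxSr/= addsmx_sub negb_and xX.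
    by rewrite ltmxErank (eqP fX) => /andP[].
  by move=> /maxk; rewrite ltnn.
apply/eqP; rewrite eq_le integral_ge0 ?andbT => [|x _]; last by rewrite lee_fin.
(* The integral of [f] over the completed measure is bounded through its Borel minorants, which
   vanish off the null hyperplane. *)
apply: integral_completed_le => [|x|h mh hf].
- exact: sigma_finiteT.
- by rewrite lee_fin.
- have h0 x : (0 <= h x)%E by case/andP: (hf x).
  pose H := [set x : 'rV[R]_n | dotv x v = dotv x0 v].
  have mH : measurable H.
    rewrite (_ : H = (fun x => dotv x v) @^-1` [set dotv x0 v])//.
    by apply: measurable_preimageT => //; exact: measurable_dotv.
  rewrite (@ge0_negligible_integral _ _ _ _ setT H)//; last exact: hyperplane_null.
  rewrite setTD integral0_eq// => x Hx; apply/eqP; rewrite eq_le h0 andbT.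
  case/andP: (hf x) => _ hfx; apply: le_trans hfx _; rewrite lee_fin leNgt.
  by apply/negP => /fH.
Qed.

End interior.

(** A number [s] with [b < s < a] would give [s^(1-l) b^l > b]. Positivity of [b] is essential: at
    [b = 0] the hypothesis says nothing. *)
Lemma pl_absorb (R : realType) (l : R) (a b : \bar R) : 0 < l < 1 ->
  pl l a b b -> (0 < b)%E -> (a <= b)%E.
Proof.
move=> l01 h; case: b h => [b| |//] h; last by rewrite leey.
rewrite lte_fin => b0; rewrite leNgt; apply/negP => /lte_gap[s bs sa].
have s0 : 0 < s by exact: lt_trans b0 bs.
have : s `^ (1 - l) * b `^ l <= b.
  apply: pl_EFin; rewrite ?ltW//; apply: pl_le h => //; exact: ltW.
apply/negP; rewrite -ltNge.
have {1}-> : b = b `^ (1 - l) * b `^ l.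
  by rewrite -powRD ?subrK ?powRr1 ?oner_eq0// ltW.
rewrite ltr_pM2r ?powR_gt0//; have /andP[l0 l1] := l01.
by apply: gt0_ltr_powR; rewrite ?subr_gt0 ?nnegrE// ltW.
Qed.

(** Reduces a product of possibly infinite factors to numbers strictly below each of them, the form
    in which monotone convergence supplies them. *)
Lemma mule_le_lt (R : realType) (a b c : \bar R) : (0 <= a)%E -> (0 <= b)%E -> (0 <= c)%E ->
  (forall s t : R, 0 < s -> 0 < t -> (s%:E < a)%E -> (t%:E < b)%E -> ((s * t)%:E <= c)%E) ->
  (a * b <= c)%E.
Proof.
move=> a0 b0 c0 h.
have [->|an0] := eqVneq a 0%E; first by rewrite mul0e.
have [->|bn0] := eqVneq b 0%E; first by rewrite mule0.
have {an0 a0} : (0 < a)%E by rewrite lt_def an0.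
have {bn0 b0} : (0 < b)%E by rewrite lt_def bn0.
case: c c0 h => [c| |//] c0 h b0 a0; last by rewrite leey.
rewrite lee_fin in c0.
have infty (x y : \bar R) : (0 < y)%E -> x = +oo%E ->
    (forall s t : R, 0 < s -> 0 < t -> (s%:E < x)%E -> (t%:E < y)%E -> ((s * t)%:E <= c%:E)%E) ->
    False.
  move=> y0 -> hxy; have [t t0 ty] := lte_gap y0.
  have := hxy ((c + 1) / t) t _ t0 (ltry _) ty.
  rewrite divfK ?gt_eqF// lee_fin divr_gt0// ?ltr_wpDl// => /(_ isT); lra.
have [aoo|afin] := eqVneq a +oo%E; first by have [] := infty a b b0 aoo h.
have [boo|bfin] := eqVneq b +oo%E.
  by have [] := infty b a a0 boo (fun s t s0 t0 sb ta => eq_rect _ (fun x => (x%:E <= c%:E)%E) (h t s t0 s0 ta sb) _ (mulrC t s)).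
case: a a0 afin h => [a| |]// a0 _; case: b b0 bfin => [b| |]// b0 _ h.
rewrite !lte_fin in a0 b0.
have ab0 : 0 < a * b by exact: mulr_gt0.
rewrite -EFinM lee_fin leNgt; apply/negP => cab.
pose x := c / (a * b).
have x1 : x < 1 by rewrite ltr_pdivrMr// mul1r.
have x0 : 0 <= x by rewrite divr_ge0// ltW.
(* This [r < 1] satisfies [r^2 = x + ((1 - x)/2)^2 > x], so [r a] and [r b] have a product above
   [c = x a b]. *)
pose r := (x + 1) / 2.
have r0 : 0 < r by rewrite /r; lra.
have r1 : r < 1 by rewrite /r; lra.
have := h (r * a) (r * b) (mulr_gt0 r0 a0) (mulr_gt0 r0 b0).
rewrite !lte_fin !gtr_pMl// r1 => /(_ isT isT); rewrite lee_fin; apply/negP; rewrite -ltNge.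
have -> : c = x * (a * b) by rewrite /x divfK// gt_eqF.
have -> : r * a * (r * b) = r ^+ 2 * (a * b) by ring.
rewrite ltr_pM2r//.
have -> : r ^+ 2 = x + ((1 - x) / 2) ^+ 2 by rewrite /r; field.
by rewrite ltrDl exprn_gt0// divr_gt0// subr_gt0.
Qed.

(** * Integrals of lower semicontinuous functions *)

Section lsc_integral.
Context (R : realType) (n : nat).
Local Notation lebn := (borel_lebesgue_rV R n).

Lemma lsc_measurable (g : 'rV[R]_n -> \bar R) :
  lower_semicontinuous_rV g -> measurable_fun setT g.
Proof.
move=> gc; apply: (measurability _ (ErealGenOInfty.measurableE R)).
move=> /= _ [_ [r ->]] <-; apply: measurableI => //.
by rewrite preimage_itvoy; apply: open_measurable_rV; exact: gc.
Qed.

Lemma open_measure_gt0 (U : set 'rV[R]_n) : open U -> U !=set0 -> (0 < lebn U)%E.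
Proof.
move=> oU [x Ux]; have [e e0 eU] := (iffLR (openP_rV _) oU) x Ux.
pose S := (fun v => v - x) @^-1` cube (e / 2).
have mS : measurable S.
  by apply: measurable_preimageT; [exact: measurable_rV_addr|exact: measurable_cube].
apply: (@lt_le_trans _ _ (lebn S)).
  rewrite lebesgue_rV_translation; last exact: measurable_cube.
  rewrite lebesgue_cube ?divr_ge0 ?(ltW e0)// lte_fin exprn_gt0//.
  by rewrite mulrn_wgt0// divr_gt0.
apply: le_measure; rewrite ?inE//; first exact: open_measurable_rV.
move=> y Sy; apply: eU; apply/(ball_rV _ _ e0) => i.
have := Sy i; rewrite !mxE in_itv/= -ler_norml distrC => /le_lt_trans; apply.
by rewrite ltr_pdivrMr// ltr_pMr// ltr1n.
Qed.

Lemma lsc_integral_gt0 (g : 'rV[R]_n -> \bar R) (x : 'rV[R]_n) :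
  (forall x, 0 <= g x)%E -> lower_semicontinuous_rV g -> (0 < g x)%E ->
  (0 < \int[lebn]_y g y)%E.
Proof.
move=> g0 gc gx0; have [e e0 ex] := lte_gap gx0.
pose U := [set y | (e%:E < g y)%E].
have mU : measurable U by apply: open_measurable_rV; exact: gc.
apply: (@lt_le_trans _ _ (\int[lebn]_y (e%:E * (\1_U y)%:E))%E).
  rewrite ge0_integralZl_EFin// ?(ltW e0)//; last exact/measurable_EFinP.
  rewrite integral_indic// setIT mule_gt0//.
  by apply: (open_measure_gt0 (gc e)); exists x.
apply: ge0_le_integral => //.
- by move=> y _; rewrite -EFinM lee_fin mulr_ge0// ltW.
- by apply: measurable_funeM; exact/measurable_EFinP.
- exact: lsc_measurable.
- move=> y _; rewrite indicE; case: (boolP (y \in U)) => [/set_mem Uy|_].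
    by rewrite mule1; exact: ltW.
  by rewrite mule0.
Qed.

(* Prékopa-Leindler applied to [h <= a], [b] and [b]: the mixing property says
   that [b] is as large as the log-concave function [a] up to its values on a
   null set. *)
Lemma integral_le_mix (a b : 'rV[R]_n -> \bar R) (l : R) (x0 : 'rV[R]_n) :
  0 < l < 1 -> (forall x, 0 <= a x)%E -> (forall x, 0 <= b x)%E ->
  lower_semicontinuous_rV b -> (0 < b x0)%E ->
  (forall x y, pl l (a x) (b y) (b ((1 - l) *: x + l *: y))) ->
  (\int[lebesgue_rV R n]_x a x <= \int[lebn]_x b x)%E.
Proof.
move=> l01 a0 b0 bc bx0 mix.
have mb : measurable_fun setT b by exact: lsc_measurable.
apply: integral_completed_le => // [|h mh ha]; first exact: sigma_finiteT.
apply: (pl_absorb l01); last exact: lsc_integral_gt0 bx0.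
apply: prekopa_leindler => // [x|x y]; first by case/andP: (ha x).
by apply: pl_le (mix x y) => //; case/andP: (ha x).
Qed.

End lsc_integral.

(** * Projections of extended-real functions *)

Section fiber_sup.
Context (R : realType) (n : nat) (F : {vspace 'rV[R]_n}).
Implicit Types g : 'rV[R]_n -> \bar R.

(** The analogue of [proj_fun] for extended-real functions such as [cone_reg] and [trunc]; at
    [EFin \o f] it is convertible to [proj_fun]. *)
Definition fiber_sup g (x : 'rV[R]_n) : \bar R :=
  ereal_sup [set g (x + v) | v in orthogonal_compl F].

Lemma orthogonal_compl0 : orthogonal_compl F 0.
Proof. by move=> u _; rewrite /dotv trmx0 mulmx0 mxE. Qed.

Lemma orthogonal_compl_lin (a b : R) (u v : 'rV[R]_n) :
  orthogonal_compl F u -> orthogonal_compl F v -> orthogonal_compl F (a *: u + b *: v).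
Proof.
move=> hu hv w wF; have := hu w wF; have := hv w wF.
rewrite /dotv linearD/= !linearZ/= mulmxDr -!scalemxAr !mxE => -> ->.
by rewrite !mulr0 addr0.
Qed.

Lemma fiber_sup_gtP g (s : R) x :
  (s%:E < fiber_sup g x)%E <-> exists2 v, orthogonal_compl F v & (s%:E < g (x + v)%R)%E.
Proof.
split=> [/ereal_sup_gt[_ [v hv <-] sv]|[v hv sv]]; first by exists v.
by apply: (lt_le_trans sv); apply: ereal_sup_ubound; exists v.
Qed.

Lemma fiber_sup_ge g x v : orthogonal_compl F v -> (g (x + v)%R <= fiber_sup g x)%E.
Proof. by move=> hv; apply: ereal_sup_ubound; exists v. Qed.

Lemma fiber_sup_le g g' x : (forall y, g y <= g' y)%E -> (fiber_sup g x <= fiber_sup g' x)%E.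
Proof.
move=> gg; apply: ge_ereal_sup => _ [v hv <-].
by apply: le_trans (gg _) _; exact: fiber_sup_ge.
Qed.

Lemma fiber_sup_ge0 g x : (forall y, 0 <= g y)%E -> (0 <= fiber_sup g x)%E.
Proof.
by move=> g0; apply: le_trans (g0 (x + 0)%R) _; apply: fiber_sup_ge; exact: orthogonal_compl0.
Qed.

Lemma fiber_sup_ub g x (J : \bar R) : (forall y, g y <= J)%E -> (fiber_sup g x <= J)%E.
Proof. by move=> gJ; apply: ge_ereal_sup => _ [v _ <-]. Qed.

Lemma fiber_sup_lsc g : lower_semicontinuous_rV g -> lower_semicontinuous_rV (fiber_sup g).
Proof.
move=> gc s; apply/openP_rV => x /= /fiber_sup_gtP[v hv sv].
have [e e0 ev] := (iffLR (openP_rV _) (gc s)) (x + v) sv.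
exists e => // y /(ball_rV _ _ e0) xy; apply/fiber_sup_gtP; exists v => //.
apply: ev; apply/(ball_rV _ _ e0) => i; rewrite !mxE opprD addrACA subrr addr0; exact: xy.
Qed.

(** The orthogonal complement is a subspace, so competitors over [x] and [y] combine to one over the
    combination. *)
Lemma fiber_sup_mix (l : R) g g' x y :
  (forall x y, pl l (g x) (g' y) (g' ((1 - l) *: x + l *: y))) ->
  pl l (fiber_sup g x) (fiber_sup g' y) (fiber_sup g' ((1 - l) *: x + l *: y)).
Proof.
move=> mix s t s0 t0 /fiber_sup_gtP[v hv sv] /fiber_sup_gtP[w hw tw].
apply: le_trans (mix _ _ s t s0 t0 sv tw) _.
rewrite !scalerDr addrACA; apply: fiber_sup_ge; exact: orthogonal_compl_lin.
Qed.

Lemma fiber_sup_concave g : pl_concave g -> pl_concave (fiber_sup g).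
Proof. by move=> gl l x y l01; apply: fiber_sup_mix => u v; exact: gl. Qed.

End fiber_sup.

(** * Orthonormal decompositions *)

Section orthonormal.
Context (R : realType) (n : nat).

Lemma onbK (F : {vspace 'rV[R]_n}) : onb F *m (onb F)^T = 1%:M.
Proof. by rewrite /onb; case: cid => B []. Qed.

Lemma mem_onb (F : {vspace 'rV[R]_n}) v : (v \in F) = (v <= onb F)%MS.
Proof.
rewrite /onb; case: cid => B [Bb _] /=.
have -> : (v \in F) = (v \in <<[tuple row i B | i < \dim F]>>%VS) by rewrite (span_basis Bb).
apply/idP/idP => [/coord_span ->|/submxP[c ->]].
  apply: summx_sub => i _; rewrite -tnth_nth tnth_mktuple.
  by rewrite scalemx_sub// row_sub.
rewrite mulmx_sum_row; apply: memv_suml => i _; apply/memvZ/memv_span.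
by apply/tnthP; exists i; rewrite tnth_mktuple.
Qed.

Lemma orthogonal_complE (F : {vspace 'rV[R]_n}) v :
  orthogonal_compl F v <-> onb F *m v^T = 0.
Proof.
split=> [vF|vF u].
  apply/row_matrixP => i; rewrite row_mul row0; apply/matrixP => a b.
  rewrite !ord1 [RHS]mxE; apply: vF; by rewrite mem_onb row_sub.
by rewrite mem_onb => /submxP[c ->]; rewrite /dotv -mulmxA vF mulmx0 mxE.
Qed.

Lemma submx_orthonormal m k (B : 'M[R]_(m, n)) (A : 'M[R]_(k, n)) :
  B *m B^T = 1%:M -> (A <= B)%MS = (A *m (B^T *m B) == A).
Proof.
move=> B1; apply/idP/eqP => [/submxP[c ->]|<-]; last by rewrite mulmxA submxMl.
by rewrite mulmxA -(mulmxA c) B1 mulmx1.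
Qed.

(** [C] is an orthonormal basis of the left kernel of [B^T]. For orthonormal rows, [B^T *m B] is the
    orthogonal projection onto the row space, and subspaces are compared through these matrices from
    here on. *)
Lemma orthonormal_complement m (B : 'M[R]_(m, n)) : B *m B^T = 1%:M ->
  exists p (C : 'M[R]_(p, n)),
    [/\ C *m C^T = 1%:M, B *m C^T = 0 & B^T *m B + C^T *m C = 1%:M].
Proof.
move=> B1; have [C C1 /eqmxP CE] := exists_orthonormal_rows (row_base_free (kermx B^T)).
have {}CE : (C :=: kermx B^T)%MS by apply: eqmx_trans (eq_row_base _); apply: eqmx_sym.
have CB : C *m B^T = 0 by apply/sub_kermxP; rewrite CE.
have BC : B *m C^T = 0 by apply: trmx_inj; rewrite trmx_mul trmxK CB trmx0.
exists _, C; split => //.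
have /submxP[D DE] : (1%:M - B^T *m B <= C)%MS.
  rewrite CE; apply/sub_kermxP.
  by rewrite mulmxBl mul1mx -mulmxA B1 mulmx1 subrr.
have : (1%:M - B^T *m B) *m C^T = D by rewrite DE -mulmxA C1 mulmx1.
rewrite mulmxBl mul1mx -mulmxA BC mulmx0 subr0 => CD.
by rewrite CD -DE addrC subrK.
Qed.

Lemma orthonormal_rows m (B : 'M[R]_(m, n)) :
  B *m B^T = 1%:M -> \tr (B^T *m B) = m%:R.
Proof. by move=> B1; rewrite mxtrace_mulC B1 mxtrace1. Qed.

Lemma orthogonal_compl_rows p (F : {vspace 'rV[R]_n}) (C : 'M[R]_(p, n)) v :
  onb F *m C^T = 0 -> (onb F)^T *m onb F + C^T *m C = 1%:M ->
  orthogonal_compl F v <-> exists b, v = b *m C.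
Proof.
move=> FC FC1; rewrite orthogonal_complE; split => [vF|[b ->]]; last first.
  by rewrite trmx_mul mulmxA FC mul0mx.
exists (v *m C^T).
have Fv : v *m (onb F)^T = 0 by apply: trmx_inj; rewrite trmx_mul trmxK vF trmx0.
by rewrite -[LHS]mulmx1 -FC1 mulmxDr !mulmxA Fv mul0mx add0r.
Qed.

Lemma col_mx_orthonormal k p (A : 'M[R]_(k, n)) (B : 'M[R]_(p, n)) :
  A *m A^T = 1%:M -> B *m B^T = 1%:M -> A *m B^T = 0 ->
  col_mx A B *m (col_mx A B)^T = 1%:M.
Proof.
move=> A1 B1 AB; rewrite tr_col_mx mul_col_row A1 B1 AB.
have -> : B *m A^T = 0 by apply: trmx_inj; rewrite trmx_mul trmxK AB trmx0.
by rewrite -scalar_mx_block.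
Qed.

Lemma tr_col_mx_mul k p (A : 'M[R]_(k, n)) (B : 'M[R]_(p, n)) :
  (col_mx A B)^T *m col_mx A B = A^T *m A + B^T *m B.
Proof. by rewrite tr_col_mx mul_row_col. Qed.

(** Equal projections mean equal row spaces: the traces identify the dimensions, and [A *m B^T] is
    the orthogonal change of coordinates. An integral on a subspace can thus be computed in any
    orthonormal basis. *)
Lemma integral_orthonormal_change d e (A : 'M[R]_(d, n)) (B : 'M[R]_(e, n))
    (g : 'rV[R]_n -> \bar R) :
  measurable_fun setT g -> (forall x, 0 <= g x)%E ->
  A *m A^T = 1%:M -> B *m B^T = 1%:M -> A^T *m A = B^T *m B ->
  (\int[borel_lebesgue_rV R d]_u g (u *m A)%R = \int[borel_lebesgue_rV R e]_u g (u *m B)%R)%E.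
Proof.
move=> mg g0 A1 B1 AB.
have de : d = e.
  have := orthonormal_rows A1; rewrite AB (orthonormal_rows B1) => /eqP.
  by rewrite eqr_nat => /eqP.
subst e.
have Q1 : (A *m B^T) *m (A *m B^T)^T = 1%:M.
  by rewrite trmx_mul trmxK mulmxA -(mulmxA A) -AB mulmxA A1 mul1mx A1.
rewrite -(integral_rV_orthogonal Q1 (f := fun u => g (u *m B))) //.
  by apply: eq_integral => u _; rewrite !mulmxA -(mulmxA (u *m A)) -AB !mulmxA -(mulmxA u A) A1 mulmx1.
exact: (measurableT_comp mg (measurable_mulmx_rV B)).
Qed.

End orthonormal.

Section adapted_basis.
Context (R : realType) (n : nat) (E H : {vspace 'rV[R]_n}).
Local Notation B0 := (onb (E :&: H)%VS).

(** The rows of [B0], [B1], [B2] form an orthonormal basis of the space. The last two equations,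
    between projections, say that [B0] and [B1] span [E] and that [B0] and [B2] span [H]; hence [B1]
    spans the complement of [H] and [B2] that of [E]. *)
Definition adapted_basis p q (B1 : 'M[R]_(p, n)) (B2 : 'M[R]_(q, n)) : Prop :=
  [/\ B1 *m B1^T = 1%:M, B2 *m B2^T = 1%:M, B0 *m B1^T = 0, B0 *m B2^T = 0 &
      B1 *m B2^T = 0] /\
  [/\ B0^T *m B0 + (B1^T *m B1 + B2^T *m B2) = 1%:M,
      (onb E)^T *m onb E = B0^T *m B0 + B1^T *m B1 &
      (onb H)^T *m onb H = B0^T *m B0 + B2^T *m B2].

(** Since the complement of [E] lies in [H], it is orthogonal to the complement of [H], so bases of
    the two complements can be put together. *)
Lemma exists_adapted_basis : orthogonal_compl E `<=` [set v | v \in H] ->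
  exists p q (B1 : 'M[R]_(p, n)) (B2 : 'M[R]_(q, n)), adapted_basis B1 B2.
Proof.
move=> EH.
have [q [B2 [B2o XB2 XB2s]]] := orthonormal_complement (onbK E).
have [p [B1 [B1o YB1 YB1s]]] := orthonormal_complement (onbK H).
exists p, q, B1, B2.
have B2H : (B2 <= onb H)%MS.
  apply/row_subP => i; rewrite -mem_onb; apply: EH.
  by apply/(orthogonal_compl_rows _ XB2 XB2s); exists (delta_mx 0 i); rewrite rowE.
have B0E : (B0 <= onb E)%MS.
  apply/row_subP => i; rewrite -mem_onb.
  by have := row_sub i B0; rewrite -mem_onb memv_cap => /andP[].
have B0H : (B0 <= onb H)%MS.
  apply/row_subP => i; rewrite -mem_onb.
  by have := row_sub i B0; rewrite -mem_onb memv_cap => /andP[].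
have B21 : B2 *m B1^T = 0 by have /submxP[D ->] := B2H; rewrite -mulmxA YB1 mulmx0.
have B12 : B1 *m B2^T = 0 by apply: trmx_inj; rewrite trmx_mul trmxK B21 trmx0.
have B01 : B0 *m B1^T = 0 by have /submxP[D ->] := B0H; rewrite -mulmxA YB1 mulmx0.
have B02 : B0 *m B2^T = 0 by have /submxP[D ->] := B0E; rewrite -mulmxA XB2 mulmx0.
have XE : (onb E)^T *m onb E = 1%:M - B2^T *m B2 by rewrite -XB2s addrK.
have YE : (onb H)^T *m onb H = 1%:M - B1^T *m B1 by rewrite -YB1s addrK.
(* [P] kills both complements, so its rows lie in [E] and in [H]; it is therefore the projection
   onto their intersection. *)
pose P := 1%:M - B1^T *m B1 - B2^T *m B2.
have PB2 : P *m B2^T = 0.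
  by rewrite /P !mulmxBl mul1mx -!mulmxA B12 B2o mulmx0 mulmx1 subr0 subrr.
have PB1 : P *m B1^T = 0.
  by rewrite /P !mulmxBl mul1mx -!mulmxA B21 B1o mulmx0 mulmx1 subrr subr0.
have PE : (P <= onb E)%MS.
  by rewrite (submx_orthonormal _ (onbK E)) XE mulmxBr mulmx1 mulmxA PB2 mul0mx subr0.
have PH : (P <= onb H)%MS.
  by rewrite (submx_orthonormal _ (onbK H)) YE mulmxBr mulmx1 mulmxA PB1 mul0mx subr0.
have PB0 : (P <= B0)%MS.
  apply/row_subP => i; rewrite -mem_onb memv_cap !mem_onb.
  by rewrite !(submx_trans (row_sub _ _)).
have B10 : B1 *m B0^T = 0 by apply: trmx_inj; rewrite trmx_mul trmxK B01 trmx0.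
have B20 : B2 *m B0^T = 0 by apply: trmx_inj; rewrite trmx_mul trmxK B02 trmx0.
have PB0t : P *m B0^T = B0^T.
  by rewrite /P !mulmxBl mul1mx -!mulmxA B10 B20 !mulmx0 !subr0.
have PE0 : P = B0^T *m B0.
  by move: PB0; rewrite (submx_orthonormal _ (onbK _)) mulmxA PB0t => /eqP.
split; split => //; rewrite -PE0 /P.
- by rewrite [X in _ + X]addrC addrA !subrK.
- by rewrite XE addrAC subrK.
- by rewrite YE subrK.
Qed.

Context (p q : nat) (B1 : 'M[R]_(p, n)) (B2 : 'M[R]_(q, n)).
Hypothesis hB : adapted_basis B1 B2.

Let B1o : B1 *m B1^T = 1%:M. Proof. by case: hB => -[]. Qed.
Let B2o : B2 *m B2^T = 1%:M. Proof. by case: hB => -[]. Qed.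
Let B01 : B0 *m B1^T = 0. Proof. by case: hB => -[]. Qed.
Let B02 : B0 *m B2^T = 0. Proof. by case: hB => -[]. Qed.
Let B12 : B1 *m B2^T = 0. Proof. by case: hB => -[]. Qed.
Let B1s : B0^T *m B0 + (B1^T *m B1 + B2^T *m B2) = 1%:M. Proof. by case: hB => _ []. Qed.
Let XE : (onb E)^T *m onb E = B0^T *m B0 + B1^T *m B1. Proof. by case: hB => _ []. Qed.
Let YE : (onb H)^T *m onb H = B0^T *m B0 + B2^T *m B2. Proof. by case: hB => _ []. Qed.
Let B21 : B2 *m B1^T = 0. Proof. by apply: trmx_inj; rewrite trmx_mul trmxK B12 trmx0. Qed.

Lemma adapted_basis_dim :
  [/\ \dim E = (\dim (E :&: H) + p)%N, \dim H = (\dim (E :&: H) + q)%N &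
      n = (\dim (E :&: H) + (p + q))%N].
Proof.
split; apply/eqP; rewrite -(eqr_nat R) !natrD.
- by rewrite -(orthonormal_rows (onbK E)) XE mxtraceD !orthonormal_rows// onbK.
- by rewrite -(orthonormal_rows (onbK H)) YE mxtraceD !orthonormal_rows// onbK.
- by rewrite -(mxtrace1 R n) -B1s !mxtraceD !orthonormal_rows// onbK.
Qed.

Lemma adapted_complE v : orthogonal_compl E v <-> exists b, v = b *m B2.
Proof.
apply: orthogonal_compl_rows; last by rewrite XE -addrA B1s.
have -> : onb E = onb E *m ((onb E)^T *m onb E) by rewrite mulmxA onbK mul1mx.
by rewrite XE -mulmxA mulmxDl -!mulmxA B02 B12 !mulmx0 addr0 mulmx0.
Qed.

Lemma adapted_complH v : orthogonal_compl H v <-> exists a, v = a *m B1.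
Proof.
apply: orthogonal_compl_rows; last by rewrite YE addrAC -addrA B1s.
have -> : onb H = onb H *m ((onb H)^T *m onb H) by rewrite mulmxA onbK mul1mx.
by rewrite YE -mulmxA mulmxDl -!mulmxA B01 B21 !mulmx0 addr0 mulmx0.
Qed.

Lemma adapted_complEH v :
  orthogonal_compl (E :&: H)%VS v <-> exists a b, v = a *m B1 + b *m B2.
Proof.
rewrite (@orthogonal_compl_rows _ _ (p + q) _ (col_mx B1 B2)).
- split => [[c ->]|[a [b ->]]]; last by exists (row_mx a b); rewrite mul_row_col.
  by exists (lsubmx c), (rsubmx c); rewrite -mul_row_col hsubmxK.
- by rewrite tr_col_mx mul_mx_row B01 B02 row_mx0.
- by rewrite tr_col_mx_mul.
Qed.

Local Notation leb d := (borel_lebesgue_rV R d).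

Lemma integral_adaptedE (g : 'rV[R]_n -> \bar R) :
  measurable_fun setT g -> (forall x, 0 <= g x)%E ->
  (\int[leb (\dim E)]_u g (u *m onb E)%R =
   \int[leb (\dim (E :&: H))]_w \int[leb p]_a g (w *m B0 + a *m B1)%R)%E.
Proof.
move=> mg g0.
rewrite (integral_orthonormal_change mg g0 (onbK E) (B := col_mx B0 B1)).
- rewrite integral_row_mx => [| |//]; last exact: (measurableT_comp mg (measurable_mulmx_rV _)).
  by apply: eq_integral => w _; apply: eq_integral => a _; rewrite mul_row_col.
- by apply: col_mx_orthonormal => //; exact: onbK.
- by rewrite tr_col_mx_mul.
Qed.

Lemma integral_adaptedH (g : 'rV[R]_n -> \bar R) :
  measurable_fun setT g -> (forall x, 0 <= g x)%E ->
  (\int[leb (\dim H)]_u g (u *m onb H)%R =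
   \int[leb (\dim (E :&: H))]_w \int[leb q]_b g (w *m B0 + b *m B2)%R)%E.
Proof.
move=> mg g0.
rewrite (integral_orthonormal_change mg g0 (onbK H) (B := col_mx B0 B2)).
- rewrite integral_row_mx => [| |//]; last exact: (measurableT_comp mg (measurable_mulmx_rV _)).
  by apply: eq_integral => w _; apply: eq_integral => a _; rewrite mul_row_col.
- by apply: col_mx_orthonormal => //; exact: onbK.
- by rewrite tr_col_mx_mul.
Qed.

Lemma integral_adapted (g : 'rV[R]_n -> \bar R) :
  measurable_fun setT g -> (forall x, 0 <= g x)%E ->
  (\int[leb n]_x g x = \int[leb (\dim (E :&: H))]_w \int[leb p]_a \int[leb q]_b
     g (w *m B0 + (a *m B1 + b *m B2))%R)%E.
Proof.
move=> mg g0.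
transitivity (\int[leb n]_x g (x *m 1%:M)%R)%E.
  by apply: eq_integral => x _; rewrite mulmx1.
rewrite (integral_orthonormal_change mg g0 _ (B := col_mx B0 (col_mx B1 B2))).
- have mA k (A : 'M[R]_(k, n)) : measurable_fun setT (fun x => g (x *m A)).
    exact: (measurableT_comp mg (measurable_mulmx_rV _)).
  rewrite integral_row_mx//; apply: eq_integral => w _.
  pose h z := g (w *m B0 + z *m col_mx B1 B2).
  have mh : measurable_fun setT h.
    rewrite /h; under eq_fun do rewrite addrC.
    apply: (measurableT_comp mg).
    exact: (measurableT_comp (measurable_rV_addr _) (measurable_mulmx_rV _)).
  transitivity (\int[leb (p + q)]_z h z)%E.
    by apply: eq_integral => z _; rewrite mul_row_col.
  rewrite (integral_row_mx mh (fun z => g0 _)).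
  by apply: eq_integral => a _; apply: eq_integral => b _; rewrite /h mul_row_col.
- by rewrite trmx1 mulmx1.
- apply: col_mx_orthonormal; [exact: onbK|exact: col_mx_orthonormal|].
  by rewrite tr_col_mx mul_mx_row B01 B02 row_mx0.
- by rewrite !tr_col_mx_mul trmx1 mulmx1 B1s.
Qed.

End adapted_basis.

(** * Slices *)

Section affine_slices.
Context (R : realType).

Definition mx_norm1 m n (A : 'M[R]_(m, n)) : R := \sum_i \sum_j `|A i j|.

Lemma mx_norm1_ge0 m n (A : 'M[R]_(m, n)) : 0 <= mx_norm1 A.
Proof. by apply: sumr_ge0 => i _; apply: sumr_ge0. Qed.

Lemma mulmx_coord_le m n (A : 'M[R]_(m, n)) (u : 'rV[R]_m) (e : R) (i : 'I_n) :
  0 <= e -> (forall j, `|u ord0 j| <= e) -> `|(u *m A) ord0 i| <= e * mx_norm1 A.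
Proof.
move=> e0 ue; rewrite mxE; apply: le_trans (ler_norm_sum _ _ _) _.
rewrite mulr_sumr; apply: ler_sum => j _; rewrite normrM.
apply: ler_pM => //; rewrite (bigD1 i)//= lerDl; exact: sumr_ge0.
Qed.

Lemma mx_norm1_tr m n (A : 'M[R]_(m, n)) : mx_norm1 A^T = mx_norm1 A.
Proof.
rewrite /mx_norm1 exchange_big; apply: eq_bigr => i _; apply: eq_bigr => j _.
by rewrite mxE.
Qed.

Lemma ball_cube_mulmx m n (A : 'M[R]_(m, n)) (J K : R) (x : 'rV[R]_n) :
  J * mx_norm1 A <= K -> ball 0 J x -> cube K (x *m A^T).
Proof.
move=> AK b i; have J0 : 0 < J by case: b.
have xJ := iffLR (ball_rV _ _ J0) b.
rewrite in_itv/= -ler_norml; apply: le_trans AK; rewrite -mx_norm1_tr.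
apply: mulmx_coord_le => [|j]; first exact: ltW.
by have := xJ j; rewrite mxE sub0r normrN; exact: ltW.
Qed.

Lemma lower_semicontinuous_affine m n (A : 'M[R]_(m, n)) (c : 'rV[R]_n)
    (g : 'rV[R]_n -> \bar R) :
  lower_semicontinuous_rV g -> lower_semicontinuous_rV (fun u => g (c + u *m A)).
Proof.
move=> gc s; apply/openP_rV => u /= su.
have [e e0 eg] := iffLR (openP_rV _) (gc s) (c + u *m A) su.
have S0 := mx_norm1_ge0 A.
have S1 : 0 < 1 + mx_norm1 A by rewrite ltr_pwDl.
have d0 : 0 < e / (1 + mx_norm1 A) by rewrite divr_gt0.
exists (e / (1 + mx_norm1 A)) => // v /(ball_rV _ _ d0) uv; apply: eg.
apply/(ball_rV _ _ e0) => i.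
have -> : (c + u *m A) ord0 i - (c + v *m A) ord0 i = ((u - v) *m A) ord0 i.
  by rewrite mulmxBl !mxE opprD addrACA subrr add0r.
apply: (@le_lt_trans _ _ (e / (1 + mx_norm1 A) * mx_norm1 A)).
  by apply: mulmx_coord_le => [|j]; rewrite ?(ltW d0)// !mxE; exact: ltW.
by rewrite -mulrA gtr_pMr// mulrC ltr_pdivrMr// mul1r ltrDr.
Qed.

End affine_slices.

Section slice.
Context (R : realType) (n k p q : nat) (V W : {vspace 'rV[R]_n}).
Context (B0 : 'M[R]_(k, n)) (B : 'M[R]_(p.+1, n)) (C : 'M[R]_(q, n)).
Hypotheses (B0o : B0 *m B0^T = 1%:M) (Bo : B *m B^T = 1%:M).
Hypotheses (B0B : B0 *m B^T = 0) (CB0 : C *m B0^T = 0) (CB : C *m B^T = 0).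
Hypothesis VC : forall v, orthogonal_compl V v <-> exists b, v = b *m C.
Hypothesis WBC : forall v, orthogonal_compl W v <-> exists a b, v = a *m B + b *m C.

(** [V] stands for [E] or for [H], [W] for their intersection, and [C] spans the complement of [V];
    one development then serves both projections with the roles of [B1] and [B2] exchanged. *)
Definition slice (g : 'rV[R]_n -> \bar R) (w : 'rV[R]_k) (a : 'rV[R]_p.+1) : \bar R :=
  fiber_sup V g (w *m B0 + a *m B).

Lemma measurable_slice g : lower_semicontinuous_rV g ->
  measurable_fun setT (fun z => slice g z.1 z.2).
Proof.
move=> gc; apply: (measurableT_comp (lsc_measurable (fiber_sup_lsc (F := V) gc))).
pose h (z : 'rV[R]_k * 'rV[R]_p.+1) := (z.1 *m B0, z.2 *m B).
have mh : measurable_fun setT h.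
  apply/measurable_fun_pairP; split.
    exact: (measurableT_comp (measurable_mulmx_rV B0) measurable_fst).
  exact: (measurableT_comp (measurable_mulmx_rV B) measurable_snd).
exact: (measurableT_comp (@measurable_rV_add R n) mh).
Qed.

Lemma slice_gtP g (s : R) w a : (s%:E < slice g w a)%E <->
  exists b, (s%:E < g (w *m B0 + a *m B + b *m C)%R)%E.
Proof.
rewrite fiber_sup_gtP; split=> [[v /VC[b ->] sb]|[b sb]]; first by exists b.
by exists (b *m C) => //; apply/VC; exists b.
Qed.

Lemma bounded_log_concave_slice g (J K : R) :
  J * mx_norm1 B0 <= K -> J * mx_norm1 B <= K ->
  (forall x, 0 <= g x <= J%:E)%E -> (forall x, (0 < g x)%E -> ball 0 J x) ->
  lower_semicontinuous_rV g -> pl_concave g -> bounded_log_concave (slice g) J K.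
Proof.
move=> JB0 JB gJ gb gc gl; split.
- exact: measurable_slice.
- move=> w a; rewrite fiber_sup_ge0/= => [|x]; last by case/andP: (gJ x).
  by apply: fiber_sup_ub => x; case/andP: (gJ x).
- move=> w a /slice_gtP[b /gb xb].
  have := ball_cube_mulmx JB0 xb; have := ball_cube_mulmx JB xb.
  rewrite !mulmxDl -!mulmxA B0o Bo B0B CB0 CB !mulmx0 !mulmx1 !addr0 add0r.
  have -> : B *m B0^T = 0 by apply: trmx_inj; rewrite trmx_mul trmxK B0B trmx0.
  by rewrite mulmx0 addr0.
- move=> l w1 a1 w2 a2 l01; rewrite /slice.
  have -> : ((1 - l) *: w1 + l *: w2) *m B0 + ((1 - l) *: a1 + l *: a2) *m B =
      (1 - l) *: (w1 *m B0 + a1 *m B) + l *: (w2 *m B0 + a2 *m B).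
    by rewrite !mulmxDl !scalerDr -!scalemxAl addrACA.
  exact: fiber_sup_concave.
Qed.

(* A fiber has positive volume as soon as it is nonempty, because it is open. *)
Lemma slice_radius_gt0 g (J K : R) z : 0 <= K -> bounded_log_concave (slice g) J K ->
  lower_semicontinuous_rV g ->
  (0 < fiber_radius (slice g) z) =
    (0 < (z.2 : R)) && ((z.2 : R)%:E < fiber_sup W g (z.1 *m B0))%E.
Proof.
move=> K0 blc gc; rewrite (fiber_radius_gt0 K0 blc); case: (boolP (0 < (z.2 : R))) => //= z0.
apply/idP/idP => [|/fiber_sup_gtP[v /WBC[a [b ->]]]].
  rewrite lt0e => /andP[/eqP vz _]; apply/fiber_sup_gtP; apply: contrapT => no; apply: vz.
  rewrite /fiber_vol (_ : [set a | _] = set0) ?measure0// -subset0 => a /slice_gtP[b sb].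
  apply: no; exists (a *m B + b *m C); first by apply/WBC; exists a, b.
  by rewrite addrA.
rewrite addrA => sab; apply: open_measure_gt0; last by exists a; apply/slice_gtP; exists b.
exact: (@lower_semicontinuous_affine _ _ _ B (z.1 *m B0) _ (fiber_sup_lsc (F := V) gc) (z.2 : R)).
Qed.

End slice.

Lemma nondecreasing_cvg_gt (R : realType) (u : nat -> \bar R) (l : \bar R) :
  nondecreasing_seq u -> (forall j, 0 <= u j)%E -> (forall j, u j <= l)%E ->
  (forall s : R, 0 <= s -> (s%:E < l)%E -> exists j, (s%:E < u j)%E) ->
  u @ \oo --> l.
Proof.
move=> nd u0 ul hl; suff <- : ereal_sup (range u) = l by exact: ereal_nondecreasing_cvgn.
apply/eqP; rewrite eq_le ge_ereal_sup => [/=|_ [j _ <-]//].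
have su0 : (0 <= ereal_sup (range u))%E.
  by apply: le_trans (u0 0%N) _; apply: ereal_sup_ubound; exists 0%N.
rewrite leNgt; apply/negP => sl.
have sfin : ereal_sup (range u) \is a fin_num.
  by rewrite ge0_fin_numE// (lt_le_trans sl)// leey.
have [||j] := hl (fine (ereal_sup (range u))); rewrite ?fine_ge0 ?fineK//.
by apply/negP; rewrite -leNgt; apply: ereal_sup_ubound; exists j.
Qed.

(** * The inequality for lower semicontinuous functions *)

Section adapted_inequality.
Context (R : realType) (n : nat) (E H : {vspace 'rV[R]_n}).
Context (p q : nat) (B1 : 'M[R]_(p.+1, n)) (B2 : 'M[R]_(q.+1, n)).
Hypothesis hB : adapted_basis E H B1 B2.
Local Notation B0 := (onb (E :&: H)%VS).
Local Notation k := (\dim (E :&: H)).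
Local Notation leb d := (borel_lebesgue_rV R d).

Let B0o : B0 *m B0^T = 1%:M. Proof. exact: onbK. Qed.
Let B1o : B1 *m B1^T = 1%:M. Proof. by case: hB => -[]. Qed.
Let B2o : B2 *m B2^T = 1%:M. Proof. by case: hB => -[]. Qed.
Let B01 : B0 *m B1^T = 0. Proof. by case: hB => -[]. Qed.
Let B02 : B0 *m B2^T = 0. Proof. by case: hB => -[]. Qed.
Let B12 : B1 *m B2^T = 0. Proof. by case: hB => -[]. Qed.
Let B10 : B1 *m B0^T = 0. Proof. by apply: trmx_inj; rewrite trmx_mul trmxK B01 trmx0. Qed.
Let B20 : B2 *m B0^T = 0. Proof. by apply: trmx_inj; rewrite trmx_mul trmxK B02 trmx0. Qed.
Let B21 : B2 *m B1^T = 0. Proof. by apply: trmx_inj; rewrite trmx_mul trmxK B12 trmx0. Qed.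

Let complEH12 := adapted_complEH hB.
Let complEH21 v : orthogonal_compl (E :&: H)%VS v <-> exists b a, v = b *m B2 + a *m B1.
Proof.
rewrite complEH12; split=> -[a [b ->]]; exists b, a; exact: addrC.
Qed.

Local Notation sliceE := (slice E B0 B1).
Local Notation sliceH := (slice H B0 B2).
Local Notation top g w := (fiber_sup (E :&: H)%VS g (w *m B0)).

Lemma slice_inequality_bounded (g : 'rV[R]_n -> \bar R) (J : R) : 0 <= J ->
  (forall x, 0 <= g x <= J%:E)%E -> (forall x, (0 < g x)%E -> ball 0 J x) ->
  lower_semicontinuous_rV g -> pl_concave g ->
  ((\int[leb k]_w top g w) * (\int[leb n]_x g x) <=
   'C(p.+1 + q.+1, q.+1)%:R%:E *
   ((\int[leb k]_w \int[leb p.+1]_a sliceE g w a) *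
    (\int[leb k]_w \int[leb q.+1]_b sliceH g w b)))%E.
Proof.
move=> J0 gJ gb gc gl.
have g0 x : (0 <= g x)%E by case/andP: (gJ x).
(* One cube size for the coordinates of the support in all three blocks. *)
pose K := J * (mx_norm1 B0 + (mx_norm1 B1 + mx_norm1 B2)).
have N0 := mx_norm1_ge0 B0; have N1 := mx_norm1_ge0 B1; have N2 := mx_norm1_ge0 B2.
have K0 : 0 <= K by rewrite mulr_ge0// !addr_ge0.
have KB0 : J * mx_norm1 B0 <= K by apply: ler_wpM2l => //; lra.
have KB1 : J * mx_norm1 B1 <= K by apply: ler_wpM2l => //; lra.
have KB2 : J * mx_norm1 B2 <= K by apply: ler_wpM2l => //; lra.
have blcE := bounded_log_concave_slice B0o B1o B01 B20 B21 (adapted_complE hB) KB0 KB1 gJ gb gc gl.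
have blcH := bounded_log_concave_slice B0o B2o B02 B10 B12 (adapted_complH hB) KB0 KB2 gJ gb gc gl.
have rE := slice_radius_gt0 (adapted_complE hB) complEH12 _ K0 blcE gc.
have rH := slice_radius_gt0 (adapted_complH hB) complEH21 _ K0 blcH gc.
(* Both radii are positive exactly when [0 < s < top g w], so their positivity sets coincide. *)
have := fiber_inequality K0 blcE blcH (fun z => etrans (rE z) (esym (rH z))).
apply: le_trans; apply: lee_pmul.
- by apply: integral_ge0 => w _; exact: fiber_sup_ge0.
- by apply: integral_ge0.
(* For fixed [w], the heights of positive radius form the interval from 0 to [top g w], whose length
   is [top g w]. *)
- rewrite measure_rV_lebesgue_prod; apply: le_integral_lower => w.
    exact: fiber_sup_ge0.
  have : (top g w <= J%:E)%E by apply: fiber_sup_ub => x; case/andP: (gJ x).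
  have := fiber_sup_ge0 (E :&: H)%VS (w *m B0) g0.
  have := rE (w, _); move: (top g w) => [m|//|//] rEw; rewrite lee_fin => m0 _.
  rewrite (_ : [set s | _] = `]0, m[%classic); last first.
    by apply/seteqP; split => s /=; rewrite rEw /= lte_fin in_itv.
  rewrite lebesgue_measure_itv/= lte_fin; case: ltP => [_|]; first by rewrite -EFinB subr0.
  by rewrite lee_fin.
- rewrite (integral_adapted hB (lsc_measurable gc) g0).
  apply: le_integral_lower => w; first by apply: integral_ge0 => a _; exact: integral_ge0.
  apply: le_integral_lower => a; first exact: integral_ge0.
  apply: le_integral_lower => b //; rewrite le_min; apply/andP; split.
    by rewrite addrA; apply: fiber_sup_ge; apply/(adapted_complE hB); exists b.
  rewrite [_ *m B1 + _]addrC addrA; apply: fiber_sup_ge.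
  by apply/(adapted_complH hB); exists a.
Qed.

(** The factors on the left may be infinite. Numbers below each of them are exceeded by truncations,
    which a common truncation level dominates. *)
Lemma slice_inequality (g : 'rV[R]_n -> \bar R) :
  (forall x, 0 <= g x)%E -> lower_semicontinuous_rV g -> pl_concave g ->
  ((\int[leb k]_w top g w) * (\int[leb n]_x g x) <=
   'C(p.+1 + q.+1, q.+1)%:R%:E *
   ((\int[leb k]_w \int[leb p.+1]_a sliceE g w a) *
    (\int[leb k]_w \int[leb q.+1]_b sliceH g w b)))%E.
Proof.
move=> g0 gc gl; pose h (j : nat) := trunc g j%:R.
have h0 j x : (0 <= h j x)%E by exact: trunc_ge0.
have hc j : lower_semicontinuous_rV (h j) by exact: trunc_lsc.
have hg j x : (h j x <= g x)%E by exact: trunc_le.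
have hnd i j x : (i <= j)%N -> (h i x <= h j x)%E by exact: trunc_nd.
have mtop f : lower_semicontinuous_rV f -> measurable_fun setT (fun w => top f w).
  move=> fc; apply: (measurableT_comp (lsc_measurable (fiber_sup_lsc (F := (E :&: H)%VS) fc))).
  exact: measurable_mulmx_rV.
have sE0 (f : 'rV[R]_n -> \bar R) w a : (forall x, 0 <= f x)%E -> (0 <= sliceE f w a)%E.
  by move=> f0; exact: fiber_sup_ge0.
have sH0 (f : 'rV[R]_n -> \bar R) w b : (forall x, 0 <= f x)%E -> (0 <= sliceH f w b)%E.
  by move=> f0; exact: fiber_sup_ge0.
apply: mule_le_lt.
- by apply: integral_ge0 => w _; exact: fiber_sup_ge0.
- exact: integral_ge0.
- by rewrite !mule_ge0// ?lee_fin//; apply: integral_ge0 => w _; apply: integral_ge0 => a _;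
    [exact: sE0|exact: sH0].
move=> s t s0 t0 sM tg.
have [i si] : exists i, (s%:E < \int[leb k]_w top (h i) w)%E.
  apply: (lt_integral_monotone (f := fun w => top g w)) => //.
  - by move=> j; exact: mtop.
  - by move=> j w; exact: fiber_sup_ge0.
  - by move=> w j l jl; apply: fiber_sup_le => x; exact: hnd.
  - move=> w; apply: nondecreasing_cvg_gt => [j l jl|j|j|r r0].
    + by apply: fiber_sup_le => x; exact: hnd.
    + exact: fiber_sup_ge0.
    + exact: fiber_sup_le.
    + move=> /fiber_sup_gtP[v hv /(trunc_gt_near r0)[j rj]].
      by exists j; apply/fiber_sup_gtP; exists v.
have [j tj] : exists j, (t%:E < \int[leb n]_x h j x)%E.
  apply: (lt_integral_monotone (f := g)) => //.
  - by move=> j; exact: lsc_measurable.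
  - by move=> x j l jl; exact: hnd.
  - move=> x; apply: nondecreasing_cvg_gt => // [a b|r r0]; first exact: hnd.
    exact: trunc_gt_near.
(* The successor keeps the truncation level positive. *)
pose J := (maxn i j).+1.
have J0 : (0 : R) < J%:R by rewrite ltr0n.
have iJ : (i <= J)%N by rewrite leqW// leq_maxl.
have jJ : (j <= J)%N by rewrite leqW// leq_maxr.
have := @slice_inequality_bounded (h J) J%:R (ltW J0).
have hJ x : (0 <= h J x <= J%:R%:E)%E by rewrite h0 trunc_leJ// ltW.
have hb x : (0 < h J x)%E -> ball 0 (J%:R : R) x.
  by move=> /(iffLR (trunc_gt _ _ _ (lexx 0)))[].
move=> /(_ hJ hb (hc J) (trunc_concave gl J0)) ineq.
apply: (@le_trans _ _ ((\int[leb k]_w top (h J) w) * (\int[leb n]_x h J x))%E).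
  rewrite EFinM; apply: lee_pmul; [by rewrite lee_fin ltW|by rewrite lee_fin ltW| |].
    apply: le_trans (ltW si) _; apply: le_integral_lower => w; first exact: fiber_sup_ge0.
    by apply: fiber_sup_le => x; exact: hnd.
  by apply: le_trans (ltW tj) _; apply: le_integral_lower => // x; exact: hnd.
apply: le_trans ineq _; apply: lee_wpmul2l; first by rewrite lee_fin.
apply: lee_pmul.
- by apply: integral_ge0 => w _; apply: integral_ge0 => a _; exact: sE0.
- by apply: integral_ge0 => w _; apply: integral_ge0 => a _; exact: sH0.
- apply: le_integral_lower => w; first by apply: integral_ge0 => a _; exact: sE0.
  by apply: le_integral_lower => a; [exact: sE0|exact: fiber_sup_le].
- apply: le_integral_lower => w; first by apply: integral_ge0 => a _; exact: sH0.
  by apply: le_integral_lower => a; [exact: sH0|exact: fiber_sup_le].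
Qed.

End adapted_inequality.

(** * From the minorant back to the given function *)

Lemma le_integral_on (R : realType) (n : nat) (F : {vspace 'rV[R]_n})
    (f : 'rV[R]_n -> R) (g : 'rV[R]_n -> \bar R) :
  (forall x, 0 <= g x)%E -> (forall x, g x <= (f x)%:E)%E -> lower_semicontinuous_rV g ->
  (\int[borel_lebesgue_rV R (\dim F)]_u fiber_sup F g (u *m onb F)%R <=
   integral_on F (proj_fun F f))%E.
Proof.
move=> g0 gf gc; apply: le_integral_completed => [|u|u].
- apply: (measurableT_comp (lsc_measurable (fiber_sup_lsc (F := F) gc))).
  exact: measurable_mulmx_rV.
- exact: fiber_sup_ge0.
- exact: (@fiber_sup_le _ _ F g (EFin \o f)).
Qed.

(** The mixing of [f] with its minorant [g] passes to their projections, so [integral_le_mix]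
    applies on [F], and projecting [g] instead of [f] loses nothing in the integral. *)
Lemma integral_on_le (R : realType) (n : nat) (F : {vspace 'rV[R]_n})
    (f : 'rV[R]_n -> R) (g : 'rV[R]_n -> \bar R) (c : 'rV[R]_n) (l : R) : 0 < l < 1 ->
  (forall x, 0 <= f x) -> (forall x, 0 <= g x)%E -> lower_semicontinuous_rV g ->
  (0 < g c)%E ->
  (forall x y, pl l (f x)%:E (g y) (g ((1 - l) *: x + l *: y))) ->
  (integral_on F (proj_fun F f) <=
   \int[borel_lebesgue_rV R (\dim F)]_u fiber_sup F g (u *m onb F)%R)%E.
Proof.
move=> l01 f0 g0 gc gc0 mix.
apply: (@integral_le_mix _ _ _ _ l (c *m (onb F)^T)) => // [u|u|s| |x y].
- by apply: (@fiber_sup_ge0 _ _ F (EFin \o f)) => x; rewrite lee_fin.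
- exact: fiber_sup_ge0.
- have := @lower_semicontinuous_affine _ _ _ (onb F) 0 _ (fiber_sup_lsc (F := F) gc) s.
  by under eq_set do rewrite add0r.
(* The projection of [g] is positive at the orthogonal projection of [c] on [F], since the fiber
   over that point contains [c]. *)
- apply/fiber_sup_gtP; exists (c - c *m (onb F)^T *m onb F); last by rewrite addrC subrK.
  apply/orthogonal_complE; apply: trmx_inj; rewrite trmx_mul trmxK trmx0.
  by rewrite mulmxBl -[_ *m onb F *m _]mulmxA onbK mulmx1 subrr.
- rewrite mulmxDl -!scalemxAl.
  exact: (@fiber_sup_mix _ _ F l (EFin \o f) g).
Qed.

Theorem theorem1p9 (R : realType) (n i j : nat) (E H : {vspace 'rV[R]_n})
    (f : 'rV[R]_n -> R)
    (hf : integrable_log_concave f)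
    (dimE : \dim E = i) (dimH : \dim H = j)
    (hi : (2 <= i <= n - 1)%N) (hj : (2 <= j <= n - 1)%N)
    (hij : (n + 1 <= i + j)%N)
    (hEH : orthogonal_compl E `<=` [set v | v \in H]) :
  let k := (i + j - n)%N in
  (integral_on (E :&: H)%VS (proj_fun (E :&: H)%VS f) *
     \int[lebesgue_rV R n]_z (f z)%:E <=
   'C(n - k, n - i)%:R%:E *
     (integral_on E (proj_fun E f) * integral_on H (proj_fun H f)))%E.
Proof.
case: hf => f0 fl _; cbv zeta.
have proj0 F : (0 <= integral_on F (proj_fun F f))%E.
  apply: integral_ge0 => u _.
  by apply: (@fiber_sup_ge0 _ _ F (EFin \o f)) => x; rewrite lee_fin.
(* If the integral of [f] is 0, the left side is 0 even when the projection has an infinite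
   integral. *)
have [[c [r [m [r0 m0 mf]]]]|->] := log_concave_interior f0 fl; last first.
  by rewrite mule0 !mule_ge0// lee_fin.
pose g := cone_reg f c r m.
have g0 x : (0 <= g x)%E by exact: cone_reg_ge0.
have gc : lower_semicontinuous_rV g by exact: cone_reg_lsc.
have gl : pl_concave g by exact: cone_reg_concave.
have gf x : (g x <= (f x)%:E)%E by exact: cone_reg_le.
have gc0 : (0 < g c)%E by exact: cone_reg_gt0.
have l01 : 0 < (2^-1 : R) < 1 by rewrite invr_gt0 ltr0n invf_lt1 ?ltr1n // ltr0n.
have mix x y : pl 2^-1 (f x)%:E (g y) (g ((1 - 2^-1) *: x + 2^-1 *: y)).
  exact: cone_reg_mix.
have [p [q [B1 [B2 hB]]]] := exists_adapted_basis hEH.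
have [dE dH dn] := adapted_basis_dim hB.
(* The dimensions [p = n - j] and [q = n - i] are positive because [i] and [j] are at most
   [n - 1]. *)
have [p' p'E] : exists p', p = p'.+1 by exists p.-1; lia.
have [q' q'E] : exists q', q = q'.+1 by exists q.-1; lia.
subst p q.
have -> : (n - (i + j - n))%N = (p'.+1 + q'.+1)%N by lia.
have -> : (n - i)%N = q'.+1 by lia.
(* On the left [f] is bounded by its minorant through the mixing property, on the right the minorant
   by [f] through monotonicity. *)
apply: le_trans (le_trans (slice_inequality hB g0 gc gl) _).
  apply: lee_pmul; rewrite ?proj0//.
  - by apply: integral_ge0 => x _; rewrite lee_fin.
  - exact: (integral_on_le _ l01 f0 g0 gc gc0 mix).
  - exact: (@integral_le_mix _ _ _ _ 2^-1 c).
apply: lee_wpmul2l; first by rewrite lee_fin.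
have mE := lsc_measurable (fiber_sup_lsc (F := E) gc).
have mH := lsc_measurable (fiber_sup_lsc (F := H) gc).
have pE x : (0 <= fiber_sup E g x)%E by exact: fiber_sup_ge0.
have pH x : (0 <= fiber_sup H g x)%E by exact: fiber_sup_ge0.
rewrite /slice -(integral_adaptedE hB mE pE) -(integral_adaptedH hB mH pH).
by apply: lee_pmul; rewrite ?integral_ge0// le_integral_on.
Qed.
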